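(* Let $k$ be a field of characteristic zero and $q\in k^\times$ not a root of unity. Let $r,s\in\mathbb Z$ with $s\ge1$ and $\gcd(r,s)=1$, and let $f\in S$. (i) $V_{r,s}(f)$ is an irreducible $D_q$-module over $k((t))$. Moreover, $V_{r,s}(f)\cong V_{r',s'}(g)$ if and only if $(r,s)=(r',s')$ and $f,g$ lie in the same $\langle\sigma_q\rangle$-orbit in $S$. Every irreducible $D_q$-module over $k((t))$ is isomorphic to some $V_{r,s}(f)$. (ii) $ext_{\bar k}(V_{r,s}(f))\cong\bigoplus_{\lambda\in\mathcal O_f}V_{r,s}(\lambda)$ as $D_q$-modules over $\bar k((t))_0$. (iii) Every indecomposable $D_q$-module over $k((t))$ is isomorphic to some $J_d\otimes V_{r,s}(f)$. The data $(d,r,s,\bar f)$ are uniquely determined, where $\bar f$ is the $\langle\sigma_q\rangle$-orbit of $f$.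
   Context: A $D_q$-module over a field $F\in\{k((t)),\ \bar k((t))_0\}$ is a finite-dimensional $F$-space $V$ with a bijective additive $\Phi$ such that $\Phi(av)=\sigma_q(a)\Phi(v)$. Here: - $\sigma_q(a(t))=a(qt)$; - $\bar k$ is an algebraic closure of $k$; - $\bar k((t))_0=k((t))\otimes_k\bar k$, which is the union of $K((t))$ over finite extensions $K/k$ inside $\bar k$. $ext_{\bar k}$ is the functor $V\mapsto V\otimes_k\bar k$ with $\Phi\otimes\mathrm{id}$. For $\lambda\in\bar k^\times$, $V_{r,s}(\lambda)$ is $R/R(T^s-\lambda t^r)$ over $\bar k((t))_0$, where $R$ is the skew polynomial ring with $Ta=\sigma_q(a)T$ and $\Phi$ is left multiplication by $T$. $J_d$ over $k((t))$ is $k((t))_q[T]/k((t))_q[T](T-1)^d$. $S$ is the set of monic irreducible polynomials in $k[x]$ with nonzero constant term. For $f\in S$, $\mathcal O_f\subset\bar k^\times$ is its set of roots. $\sigma_q$ acts on $S$ by $(\sigma_qf)(x)=q^{-\deg f}f(qx)$. For $f(x)=x^m-a_{m-1}x^{m-1}-\dots-a_0\in S$, the module $V_{r,s}(f)$ is the $D_q$-module over $k((t))$ with $k((t))$-basis $\{\Phi^iv_j: 0\le i\le s-1,\ 0\le j\le m-1\}$ and the relations - $\Phi^sv_j=t^rv_{j+1}$ for $0\le j\le m-2$; - $\Phi^sv_{m-1}=t^r(a_0v_0+\dots+a_{m-1}v_{m-1})$. Equivalently, it is $k((t))_q[T]$ modulo the left ideal generated by $q^{-\frac12 srm(m-1)}t^{-rm}T^{sm}-\sum_{j=0}^{m-1}q^{-\frac12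 srj(j-1)}a_jt^{-rj}T^{sj}$, with $\Phi$ given by left multiplication by $T$. *)

(* Defs.v *)
From HB Require Import structures.
From mathcomp Require Import all_boot all_order all_algebra.
From Stdlib Require Import ClassicalEpsilon FunctionalExtensionality Classical.
Set Implicit Arguments. Unset Strict Implicit. Unset Printing Implicit Defensive.
Import GRing.Theory.
Local Open Scope ring_scope.

Lemma pdec (P : Prop) : {P} + {~ P}.
Proof.
have /constructive_indefinite_description [[] Hb] :
  exists b : bool, if b then P else ~ P.
  by case: (classic P) => H; [exists true | exists false].
by left. by right.
Qed.

Record pser (K : Type) := PS { pcoef : nat -> K }.

Section PSer.
Variable K : fieldType.
Implicit Types a b c : pser K.

Lemma ps_ext a b : (forall n, pcoef a n = pcoef b n) -> a = b.
Proof. destruct a as [f]; destruct b as [g]; move=> /= H; congr PS; exact: functional_extensionality. Qed.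

Definition ps_eqb a b : bool := if pdec (a = b) then true else false.
Lemma ps_eqP : Equality.axiom ps_eqb.
Proof. by move=> a b; rewrite /ps_eqb; case: pdec => H; constructor. Qed.
HB.instance Definition _ := hasDecEq.Build (pser K) ps_eqP.

Definition ps_find (P : pred (pser K)) (n : nat) : option (pser K) :=
  match pdec (exists x, P x) with
  | left H => Some (proj1_sig (constructive_indefinite_description _ H))
  | right _ => None end.
Lemma ps_find_correct P n x : ps_find P n = Some x -> P x.
Proof.
rewrite /ps_find; case: pdec => // H [<-].
exact: (proj2_sig (constructive_indefinite_description _ H)).
Qed.
Lemma ps_find_complete (P : pred (pser K)) : (exists x, P x) -> exists n, ps_find P n.
Proof. by move=> H; exists 0%N; rewrite /ps_find; case: pdec. Qed.
Lemma ps_find_ext (P Q : pred (pser K)) : P =1 Q -> ps_find P =1 ps_find Q.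
Proof. by move=> /functional_extensionality ->. Qed.
HB.instance Definition _ :=
  hasChoice.Build (pser K) ps_find_correct ps_find_complete ps_find_ext.

Definition ps0 : pser K := PS (fun _ => 0).
Definition psopp a := PS (fun n => - pcoef a n).
Definition psadd a b := PS (fun n => pcoef a n + pcoef b n).
Lemma psaddA : associative psadd.
Proof. by move=> a b c; apply: ps_ext => n /=; rewrite addrA. Qed.
Lemma psaddC : commutative psadd.
Proof. by move=> a b; apply: ps_ext => n /=; rewrite addrC. Qed.
Lemma psadd0 : left_id ps0 psadd.
Proof. by move=> a; apply: ps_ext => n /=; rewrite add0r. Qed.
Lemma psaddN : left_inverse ps0 psopp psadd.
Proof. by move=> a; apply: ps_ext => n /=; rewrite addNr. Qed.
HB.instance Definition _ := GRing.isZmodule.Build (pser K) psaddA psaddC psadd0 psaddN.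

Definition ps1 : pser K := PS (fun n => (n == 0%N)%:R).
Definition psmul a b := PS (fun n => \sum_(j < n.+1) pcoef a j * pcoef b (n - j)).

Definition agree (P : {poly K}) a n := forall i, (i <= n)%N -> P`_i = pcoef a i.
Definition trunc a n : {poly K} := \poly_(i < n.+1) pcoef a i.
Lemma agree_trunc a n : agree (trunc a n) a n.
Proof. by move=> i le; rewrite coef_poly ltnS le. Qed.
Lemma agree_le P a n m : agree P a n -> (m <= n)%N -> agree P a m.
Proof. by move=> H le i lei; apply: H; apply: leq_trans lei le. Qed.
Lemma psmulE a b P Q n : agree P a n -> agree Q b n ->
  pcoef (psmul a b) n = (P * Q)`_n.
Proof.
move=> HP HQ; rewrite coefM /=; apply: eq_bigr => j _.
by rewrite HP ?HQ ?leq_subr // -ltnS.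
Qed.
Lemma agreeM a b P Q n : agree P a n -> agree Q b n -> agree (P * Q) (psmul a b) n.
Proof.
move=> HP HQ i le; rewrite (psmulE (agree_le HP le) (agree_le HQ le)) //.
Qed.
Lemma agreeD a b P Q n : agree P a n -> agree Q b n -> agree (P + Q) (psadd a b) n.
Proof. by move=> HP HQ i le; rewrite coefD HP ?HQ. Qed.
Lemma agree1 n : agree 1 ps1 n.
Proof. by move=> i _; rewrite coef1. Qed.

Lemma psmulA : associative psmul.
Proof.
move=> a b c; apply: ps_ext => n.
have Ha := @agree_trunc a n; have Hb := @agree_trunc b n; have Hc := @agree_trunc c n.
rewrite (psmulE Ha (agreeM Hb Hc)) (psmulE (agreeM Ha Hb) Hc).
by rewrite mulrA.
Qed.
Lemma psmulC : commutative psmul.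
Proof.
move=> a b; apply: ps_ext => n.
have Ha := @agree_trunc a n; have Hb := @agree_trunc b n.
by rewrite (psmulE Ha Hb) (psmulE Hb Ha) mulrC.
Qed.
Lemma psmul1 : left_id ps1 psmul.
Proof.
move=> a; apply: ps_ext => n; have Ha := @agree_trunc a n.
by rewrite (psmulE (@agree1 n) Ha) mul1r Ha.
Qed.
Lemma psmulDl : left_distributive psmul psadd.
Proof.
move=> a b c; apply: ps_ext => n.
have Ha := @agree_trunc a n; have Hb := @agree_trunc b n; have Hc := @agree_trunc c n.
rewrite (psmulE (agreeD Ha Hb) Hc) mulrDl coefD -(psmulE Ha Hc) -(psmulE Hb Hc).
by [].
Qed.
Lemma ps1_neq0 : ps1 != 0.
Proof.
apply/eqP => /(congr1 (fun a => pcoef a 0)) /=.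
by move/eqP; rewrite oner_eq0.
Qed.
HB.instance Definition _ :=
  GRing.Zmodule_isComNzRing.Build (pser K) psmulA psmulC psmul1 psmulDl ps1_neq0.

Definition ps_unit : {pred pser K} :=
  fun a => if pdec (exists b, b * a = 1) then true else false.
Definition ps_inv (a : pser K) : pser K :=
  match pdec (exists b, b * a = 1) with
  | left H => proj1_sig (constructive_indefinite_description _ H)
  | right _ => a end.
Lemma ps_mulVx : {in ps_unit, left_inverse 1 ps_inv *%R}.
Proof.
move=> a; rewrite /ps_unit /ps_inv unfold_in; case: pdec => // H _.
exact: (proj2_sig (constructive_indefinite_description _ H)).
Qed.
Lemma ps_unitPl (a b : pser K) : b * a = 1 -> ps_unit a.
Proof. by move=> H; rewrite /ps_unit; case: pdec => // -[]; exists b. Qed.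
Lemma ps_inv_out : {in [predC ps_unit], ps_inv =1 id}.
Proof.
move=> a; rewrite inE /ps_unit /ps_inv unfold_in /=; by case: pdec.
Qed.
HB.instance Definition _ :=
  GRing.ComNzRing_hasMulInverse.Build (pser K) ps_mulVx ps_unitPl ps_inv_out.

Lemma ps_neq0 (a : pser K) : a != 0 -> exists n, pcoef a n != 0.
Proof.
move=> H; apply: NNPP => nex; case/eqP: H; apply: ps_ext => n /=.
case: (pdec (pcoef a n = 0)) => // ne; exfalso; apply: nex; exists n; exact/eqP.
Qed.

Lemma ps_idomain : GRing.integral_domain_axiom (pser K).
Proof.
move=> a b ab0; apply: contraTT isT; rewrite negb_or => /andP[/ps_neq0 ea /ps_neq0 eb].
case: (ex_minnP ea) => i ai mini; case: (ex_minnP eb) => j bj minj.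
have: pcoef (a * b) (i + j) = 0 by rewrite ab0.
have lti : (i < (i + j).+1)%N by rewrite ltnS leq_addr.
rewrite /= (bigD1 (Ordinal lti)) //= big1 ?addr0 ?addKn.
  by move/eqP; rewrite mulf_eq0 (negbTE ai) (negbTE bj).
move=> [k ltk] /= nek; have [lt|gt] := ltnP k i.
  have /eqP -> : pcoef a k == 0.
    by apply: contraTT lt => /mini; rewrite -leqNgt.
  by rewrite mul0r.
have ltki : (i < k)%N by rewrite ltn_neqAle eq_sym gt andbT; apply: contra nek => /eqP e; apply/eqP/val_inj.
have /eqP -> : pcoef b (i + j - k) == 0; last by rewrite mulr0.
have ltkj : (i + j - k < j)%N.
  by rewrite ltn_subLR ?ltn_add2r // -ltnS.
by apply: contraTT ltkj => /minj; rewrite -leqNgt.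
Qed.
HB.instance Definition _ := GRing.ComUnitRing_isIntegral.Build (pser K) ps_idomain.


End PSer.

(* The field k((t)) of formal Laurent series, realised as the fraction field *)
(* of the power series ring k[[t]] (canonically isomorphic to k((t))).       *)

Notation "x %:F" := (@FracField.tofrac _ x) (at level 1, format "x %:F").

Definition LS (K : fieldType) : fieldType := {fraction (pser K)}.

Definition frac_map (R S : idomainType) (f : R -> S) (x : {fraction R})
  : {fraction S} :=
  let r := repr x in (f \n_r)%:F / (f \d_r)%:F.

Definition ps_scale (K : fieldType) (c : K) (a : pser K) : pser K :=
  PS (fun n => c ^+ n * pcoef a n).
Definition ps_map (K L : fieldType) (f : K -> L) (a : pser K) : pser L :=
  PS (fun n => f (pcoef a n)).

Definition sigma_q (K : fieldType) (q : K) : LS K -> LS K :=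
  frac_map (ps_scale q).
Definition tLS (K : fieldType) : LS K := (PS (fun n => (n == 1%N)%:R))%:F.
Definition cstLS (K : fieldType) (c : K) : LS K :=
  (PS (fun n => if n == 0%N then c else 0))%:F.
Definition LS_map (K L : fieldType) (f : K -> L) : LS K -> LS L :=
  frac_map (ps_map f).

(* kbar((t))_0 = union of K((t)), K/k finite inside kbar: the elements a/b   *)
(* with a, b in kbar[[t]] whose coefficients lie in a finite-dimensional    *)
(* k-subspace of kbar (kbar being algebraic over k).                         *)
Definition fin_span (k kbar : fieldType) (iota : k -> kbar) (a : pser kbar) :=
  exists B : seq kbar, forall n, exists c : 'I_(size B) -> k,
    pcoef a n = \sum_(i < size B) iota (c i) * B`_i.
Definition in_kbar0 (k kbar : fieldType) (iota : k -> kbar) (x : LS kbar) :=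
  exists a b : pser kbar,
    [/\ b != 0, fin_span iota a, fin_span iota b & x = a%:F / b%:F].

Section Dq.
Variables (F : fieldType) (sigma : F -> F).

Definition is_Dq_module (V : vectType F) (Phi : V -> V) : Prop :=
  [/\ {morph Phi : u v / u + v}, bijective Phi &
      forall (a : F) (v : V), Phi (a *: v) = sigma a *: Phi v].

Definition Dq_stable (V : vectType F) (Phi : V -> V) (U : {vspace V}) :=
  forall v, v \in U -> Phi v \in U.

Definition Dq_irreducible (V : vectType F) (Phi : V -> V) : Prop :=
  fullv != (0 : {vspace V})%VS /\
  forall U : {vspace V}, Dq_stable Phi U -> U = 0%VS \/ U = fullv.

Definition Dq_indecomposable (V : vectType F) (Phi : V -> V) : Prop :=
  fullv != (0 : {vspace V})%VS /\
  forall U W : {vspace V}, Dq_stable Phi U -> Dq_stable Phi W ->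
    directv (U + W) -> (U + W)%VS = fullv -> U = 0%VS \/ W = 0%VS.

Definition Dq_iso (V W : vectType F) (Phi : V -> V) (Psi : W -> W) : Prop :=
  exists h : V -> W,
    [/\ linear h, bijective h & forall v, h (Phi v) = Psi (h v)].

(* The cyclic module R/R P, P = T^n + p_{n-1} T^{n-1} + ... + p_0 monic of  *)
(* degree n (coefficients on the left), in the basis 1, T, ..., T^{n-1},    *)
(* with Phi = left multiplication by T  (T a = sigma(a) T, T^n = -sum p_j T^j). *)
Definition Tmul (n : nat) (p : {poly F}) (i : 'I_n) : 'rV[F]_n :=
  if (i.+1 < n)%N then delta_mx 0 (insubd i i.+1) else - \row_(j < n) p`_j.
Definition cyc_mod (n : nat) (p : {poly F}) (x : 'rV[F]_n) : 'rV[F]_n :=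
  \sum_(i < n) sigma (x 0 i) *: Tmul p i.

(* V_{r,s}(f) for f = x^m - a_{m-1} x^{m-1} - ... - a_0: coordinates       *)
(* M j i  of the basis vector Phi^i v_j  (0 <= i < s, 0 <= j < m).           *)
(* Phi^s v_j = t^r v_{j+1} (j < m-1),  Phi^s v_{m-1} = t^r sum_j a_j v_j.   *)
Definition VrsM (t : F) (r : int) (s m : nat) (a : 'I_m -> F)
    (M : 'M[F]_(m, s)) : 'M[F]_(m, s) :=
  \matrix_(j < m, i < s)
    if (0 < i)%N then sigma (M j (insubd i i.-1))
    else t ^ r * ((if (0 < j)%N then sigma (M (insubd j j.-1) (insubd i s.-1))
                   else 0)
                  + a j * sigma (M (insubd j m.-1) (insubd i s.-1))).
Definition VrsRow (t : F) (r : int) (s m : nat) (a : 'I_m -> F)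
    (x : 'rV[F]_(m * s)) : 'rV[F]_(m * s) :=
  mxvec (VrsM t r a (vec_mx x)).

(* tensor product of two D_q-modules on coordinate spaces F^n1, F^n2;       *)
(* F^n1 (x) F^n2 = n1 x n2 matrices, e_a (x) f_b = delta_mx a b,           *)
(* v (x) w = v^T w, and Phi (e_a (x) f_b) = Phi1 e_a (x) Phi2 f_b.          *)
Definition tensor_mod (n1 n2 : nat) (Phi1 : 'rV[F]_n1 -> 'rV[F]_n1)
    (Phi2 : 'rV[F]_n2 -> 'rV[F]_n2) (M : 'M[F]_(n1, n2)) : 'M[F]_(n1, n2) :=
  \sum_(a < n1) \sum_(b < n2)
     sigma (M a b) *: ((Phi1 (delta_mx 0 a))^T *m Phi2 (delta_mx 0 b)).

Definition dsum_mod (l n : nat) (Phi : 'I_l -> 'rV[F]_n -> 'rV[F]_n)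
    (M : 'M[F]_(l, n)) : 'M[F]_(l, n) :=
  \matrix_(j < l, i < n) Phi j (row j M) 0 i.

Definition mx_over (P : F -> Prop) (m n : nat) (M : 'M[F]_(m, n)) :=
  forall i j, P (M i j).

Definition Dq_iso_over (P : F -> Prop) (m1 n1 m2 n2 : nat)
    (Phi : 'M[F]_(m1, n1) -> 'M[F]_(m1, n1))
    (Psi : 'M[F]_(m2, n2) -> 'M[F]_(m2, n2)) : Prop :=
  exists (h : 'M[F]_(m1, n1) -> 'M[F]_(m2, n2))
         (g : 'M[F]_(m2, n2) -> 'M[F]_(m1, n1)),
    [/\ linear h, linear g, cancel h g & cancel g h] /\
    (forall v, h (Phi v) = Psi (h v)) /\
    (forall v, mx_over P v -> mx_over P (h v)) /\
    (forall w, mx_over P w -> mx_over P (g w)).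

End Dq.

Definition ext_mod (F1 F2 : fieldType) (iota : F1 -> F2) (sigma2 : F2 -> F2)
    (n : nat) (Phi : 'rV[F1]_n -> 'rV[F1]_n) (x : 'rV[F2]_n) : 'rV[F2]_n :=
  \sum_(i < n) sigma2 (x 0 i) *: map_mx iota (Phi (delta_mx 0 i)).

Section Objects.
Local Unset Implicit Arguments.
Variables (k : fieldType) (q : k).

Definition inS (f : {poly k}) : Prop :=
  [/\ f \is monic, irreducible_poly f & f`_0 != 0].

Definition sigmaS (f : {poly k}) : {poly k} :=
  q ^- (size f).-1 *: (f \Po (q *: 'X)).

Definition same_orbit (f g : {poly k}) : Prop :=
  exists n : nat, g = iter n sigmaS f \/ f = iter n sigmaS g.

Definition degS (f : {poly k}) := (size f).-1.

(* V_{r,s}(f) over k((t)), f = x^m - sum a_j x^j, i.e. a_j = - f_j *)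
Definition Vrs (r : int) (s : nat) (f : {poly k}) :
    'rV[LS k]_(degS f * s) -> 'rV[LS k]_(degS f * s) :=
  VrsRow (sigma_q q) (tLS k) r (fun j : 'I_(degS f) => cstLS (- f`_j)).

Definition Jd (d : nat) : 'rV[LS k]_d -> 'rV[LS k]_d :=
  cyc_mod (sigma_q q) (('X - 1) ^+ d).

Definition JV (d : nat) (r : int) (s : nat) (f : {poly k}) :=
  tensor_mod (sigma_q q) (Jd d) (Vrs r s f).

Variables (kbar : fieldType) (iota : k -> kbar).

Definition Vlam (r : int) (s : nat) (lam : kbar) : 'rV[LS kbar]_s -> 'rV[LS kbar]_s :=
  cyc_mod (sigma_q (iota q)) ('X^s - (cstLS lam * tLS kbar ^ r)%:P).

Definition ext_Vrs (r : int) (s : nat) (f : {poly k}) :=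
  ext_mod (LS_map iota) (sigma_q (iota q)) (Vrs r s f).

Definition sum_Vlam (r : int) (s : nat) (l : seq kbar) :=
  dsum_mod (fun j : 'I_(size l) => Vlam r s l`_j).

End Objects.

Arguments inS {k}.
Arguments sigmaS {k}.
Arguments same_orbit {k}.
Arguments degS {k}.
Arguments Vrs {k}.
Arguments Jd {k}.
Arguments JV {k}.
Arguments Vlam {k}.
Arguments ext_Vrs {k}.
Arguments sum_Vlam {k}.

(* Main.v *)
(* Put B = t^-r Phi^s. If p is a polynomial over k, a vector w with p(B) w = 0 and
   p(0) != 0 is called torsion of slope r/s. A monic P defines a module V_{r,s}(P),
   universal for vectors killed by P(B), and J_d (x) V_{r,s}(f) is V_{r,s}(f^d): on
   e_0 (x) v_0 the operator f(B) acts as (T - 1) s x f'(x) up to higher powers of T - 1.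

   On V_{r,s}(P) the operator B is diagonal: the coefficients at the positions of
   weight i form a copy of k[x]/P on which B acts as q^i x. Since q is not a root of
   unity, f(q^i x) and f(q^j x) are coprime for i != j; so the torsion vectors of
   V_{r,s}(f^e) of type g have slope r/s, are concentrated in one weight, and exist only
   if g is in the orbit of f. This yields irreducibility, the isomorphism criterion and
   the uniqueness of the data, and it shows that p(B) is onto modulo torsion, for every
   slope.

   Every nonzero module has a torsion vector: take a cyclic submodule, the smallest slope
   r/s of its Newton polygon and a lattice L stable under B on which B is not nilpotent
   modulo t, and lift a kernel vector of p(B) from t^j L / t^(j+1) L for the last j where
   there is one. As torsion lifts modulo sums of images of modules V_{r,s}(P), torsion
   vectors span. A submodule V_{r,s}(f^e) with e maximal then has a complement, by the
   argument for modules over a principal ideal domain.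

   After extension of scalars, v_j = sum over the roots lambda of f of lambda^j e_lambda,
   a Vandermonde change of basis. *)
Require Import Defs.
From HB Require Import structures.
From mathcomp Require Import all_boot all_order all_algebra.
From mathcomp Require Import zify ring separable.
From Stdlib Require Import ClassicalEpsilon Classical.
Set Implicit Arguments. Unset Strict Implicit. Unset Printing Implicit Defensive.
Import Order.TTheory GRing.Theory Num.Theory.
Local Open Scope ring_scope.
Local Open Scope quotient_scope.

(** * Laurent series *)

(** The obstacle is that B is only k-linear, with [B t = q^s t B]: kernels and images of p(B) are
    not subspaces over k((t)), so dimension arguments do not apply to them. Two devices replace
    these. One is the weight [s l + r c] of the position given by column c and exponent l: B
    preserves it, Phi raises it by r and t by s. As r and s are coprime, each weight belongs to a
    single position, so every graded piece is one copy of k[x]/P. The other is successive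
    approximation: a filtered operator that is onto on graded pieces is onto. On V_{r,s}(P) the
    equation p(B) x = y may be unsolvable in weights i where p(q^i x) and P share a factor; these
    weights are bounded above, and this is why lifting is stated modulo torsion. Quotient modules
    are never formed: statements about V / X are written as membership in X. In (i) and (iii) the
    closed field only supplies roots, to see that p(q^i x) is prime to a given polynomial for large
    i. Characteristic zero enters where f must be prime to f' and s must be nonzero in k. *)

Section FracMap.
Variables (R S : idomainType) (f : {rmorphism R -> S}).
Hypothesis finj : injective f.

Lemma frac_repr (x : {fraction R}) :
  x = (\n_(repr x))%:F / (\d_(repr x))%:F.
Proof.
have dn0 := denom_ratioP (repr x).
rewrite -[LHS]reprK; move: (repr x) dn0 => y dn0.
apply: (canRL (mulfK _)); first by rewrite tofrac_eq0.
unlock FracField.tofrac; rewrite -[LHS]FracField.pi_mul; apply/eqmodP.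
rewrite /= FracField.equivfE /FracField.mulf.
by rewrite !numden_Ratio ?oner_neq0 ?mulr1 // mulrC.
Qed.

(** [frac_map] uses the representative chosen by [repr]. Injectivity of [f] keeps denominators
    nonzero, so cross-multiplication shows that the choice does not matter. *)
Lemma frac_mapE (a b : R) : b != 0 ->
  frac_map f (a%:F / b%:F) = (f a)%:F / (f b)%:F.
Proof.
move=> b0; rewrite /frac_map; set x := a%:F / b%:F.
have d0 := denom_ratioP (repr x).
have fd0 : f (\d_(repr x)) != 0 by rewrite -(rmorph0 f) (inj_eq finj).
have fb0 : f b != 0 by rewrite -(rmorph0 f) (inj_eq finj).
have := frac_repr x; rewrite {1}/x => /eqP.
rewrite eqr_div ?tofrac_eq0 // -!tofracM tofrac_eq => /eqP e.
apply/eqP; rewrite eqr_div ?tofrac_eq0 // -!tofracM tofrac_eq -!rmorphM.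
by rewrite e.
Qed.

Lemma frac_map_zmod : zmod_morphism (frac_map f).
Proof.
move=> x y; rewrite (frac_repr x) (frac_repr y).
move: (\n_ _) (\d_ _) (denom_ratioP (repr x)) (\n_ _) (\d_ _) (denom_ratioP (repr y)).
move=> a b b0 c d d0; have fb0 : f b != 0 by rewrite -(rmorph0 f) (inj_eq finj).
have fd0 : f d != 0 by rewrite -(rmorph0 f) (inj_eq finj).
rewrite -mulNr -tofracN addf_div ?tofrac_eq0 // -!tofracM -tofracD.
rewrite !frac_mapE ?mulf_neq0 // -mulNr -tofracN addf_div ?tofrac_eq0 //.
by rewrite -!tofracM -tofracD -rmorphN -!rmorphM -rmorphD.
Qed.

Lemma frac_map_monoid : monoid_morphism (frac_map f).
Proof.
split=> [|x y].
  have -> : (1 : {fraction R}) = 1%:F / 1%:F by rewrite divr1.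
  by rewrite frac_mapE ?oner_neq0 // rmorph1 divr1.
rewrite (frac_repr x) (frac_repr y).
move: (\n_ _) (\d_ _) (denom_ratioP (repr x)) (\n_ _) (\d_ _) (denom_ratioP (repr y)).
move=> a b b0 c d d0; rewrite mulf_div -!tofracM !frac_mapE ?mulf_neq0 //.
by rewrite mulf_div -!tofracM -!rmorphM.
Qed.
End FracMap.

Section PowerSeries.
Variable K : fieldType.
Implicit Types (a b : pser K) (c : K) (n m : nat).

Definition psX : pser K := PS (fun n => (n == 1%N)%:R).
Definition psC c : pser K := PS (fun n => if n == 0%N then c else 0).

Lemma pcoefM a b n :
  pcoef (a * b) n = \sum_(j < n.+1) pcoef a j * pcoef b (n - j).
Proof. by []. Qed.

Lemma pcoefB a b n : pcoef (a - b) n = pcoef a n - pcoef b n. Proof. by []. Qed.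
Lemma pcoefD a b n : pcoef (a + b) n = pcoef a n + pcoef b n. Proof. by []. Qed.
Lemma pcoef1 n : pcoef (1 : pser K) n = (n == 0%N)%:R. Proof. by []. Qed.

Lemma pcoefCM c a n : pcoef (psC c * a) n = c * pcoef a n.
Proof.
rewrite pcoefM big_ord_recl big1 ?addr0 ?subn0 //= => i _; exact: mul0r.
Qed.

Lemma pcoefXM a n : pcoef (psX * a) n = if n is n'.+1 then pcoef a n' else 0.
Proof.
case: n => [|n]; first by rewrite pcoefM big_ord1 mul0r.
rewrite pcoefM 2!big_ord_recl /= mul0r add0r mul1r big1 ?addr0 ?subn1 // => i _.
exact: mul0r.
Qed.

Lemma pcoefXnM m a n :
  pcoef (psX ^+ m * a) n = if (n < m)%N then 0 else pcoef a (n - m).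
Proof.
elim: m n => [|m IH] n; first by rewrite expr0 mul1r subn0.
rewrite exprS -mulrA pcoefXM; case: n => // n; rewrite IH ltnS subSS //.
Qed.

Lemma psC_zmod : zmod_morphism psC.
Proof.
move=> x y; apply: ps_ext => n /=; case: eqP => //= _.
by rewrite oppr0 addr0.
Qed.
Lemma psC_monoid : monoid_morphism psC.
Proof.
split=> [|x y]; apply: ps_ext => n; first by rewrite /=; case: eqP.
by rewrite pcoefCM /=; case: eqP; rewrite ?mulr0.
Qed.
HB.instance Definition _ := GRing.isZmodMorphism.Build K (pser K) psC psC_zmod.
HB.instance Definition _ := GRing.isMonoidMorphism.Build K (pser K) psC psC_monoid.

Lemma psX_neq0 : psX != 0.
Proof. by apply/eqP => /(congr1 (fun a : pser K => pcoef a 1)) /eqP /=; rewrite oner_eq0. Qed.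

Lemma psX_decomp a : a != 0 -> exists n b, a = psX ^+ n * b /\ pcoef b 0 != 0.
Proof.
move=> /ps_neq0 ex; case: (ex_minnP ex) => n an min.
exists n, (PS (fun i => pcoef a (i + n))); split; last by [].
apply: ps_ext => i; rewrite pcoefXnM; case: ltnP => le /=; last by rewrite subnK.
by apply/eqP; apply: contraTT le => /min; rewrite -leqNgt.
Qed.

(** Geometric series: [a] is [a_0 (1 - X c)], and [b] is the inverse of the second factor, read off
    diagonally because the powers [(X c)^j] with [j > n] do not reach degree [n]. *)
Lemma ps_inv_ex a : pcoef a 0 != 0 -> exists b, a * b = 1.
Proof.
move=> a0; pose c := PS (fun n => - ((pcoef a 0)^-1 * pcoef a n.+1)).
have ea : a = psC (pcoef a 0) * (1 - psX * c).
  apply: ps_ext => n; rewrite pcoefCM pcoefB pcoef1 pcoefXM.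
  case: n => [|n] /=; first by rewrite subr0 mulr1.
  by rewrite sub0r opprK mulrA mulfV // mul1r.
pose S n := \sum_(j < n) (psX * c) ^+ j.
have SE n : (1 - psX * c) * S n = 1 - psX ^+ n * c ^+ n.
  by rewrite /S -opprB mulNr -subrX1 opprB exprMn.
pose b := PS (fun n => pcoef (S n.+1) n).
have bE n i : (i < n)%N -> pcoef b i = pcoef (S n) i.
  elim: n => // n IH; rewrite ltnS leq_eqVlt => /orP[/eqP ->//|lt].
  by rewrite IH // /S [in RHS]big_ord_recr pcoefD exprMn pcoefXnM lt addr0.
exists (b * psC (pcoef a 0)^-1); rewrite {1}ea [psC _ * _]mulrC mulrACA.
have -> : (1 - psX * c) * b = 1; last by rewrite mul1r -rmorphM mulfV // rmorph1.
apply: ps_ext => n.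
rewrite -[RHS]subr0.
transitivity (pcoef ((1 - psX * c) * S n.+1) n).
  by rewrite !pcoefM; apply: eq_bigr => j _; rewrite (bE n.+1) // ltnS leq_subr.
by rewrite SE pcoefB pcoefXnM ltnSn.
Qed.

Lemma ps_scale_zmod c : zmod_morphism (ps_scale c).
Proof. by move=> a b; apply: ps_ext => n /=; rewrite mulrBr. Qed.
Lemma ps_scale_monoid c : monoid_morphism (ps_scale c).
Proof.
split=> [|a b]; apply: ps_ext => n /=.
  by case: n => [|n]; rewrite ?expr0 ?mul1r ?mulr0.
rewrite mulr_sumr; apply: eq_bigr => -[j /= le] _.
by rewrite mulrACA -exprD subnKC.
Qed.
HB.instance Definition _ c :=
  GRing.isZmodMorphism.Build (pser K) (pser K) (ps_scale c) (ps_scale_zmod c).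
HB.instance Definition _ c :=
  GRing.isMonoidMorphism.Build (pser K) (pser K) (ps_scale c) (ps_scale_monoid c).

Lemma ps_scale_inj c : c != 0 -> injective (ps_scale c).
Proof.
move=> c0 a b e; apply: ps_ext => n; have := congr1 (fun a : pser K => pcoef a n) e => /=.
by apply: mulfI; rewrite expf_neq0.
Qed.

End PowerSeries.

Section Laurent.
Variable K : fieldType.
Implicit Types (x y : LS K) (i n : int) (c : K).
Local Notation t := (tLS K).
Local Notation cst := (@cstLS K).

Lemma tLS_neq0 : t != 0.
Proof. by rewrite /tLS tofrac_eq0 psX_neq0. Qed.
Lemma tLS_unit : t \is a GRing.unit.
Proof. by rewrite unitfE tLS_neq0. Qed.
Hint Resolve tLS_neq0 tLS_unit : core.
Lemma tLSD n i : t ^ (n + i) = t ^ n * t ^ i.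
Proof. by rewrite expfzDr. Qed.

Lemma cstLS_zmod : zmod_morphism cst.
Proof. by move=> a b; rewrite /cstLS -/(psC _) rmorphB tofracB. Qed.
Lemma cstLS_monoid : monoid_morphism cst.
Proof.
split=> [|a b]; first by rewrite /cstLS -/(psC _) rmorph1 tofrac1.
by rewrite /cstLS -/(psC _) rmorphM tofracM.
Qed.
HB.instance Definition _ := GRing.isZmodMorphism.Build K (LS K) cst cstLS_zmod.
HB.instance Definition _ := GRing.isMonoidMorphism.Build K (LS K) cst cstLS_monoid.

Definition pcoefz (a : pser K) i := if i is Posz n then pcoef a n else 0.

(** A nonzero denominator is a power of [psX] times a unit, so every fraction has a pole of finite
    order. *)
Lemma LS_ex x : exists N : nat * pser K, x = t ^- N.1 * (N.2)%:F.
Proof.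
rewrite (frac_repr x); move: (\n_ _) (\d_ _) (denom_ratioP (repr x)) => a b.
case/psX_decomp => n [u [-> /ps_inv_ex [v uv]]]; exists (n, a * v).
rewrite /= rmorphM rmorphXn /= tofracM mulrCA; congr (_ * _).
have u0 : u%:F != 0.
  by rewrite tofrac_eq0; apply: contra_eq_neq uv => ->; rewrite mul0r eq_sym oner_neq0.
have -> : v%:F = (u%:F)^-1 by apply: (mulfI u0); rewrite -tofracM uv mulfV.
by rewrite invfM.
Qed.

(* The coefficient of [t ^ i] in a Laurent series. *)
Definition co x i : K :=
  let N := proj1_sig (constructive_indefinite_description _ (LS_ex x)) in
  pcoefz N.2 (i + N.1%:Z).

Lemma pcoefz_XnM (m : nat) a i : pcoefz (psX K ^+ m * a) (i + m%:Z) = pcoefz a i.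
Proof.
case: i => i.
  by rewrite -PoszD [LHS]pcoefXnM ltnNge leq_addl /= addnK.
case: (ltnP i m) => lt.
  have -> : Negz i + m = (m - i.+1)%N :> int by lia.
  by rewrite [LHS]pcoefXnM ifT //; lia.
have -> : Negz i + m = Negz (i - m) by lia.
by [].
Qed.

(** Well-definedness of [co]: two representations of a series differ by powers of [psX], which only
    shift [pcoefz]. *)
Lemma co_expnE (N : nat) (a : pser K) i : co (t ^- N * a%:F) i = pcoefz a (i + N%:Z).
Proof.
rewrite /co; case: constructive_indefinite_description => -[M b] /= e.
have {}e : psX K ^+ M * a = psX K ^+ N * b.
  apply/eqP; rewrite -tofrac_eq !tofracM !tofracXn -[(psX K)%:F]/t; apply/eqP.
  have tn (m : nat) : t ^+ m != 0 by rewrite expf_neq0.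
  move/(congr1 (fun z => t ^+ M * (t ^+ N * z))): e.
  by rewrite (mulVKf (tn N)) => ->; rewrite mulrCA (mulVKf (tn M)).
rewrite -(pcoefz_XnM N b) -e addrAC pcoefz_XnM //.
Qed.

Lemma LS_ex2 x y : exists N a b, x = t ^- N * a%:F /\ y = t ^- N * b%:F.
Proof.
case: (LS_ex x) (LS_ex y) => -[N a] /= -> [[M b] /= ->].
exists (M + N)%N, (psX K ^+ M * a), (psX K ^+ N * b).
have tn (m : nat) : t ^+ m != 0 by rewrite expf_neq0.
rewrite !tofracM !tofracXn -[(psX K)%:F]/t exprD invfM; split.
  by rewrite -mulrA mulrCA (mulKf (tn M)).
by rewrite -mulrA (mulKf (tn N)).
Qed.

Lemma coB x y i : co (x - y) i = co x i - co y i.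
Proof.
case: (LS_ex2 x y) => N [a [b [-> ->]]]; rewrite -mulrBr -tofracB !co_expnE.
by case: (i + N)%R => //= _; rewrite subr0.
Qed.
Definition coAt i x := co x i.
Lemma co_zmod i : zmod_morphism (coAt i). Proof. by move=> x y; exact: coB. Qed.
HB.instance Definition _ i :=
  GRing.isZmodMorphism.Build (LS K) K (coAt i) (co_zmod i).
Lemma co0 i : co 0 i = 0. Proof. exact: (raddf0 (coAt i)). Qed.
Lemma coD x y i : co (x + y) i = co x i + co y i.
Proof. exact: (raddfD (coAt i)). Qed.
Lemma coN x i : co (- x) i = - co x i.
Proof. exact: (raddfN (coAt i)). Qed.

Lemma co_ext x y : (forall i, co x i = co y i) -> x = y.
Proof.
case: (LS_ex2 x y) => N [a [b [-> ->]]] H; congr (_ * _%:F); apply: ps_ext => n.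
have := H (n%:Z - N%:Z); rewrite !co_expnE subrK //.
Qed.

Lemma co_bound x : exists N, forall i, i < N -> co x i = 0.
Proof.
case: (LS_ex x) => -[N a] /= ->; exists (- N%:Z) => i lt; rewrite co_expnE.
have : i + N < 0 by lia.
by case: (i + N)%R.
Qed.

Lemma co_mk (f : int -> K) N : (forall i, i < N -> f i = 0) ->
  exists x, forall i, co x i = f i.
Proof.
move=> H; pose M := `|N|%N; exists (t ^- M * (PS (fun k : nat => f (k%:Z - M%:Z)))%:F) => i.
rewrite co_expnE; case e: (i + M%:Z)%R => [n|n] /=; last by rewrite H //; lia.
by congr f; lia.
Qed.

Lemma co_t n x i : co (t ^ n * x) i = co x (i - n).
Proof.
case: (LS_ex x) => -[N a] /= ->; case: n => n.
  have -> : t ^ Posz n * (t ^- N * a%:F) =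
    t ^- N * (psX K ^+ n * a)%:F by rewrite tofracM tofracXn mulrCA.
  rewrite !co_expnE -(pcoefz_XnM n a); congr pcoefz; lia.
have -> : t ^ Negz n * (t ^- N * a%:F) =
    t ^- (N + n.+1) * a%:F by rewrite mulrA NegzE -exprnN -invfM -exprD addnC.
rewrite !co_expnE; congr pcoefz; lia.
Qed.

Lemma co_cst c x i : co (cst c * x) i = c * co x i.
Proof.
case: (LS_ex x) => -[N a] /= ->; rewrite mulrCA -tofracM !co_expnE.
by case: (i + _)%R => n /=; rewrite ?mulr0 // -pcoefCM.
Qed.
Lemma co_cst1 c i : co (cst c) i = c *+ (i == 0).
Proof.
have := co_expnE 0 (psC c) i; rewrite expr0 invr1 mul1r addr0 => ->.
by case: i => -[|n].
Qed.

Lemma coM x y m n : (forall i, i < m -> co x i = 0) -> (forall i, i < n -> co y i = 0) ->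
  (forall i, i < m + n -> co (x * y) i = 0) /\ co (x * y) (m + n) = co x m * co y n.
Proof.
move=> Hx Hy.
have [a ea] : exists a : pser K, x = t ^ m * a%:F.
  case: (LS_ex (t ^ (- m) * x)) => -[N a] /= e.
  exists (PS (fun k : nat => co x (k%:Z + m))); apply: co_ext => i; rewrite co_t.
  have := co_expnE 0 (PS (fun k : nat => co x (k%:Z + m))) (i - m).
  rewrite expr0 invr1 mul1r => ->; rewrite addr0.
  case ek: (i - m)%R => [k|k] /=; first by congr co; lia.
  by rewrite Hx //; lia.
have [b eb] : exists b : pser K, y = t ^ n * b%:F.
  exists (PS (fun k : nat => co y (k%:Z + n))); apply: co_ext => i; rewrite co_t.
  have := co_expnE 0 (PS (fun k : nat => co y (k%:Z + n))) (i - n).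
  rewrite expr0 invr1 mul1r => ->; rewrite addr0.
  case ek: (i - n)%R => [k|k] /=; first by congr co; lia.
  by rewrite Hy //; lia.
have E (c : pser K) i : co (c%:F) i = pcoefz c i.
  by have := co_expnE 0 c i; rewrite expr0 invr1 mul1r addr0.
rewrite ea eb mulrACA -tLSD -tofracM; split=> [i lt|].
  rewrite co_t E; have : i - (m + n) < 0 by lia.
  by case: (i - _)%R.
by rewrite !co_t !subrr !E /= big_ord1.
Qed.

Lemma co_tofrac a i : co a%:F i = pcoefz a i.
Proof. by have := co_expnE 0 a i; rewrite expr0 invr1 mul1r addr0. Qed.

Lemma lval_ex x : x != 0 -> exists n, (forall i, i < n -> co x i = 0) /\ co x n != 0.
Proof.
move=> x0; case: (LS_ex x) => -[N a] /= ex.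
have : a != 0 by apply: contra_neq x0 => a0; rewrite ex a0 tofrac0 mulr0.
case/psX_decomp => n [b [ea b0]]; exists (n%:Z - N%:Z).
split=> [i lt|]; last by rewrite ex co_expnE subrK ea -[pcoefz _ _]/(pcoef (psX K ^+ n * b) n) pcoefXnM ltnn subnn.
rewrite ex co_expnE ea; case ek: (i + N%:Z)%R => [k|k] //.
by rewrite [LHS]pcoefXnM ifT //; lia.
Qed.

End Laurent.
#[global] Hint Resolve tLS_neq0 tLS_unit : core.

Section Sigma.
Variables (K : fieldType) (q : K).
Hypothesis q0 : q != 0.

(** The proof of [q != 0] is an argument so that the morphism structures, which rest on the
    injectivity of [ps_scale q], can be attached to this name. *)
Definition sigmaLS (_ : q != 0) := sigma_q q.
Local Notation sg := (sigmaLS q0).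
HB.instance Definition _ := GRing.isZmodMorphism.Build (LS K) (LS K) sg
  (frac_map_zmod (ps_scale_inj q0)).
HB.instance Definition _ := GRing.isMonoidMorphism.Build (LS K) (LS K) sg
  (frac_map_monoid (ps_scale_inj q0)).

Local Notation s := (sigma_q q).
Lemma sigmaM : {morph s : x y / x * y}. Proof. exact: (rmorphM sg). Qed.
Lemma sigmaD : {morph s : x y / x + y}. Proof. exact: (rmorphD sg). Qed.
Lemma sigma0 : s 0 = 0. Proof. exact: (rmorph0 sg). Qed.
Lemma sigma1 : s 1 = 1. Proof. exact: (rmorph1 sg). Qed.

Lemma sigma_tofrac a : s a%:F = (ps_scale q a)%:F.
Proof.
have := frac_mapE (ps_scale_inj q0) a (oner_neq0 _).
by rewrite !rmorph1 !divr1.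
Qed.

Lemma sigma_cst c : s (cstLS c) = cstLS c.
Proof.
rewrite sigma_tofrac; congr _%:F; apply: ps_ext => n /=.
by case: eqP => [->|]; rewrite ?expr0 ?mul1r ?mulr0.
Qed.

Lemma sigma_tz (n : int) : s (tLS K ^ n) = cstLS (q ^ n) * tLS K ^ n.
Proof.
have -> : s (tLS K ^ n) = s (tLS K) ^ n by exact: (rmorphXz sg n (tLS_unit K)).
have -> : s (tLS K) = cstLS q * tLS K.
  rewrite sigma_tofrac -tofracM; congr _%:F; apply: ps_ext => i.
  by rewrite pcoefCM /=; case: eqP => [->|]; rewrite ?expr1 ?mulr0.
by rewrite expfzMl (rmorphXz (@cstLS K)) ?unitfE.
Qed.

Lemma co_sigma x i : co (s x) i = q ^ i * co x i.
Proof.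
case: (LS_ex x) => -[N a] /= ->; rewrite exprnN.
rewrite sigmaM sigma_tz sigma_tofrac -mulrA co_cst !co_t !co_tofrac.
case e: (i - _)%R => [n|n] /=; last by rewrite !mulr0.
by rewrite mulrA; congr (_ * _); rewrite -[q ^+ n]/(q ^ n%:Z) -expfzDr //; congr (_ ^ _); lia.
Qed.

End Sigma.

Lemma sigma_bij (K : fieldType) (q : K) : q != 0 -> bijective (sigma_q q).
Proof.
move=> q0; have qi0 : q^-1 != 0 by rewrite invr_eq0.
exists (sigma_q q^-1) => x; apply: co_ext => i.
  rewrite (co_sigma qi0) (co_sigma q0) mulrA -expfzMl mulVf // exp1rz mul1r //.
by rewrite (co_sigma q0) (co_sigma qi0) mulrA -expfzMl mulfV // exp1rz mul1r.
Qed.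

(** * Semilinear operators *)

Section Semilinear.
Variables (k : fieldType) (q : k).
Hypothesis q0 : q != 0.
Local Notation F := (LS k).
Local Notation t := (tLS k).
Local Notation cst := (@cstLS k).

(** Linearity over the constants, which [sigma_q] fixes. It is the linearity shared by [Phi], [B],
    the operators p(B) and the maps between modules. *)
Definition kadd (V W : lmodType F) (B : V -> W) :=
  {morph B : u v / u + v} /\ forall c v, B (cst c *: v) = cst c *: B v.

Section Kadd.
Variables (V W : lmodType F) (B : V -> W).
Hypothesis kB : kadd B.
Lemma kaddD u v : B (u + v) = B u + B v. Proof. exact: kB.1. Qed.
Lemma kadd0 : B 0 = 0. Proof. by apply: (addIr (B 0)); rewrite -kaddD !add0r. Qed.
Lemma kaddN v : B (- v) = - B v.
Proof. by apply: (addIr (B v)); rewrite -kaddD !addNr kadd0. Qed.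
Lemma kaddB u v : B (u - v) = B u - B v. Proof. by rewrite kaddD kaddN. Qed.
Lemma kaddZ c v : B (cst c *: v) = cst c *: B v. Proof. exact: kB.2. Qed.
Lemma kadd_sum I (r : seq I) P (G : I -> V) :
  B (\sum_(i <- r | P i) G i) = \sum_(i <- r | P i) B (G i).
Proof. by apply: big_morph; [exact: kaddD | exact: kadd0]. Qed.
End Kadd.

Lemma kadd_iter (V : lmodType F) (B : V -> V) n : kadd B -> kadd (iter n B).
Proof.
move=> kB; elim: n => [|n [IH1 IH2]]; first by split.
by split=> [u v|c v] /=; rewrite ?IH1 ?IH2 ?(kaddD kB) ?(kaddZ kB).
Qed.

Lemma kadd_linear (V W : lmodType F) (h : V -> W) : linear h -> kadd h.
Proof.
move=> hl; have h0 : h 0 = 0.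
  by have := hl (-1) 0 0; rewrite scaler0 addr0 scaleN1r addNr.
split=> [u v|c v]; first by have := hl 1 u v; rewrite !scale1r.
by have := hl (cst c) v 0; rewrite !addr0 h0 addr0.
Qed.

Definition act (V : lmodType F) (B : V -> V) (p : {poly k}) (v : V) : V :=
  \sum_(i < size p) cst p`_i *: iter i B v.

Section Act.
Variables (V : lmodType F) (B : V -> V).
Hypothesis kB : kadd B.
Implicit Types (p : {poly k}) (v : V).

Lemma act_widen n p v : (size p <= n)%N ->
  act B p v = \sum_(i < n) cst p`_i *: iter i B v.
Proof.
move=> le; rewrite /act (big_ord_widen n (fun i => cst p`_i *: iter i B v)) //.
rewrite big_mkcond; apply: eq_bigr => i _; case: ltnP => // ge.
by rewrite nth_default // rmorph0 scale0r.
Qed.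

Lemma act_split p (n : 'I_(size p)) v :
  act B p v - cst p`_n *: iter n B v =
  \sum_(i < size p | i != n) cst p`_i *: iter i B v.
Proof. by apply/eqP; rewrite subr_eq addrC /act (bigD1 n). Qed.

Lemma act_kadd p : kadd (act B p).
Proof.
split=> [u v|c v]; rewrite /act.
  rewrite -big_split; apply: eq_bigr => i _.
  by rewrite /= (kaddD (kadd_iter i kB)) scalerDr.
rewrite scaler_sumr; apply: eq_bigr => i _.
by rewrite (kaddZ (kadd_iter i kB)) !scalerA mulrC.
Qed.

Lemma actD p1 p2 v : act B (p1 + p2) v = act B p1 v + act B p2 v.
Proof.
pose n := maxn (size p1) (size p2).
rewrite (@act_widen n p1) ?leq_maxl // (@act_widen n p2) ?leq_maxr //.
rewrite (@act_widen n); last exact: leq_trans (size_polyD _ _) (leqnn _).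
rewrite -big_split; apply: eq_bigr => i _.
by rewrite coefD rmorphD scalerDl.
Qed.

Lemma actZ c p v : act B (c *: p) v = cst c *: act B p v.
Proof.
rewrite (@act_widen (size p)) ?size_scale_leq // scaler_sumr.
by apply: eq_bigr => i _; rewrite coefZ rmorphM scalerA.
Qed.

Lemma act0 v : act B 0 v = 0.
Proof. by rewrite /act size_poly0 big_ord0. Qed.

Lemma actC c v : act B c%:P v = cst c *: v.
Proof.
by rewrite (@act_widen 1) ?size_polyC ?leq_b1 // big_ord1 coefC.
Qed.

Lemma act1 v : act B 1 v = v.
Proof. by rewrite -[1]/(1%:P) actC rmorph1 scale1r. Qed.

Lemma actMX p v : act B (p * 'X) v = B (act B p v).
Proof.
rewrite (@act_widen (size p).+1); last first.
  by have [->|p0] := eqVneq p 0; rewrite ?mul0r ?size_poly0 // size_mulX.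
rewrite big_ord_recl coefMX /= rmorph0 scale0r add0r /act (kadd_sum kB).
by apply: eq_bigr => i _; rewrite coefMX /= kaddZ.
Qed.

Lemma actM p1 p2 v : act B (p1 * p2) v = act B p1 (act B p2 v).
Proof.
elim/poly_ind: p1 => [|p c IH]; first by rewrite mul0r !act0.
rewrite mulrDl mulrAC !actD !actMX IH.
by rewrite mul_polyC actZ actC.
Qed.

Lemma actMC p1 p2 v : act B p1 (act B p2 v) = act B p2 (act B p1 v).
Proof. by rewrite -!actM mulrC. Qed.

Lemma actXn n v : act B 'X^n v = iter n B v.
Proof.
elim: n v => [|n IH] v; first by rewrite expr0 act1.
by rewrite exprSr actMX IH.
Qed.

Lemma actD2 p v1 v2 : act B p (v1 + v2) = act B p v1 + act B p v2.
Proof. exact: (kaddD (act_kadd p)). Qed.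
Lemma actB2 p v1 v2 : act B p (v1 - v2) = act B p v1 - act B p v2.
Proof. exact: (kaddB (act_kadd p)). Qed.
Lemma act02 p : act B p 0 = 0.
Proof. exact: (kadd0 (act_kadd p)). Qed.

Lemma act_dvd p1 p2 v : p1 %| p2 -> act B p1 v = 0 -> act B p2 v = 0.
Proof. by move=> /dvdpP[u ->] e; rewrite actM e act02. Qed.

(** From [B E = a E B] follows [B^n E = a^n E B^n], so moving [E] to the left of p(B) substitutes
    [a x] for [x] in [p]. *)
Lemma act_twist (a : k) (E : V -> V) p v : kadd E ->
  (forall v, B (E v) = cst a *: E (B v)) ->
  act B p (E v) = E (act B (p \Po (a *: 'X)) v).
Proof.
move=> kE comm.
have it n w : iter n B (E w) = cst (a ^+ n) *: E (iter n B w).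
  elim: n => [|n IH]; first by rewrite rmorph1 scale1r.
  by rewrite /= IH (kaddZ kB) comm scalerA -rmorphM mulrC -exprS.
rewrite {1}/act (@act_widen (size p) (p \Po _)); last first.
  have [->|a0] := eqVneq a 0.
    rewrite scale0r comp_poly0r size_polyC; case: eqP => // /eqP p0.
    by rewrite lt0n size_poly_eq0; apply: contraNneq p0 => ->; rewrite coef0.
  by rewrite size_comp_poly2 // size_scale // size_polyX.
rewrite (kadd_sum kE); apply: eq_bigr => i _; rewrite it (kaddZ kE) scalerA -rmorphM.
congr (cst _ *: _); rewrite comp_polyE.
rewrite coef_sum (bigD1 i) //= big1 ?addr0 => [|j ji].
  by rewrite coefZ exprZn coefZ coefXn eqxx mulr1.
by rewrite coefZ exprZn coefZ coefXn eq_sym (inj_eq val_inj) (negbTE ji) !mulr0.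
Qed.

End Act.

(** Commutation modulo [X] stands for a morphism to the quotient by [X]. This form serves the maps
    out of companion modules and of V_{r,s}(P) whose defining relation holds only modulo [X]. *)
Lemma act_morph (V W : vectType F) (B : V -> V) (B' : W -> W) (h : V -> W)
    (X : {vspace W}) p v :
  kadd h -> kadd B' -> (forall w, w \in X -> B' w \in X) ->
  (forall v, h (B v) - B' (h v) \in X) ->
  h (act B p v) - act B' p (h v) \in X.
Proof.
move=> kh kB' sX comm; rewrite /act (kadd_sum kh) -sumrB.
apply: rpred_sum => i _; rewrite (kaddZ kh) -scalerBr rpredZ //.
elim: (nat_of_ord i) => [|n IH] /=; first by rewrite subrr rpred0.
have := rpredD (comm (iter n B v)) (sX _ IH).
by rewrite (kaddB kB') addrA subrK.
Qed.

Lemma act_morph0 (V W : vectType F) (B : V -> V) (B' : W -> W) (h : V -> W) p v :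
  kadd h -> kadd B' -> (forall v, h (B v) = B' (h v)) ->
  h (act B p v) = act B' p (h v).
Proof.
move=> kh kB' comm; apply/eqP; rewrite -subr_eq0 -memv0.
apply: act_morph => // [w|w]; rewrite ?memv0; last by rewrite comm subrr eqxx.
by move/eqP->; rewrite (kadd0 kB').
Qed.

Lemma act_stable (V : vectType F) (B : V -> V) (X : {vspace V}) p v :
  (forall w, w \in X -> B w \in X) -> v \in X -> act B p v \in X.
Proof.
move=> sX vX; apply: rpred_sum => i _; apply: rpredZ.
by elim: (nat_of_ord i) => //= n IH; exact: sX.
Qed.

Definition semilin (V W : lmodType F) (Phi : V -> W) :=
  {morph Phi : u v / u + v} /\ forall a v, Phi (a *: v) = sigma_q q a *: Phi v.

Lemma semilin_kadd (V W : lmodType F) (Phi : V -> W) : semilin Phi -> kadd Phi.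
Proof. by case=> h1 h2; split=> // c v; rewrite h2 (sigma_cst q0). Qed.

Definition Bop (V : lmodType F) (r : int) (s : nat) (Phi : V -> V) (v : V) : V :=
  t ^ (- r) *: iter s Phi v.

Section Bop.
Variables (V : lmodType F) (Phi : V -> V).
Hypothesis sl : semilin Phi.

Lemma iter_t n (l : int) v :
  iter n Phi (t ^ l *: v) = cst (q ^ (l * n%:Z)) *: (t ^ l *: iter n Phi v).
Proof.
elim: n => [|n IH]; first by rewrite mulr0 expr0z rmorph1 scale1r.
rewrite [LHS]/= IH (kaddZ (semilin_kadd sl)) sl.2 (sigma_tz q0).
rewrite !scalerA; congr (_ *: _); rewrite mulrA -rmorphM -expfzDr //.
by congr (cst (_ ^ _) * _); lia.
Qed.

Lemma Bop_kadd r s : kadd (Bop r s Phi).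
Proof.
have kP := kadd_iter s (semilin_kadd sl).
split=> [u v|c v]; first by rewrite /Bop (kaddD kP) scalerDr.
by rewrite /Bop (kaddZ kP) !scalerA mulrC.
Qed.

(** These monomial operators move vectors between weights: they commute with [B] up to a power of q,
    and so exchange torsion vectors of different twists of one polynomial. *)
Definition Eop (l : int) (c : nat) (v : V) : V := t ^ l *: iter c Phi v.

Lemma Eop_kadd l c : kadd (Eop l c).
Proof.
have kP := kadd_iter c (semilin_kadd sl).
split=> [u v|a v]; first by rewrite /Eop (kaddD kP) scalerDr.
by rewrite /Eop (kaddZ kP) !scalerA mulrC.
Qed.

(** Moving [Phi^s] past [t^l] contributes [q^(s l)]; moving [Phi^c] past [t^-r] on the other side
    contributes [q^(- r c)]. *)
Lemma Bop_Eop r s l c v :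
  Bop r s Phi (Eop l c v) = cst (q ^ (s%:Z * l + r * c%:Z)) *: Eop l c (Bop r s Phi v).
Proof.
rewrite /Bop /Eop !iter_t -!iterD addnC !scalerA; congr (_ *: _).
have -> : q ^ (l * s%:Z) = q ^ (s%:Z * l + r * c%:Z) * q ^ (- r * c%:Z).
  by rewrite -expfzDr //; congr (_ ^ _); lia.
by rewrite rmorphM /=; ring.
Qed.

Lemma act_Eop r s l c p v :
  act (Bop r s Phi) p (Eop l c v) =
  Eop l c (act (Bop r s Phi) (p \Po (q ^ (s%:Z * l + r * c%:Z) *: 'X)) v).
Proof.
apply: act_twist; [exact: Bop_kadd | exact: Eop_kadd | exact: Bop_Eop].
Qed.

End Bop.

End Semilinear.

(** * Successive approximation in a complete filtered group *)

Section Approximation.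
Variables (V W : zmodType) (L : nat -> V -> Prop) (L' : nat -> W -> Prop) (D : V -> W).
Hypothesis D_add : {morph D : u v / u + v}.
Hypothesis L'_sub : forall n x y, L' n x -> L' n y -> L' n (x - y).
Hypothesis L_D : forall n x, L n x -> L' n (D x).
Hypothesis D_gr : forall n y, L' n y -> exists x, L n x /\ L' n.+1 (y - D x).
Hypothesis L_complete : forall u : nat -> V, (forall n, L n (u n)) ->
  exists x, forall n, L n (x - \sum_(i < n) u i).
Hypothesis L'_separated : forall y, (forall n, L' n y) -> y = 0.

(** The residue [Y n] is pushed one step down the filtration by a correction [u n]; completeness
    sums the corrections, and separatedness shows that the limit is an exact solution. *)
Lemma approx_surj y : L' 0%N y -> exists x, L 0%N x /\ D x = y.
Proof.
move=> Ly.
have g n z : {x | L' n z -> L n x /\ L' n.+1 (z - D x)}.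
  apply: constructive_indefinite_description.
  case: (classic (L' n z)) => [/D_gr [x Hx]|H]; first by exists x.
  by exists 0.
pose Y := fix Y n := if n is m.+1 then Y m - D (sval (g m (Y m))) else y.
have LY n : L' n (Y n) by elim: n => //= n IH; case: (g n (Y n)) => x /= [].
have D0 : D 0 = 0 by apply: (addIr (D 0)); rewrite -D_add !add0r.
have DN x : D (- x) = - D x by apply: (addIr (D x)); rewrite -D_add !addNr D0.
pose u n := sval (g n (Y n)).
have uL n : L n (u n) by rewrite /u; case: (g n (Y n)) => x /= [].
have [x xL] := L_complete uL.
exists x; split; first by have := xL 0%N; rewrite big_ord0 subr0.
apply: subr0_eq; apply: L'_separated => n.
have -> : D x - y = D (x - \sum_(i < n) u i) - Y n.
  rewrite D_add DN; suff -> : Y n = y - D (\sum_(i < n) u i).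
    by rewrite opprB addrA subrK.
  elim: n => [|n IH]; first by rewrite big_ord0 D0 subr0.
  by rewrite big_ord_recr /= D_add opprD addrA -IH.
by apply: L'_sub; [exact: L_D | exact: LY].
Qed.
End Approximation.

(** * Polynomials *)

Section PolyFacts.
Variable k : fieldType.
Implicit Types p f g h : {poly k}.

Lemma irred_factor p : (1 < size p)%N ->
  exists g, [/\ g \is monic, irreducible_poly g & g %| p].
Proof.
have [n] := ubnP (size p); elim: n p => // n IH p lt sz.
have p0 : p != 0 by rewrite -size_poly_gt0; apply: leq_trans sz.
case: (classic (irreducible_poly p)) => [irr|nirr].
  have l0 : lead_coef p != 0 by rewrite lead_coef_eq0.
  exists ((lead_coef p)^-1 *: p); split.
  - by rewrite monicE lead_coefZ mulVf.
  - split=> [|d d1]; first by rewrite size_scale ?invr_eq0.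
    rewrite dvdpZr ?invr_eq0 // => /(irr.2 _ d1) dp.
    by rewrite (eqp_trans dp) // eqp_sym eqp_scale ?invr_eq0.
  - by rewrite dvdpZl ?invr_eq0.
have [d [d1 dp ndp]] : exists d : {poly k}, [/\ size d != 1%N, d %| p & ~~ (d %= p)].
  apply: NNPP => H; apply: nirr; split=> // d d1 dp.
  by apply: contraT => ndp; case: H; exists d.
have d0 : d != 0 by apply: contraTneq dp => ->; rewrite dvd0p.
have szd : (1 < size d)%N by rewrite ltn_neqAle eq_sym d1 size_poly_gt0.
have ltd : (size d < size p)%N.
  by rewrite ltn_neqAle dvdp_leq // andbT dvdp_size_eqp.
have [|g [g1 g2 g3]] := IH d _ szd; first exact: leq_trans ltd _.
by exists g; split=> //; exact: dvdp_trans dp.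
Qed.

Lemma irred_monic_dvd f g : f \is monic -> g \is monic ->
  irreducible_poly f -> irreducible_poly g -> f %| g -> f = g.
Proof.
move=> mf mg [sf _] ig fg; apply/eqP; rewrite -eqp_monic //.
by apply: ig.2 => //; rewrite gtn_eqF.
Qed.

Lemma irred_dvdX f p n : irreducible_poly f -> f %| p ^+ n -> f %| p.
Proof.
move=> irr; elim: n => [|n IH].
  by rewrite expr0 dvdp1 => /eqP sf; have := irr.1; rewrite sf.
rewrite exprS; case fp: (f %| p) => //.
have cop : coprimep f p by rewrite irreducible_poly_coprime // fp.
by rewrite Gauss_dvdpr // => /IH; rewrite fp.
Qed.

Lemma size_mulr_lt p g : p != 0 -> (1 < size g)%N -> (size p < size (p * g)%R)%N.
Proof.
move=> p0 sg; have g0 : g != 0 by rewrite -size_poly_gt0 ltnW.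
by rewrite size_mul // -(prednK (ltnW sg)) addnS /= -addn1 leq_add2l -ltnS prednK // ltnW.
Qed.

Lemma irred_coprimep_deriv f : [pchar k] =i pred0 -> f \is monic ->
  irreducible_poly f -> coprimep f f^`().
Proof.
move=> char0 mf irf; rewrite irreducible_poly_coprime //.
have sf := irf.1; have df0 : f^`() != 0.
  apply/eqP => /polyP /(_ (size f).-2); rewrite coef_deriv coef0.
  have -> : (size f).-2.+1 = (size f).-1 by case: (size f) sf => [|[]].
  rewrite -lead_coefE (eqP mf) => /eqP; rewrite ((pcharf0P k).1 char0).
  by case: (size f) sf => [|[]].
by apply/negP => /(dvdp_leq df0); rewrite leqNgt lt_size_deriv // monic_neq0.
Qed.

Lemma irred_multiplicity f h : h != 0 -> irreducible_poly f ->
  exists j h2, h = f ^+ j * h2 /\ coprimep f h2.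
Proof.
have [n] := ubnP (size h); elim: n h => // n IH h lt h0 irr.
case fh: (f %| h); last first.
  by exists 0%N, h; rewrite mul1r irreducible_poly_coprime // fh.
have [u eh] : exists u : {poly k}, h = u * f by apply/dvdpP.
have u0 : u != 0 by apply: contraNneq h0 => u0; rewrite eh u0 mul0r.
have f0 : f != 0 by exact: irredp_neq0.
have [|j [h2 [eu co]]] := IH u _ u0 irr.
  by apply: leq_trans (size_mulr_lt u0 irr.1) _; rewrite -eh -ltnS.
by exists j.+1, h2; split=> //; rewrite eh eu exprSr mulrAC.
Qed.

End PolyFacts.

Section Twist.
Variables (k : fieldType) (q : k).
Hypothesis q0 : q != 0.
Hypothesis qnr : forall n : nat, (0 < n)%N -> q ^+ n != 1.
Implicit Types (p f g : {poly k}) (i j : int).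

Lemma qz_eq1 i : q ^ i = 1 -> i = 0.
Proof.
case: i => [[|n]|n] //.
  by move=> e; have := @qnr n.+1 isT; rewrite -[q ^+ _]/(q ^ n.+1%:Z) e eqxx.
rewrite NegzE -exprnN => /(congr1 GRing.inv); rewrite invrK invr1 => e.
by have := @qnr n.+1 isT; rewrite e eqxx.
Qed.

(** p(q^i x), the polynomial by which p(B) acts in weight [i]. The action of sigma_q on S is [tw 1]
    normalised to be monic. *)
Definition tw i p := p \Po (q ^ i *: 'X).

Lemma qz_neq0 i : q ^ i != 0. Proof. exact: expfz_neq0. Qed.
Hint Resolve qz_neq0 : core.

Lemma coef_tw i p (j : nat) : (tw i p)`_j = (q ^ i) ^+ j * p`_j.
Proof.
rewrite /tw comp_polyE coef_sum.
under eq_bigr => n _ do rewrite exprZn !coefZ coefXn.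
case: (ltnP j (size p)) => lt.
  rewrite (bigD1 (Ordinal lt)) //= big1 ?addr0 => [|n nj].
    by rewrite eqxx mulr1 mulrC.
  by rewrite eq_sym -[j]/(nat_of_ord (Ordinal lt)) (inj_eq val_inj) (negbTE nj) !mulr0.
rewrite big1 ?nth_default ?mulr0 // => n _.
by rewrite gtn_eqF ?mulr0 //; apply: leq_trans lt.
Qed.

Lemma size_tw i p : size (tw i p) = size p.
Proof. by rewrite size_comp_poly2 // size_scale // size_polyX. Qed.

Lemma tw0 p : tw 0 p = p.
Proof. by rewrite /tw expr0z scale1r comp_polyXr. Qed.

Lemma twD i j p : tw i (tw j p) = tw (i + j) p.
Proof.
by apply/polyP => n; rewrite !coef_tw mulrA -exprMn -expfzDr.
Qed.

Lemma twM i p1 p2 : tw i (p1 * p2) = tw i p1 * tw i p2.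
Proof. exact: comp_polyM. Qed.

Lemma twXn i p n : tw i (p ^+ n) = tw i p ^+ n.
Proof. exact: rmorphXn. Qed.

Lemma tw_coef0 i p : (tw i p)`_0 = p`_0.
Proof. by rewrite coef_tw expr0 mul1r. Qed.

Lemma tw_dvd i p1 p2 : (tw i p1 %| tw i p2) = (p1 %| p2).
Proof.
have H j p p' : p %| p' -> tw j p %| tw j p'.
  by move/dvdpP => [u ->]; rewrite twM dvdp_mull.
apply/idP/idP; last exact: H.
by move/(H (- i)); rewrite !twD addNr !tw0.
Qed.

Lemma tw_irred i f : irreducible_poly f -> irreducible_poly (tw i f).
Proof.
case=> sf irr; split=> [|d d1]; first by rewrite size_tw.
rewrite -{1}[d](tw0) -(subrr i) -twD tw_dvd => /(irr _).
rewrite size_tw => /(_ d1) /andP[h1 h2].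
have e : d = tw i (tw (- i) d) by rewrite twD subrr tw0.
by rewrite /eqp e !tw_dvd h1 h2.
Qed.

(** [f] and its twist are associates. Their constant terms agree and are nonzero, so they are equal;
    the leading coefficients then give [q^(i deg f) = 1], which forces [i = 0] as q is not a root of
    unity. *)
Lemma tw_dvd_self i f : irreducible_poly f -> f`_0 != 0 -> f %| tw i f -> i = 0.
Proof.
move=> irr f0 dv; have : f %= tw i f.
  by apply: (tw_irred i irr).2 => //; rewrite gtn_eqF // irr.1.
case/eqpf_eq => c c0 e.
have c1 : c = 1.
  apply: (mulIf f0); rewrite mul1r.
  by have := congr1 (fun p : {poly k} => p`_0) e; rewrite coefZ tw_coef0.
have := congr1 (fun p : {poly k} => p`_(size f).-1) e.
rewrite c1 scale1r coef_tw => e1.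
have l0 : f`_(size f).-1 != 0 by rewrite -/(lead_coef f) lead_coef_eq0 irredp_neq0.
have : q ^ (i * (size f).-1%:Z) = 1 by
    rewrite -exprz_exp; apply: (mulIf l0); rewrite mul1r [RHS]e1.
move/qz_eq1/eqP; rewrite mulf_eq0 => /orP[/eqP->//|].
by have := irr.1; case: (size f) => [|[|n]].
Qed.

Definition norm_tw i f := q ^ (- (i * (size f).-1%:Z)) *: tw i f.

Lemma iter_sigmaS n f : iter n (sigmaS q) f = norm_tw n f.
Proof.
elim: n => [|n IH]; first by rewrite /norm_tw mul0r oppr0 expr0z scale1r tw0.
have sz : size (norm_tw n f) = size f by rewrite size_scale // size_tw.
rewrite iterS IH /sigmaS sz -[q *: 'X]/(q ^ 1 *: 'X) -/(tw 1 _).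
apply/polyP => j; rewrite coefZ coef_tw coefZ coef_tw [RHS]coefZ coef_tw.
rewrite !mulrA; congr (_ * _).
rewrite exprnN !exprnP !exprz_exp -!expfzDr //; congr (_ ^ _); lia.
Qed.

Lemma norm_tw_orbit i f g : g = norm_tw i f -> same_orbit q f g.
Proof.
case: i => n e; first by exists n; left; rewrite iter_sigmaS.
exists n.+1; right; rewrite iter_sigmaS e /norm_tw size_scale // size_tw.
apply/polyP => j; rewrite !coefZ coef_tw coefZ coef_tw.
rewrite !mulrA -[LHS]mul1r; congr (_ * _).
rewrite !exprnP !exprz_exp -!expfzDr // NegzE -(expr0z q); congr (_ ^ _); lia.
Qed.

Lemma dvd_tw_orbit i f g : f \is monic -> g \is monic ->
  irreducible_poly f -> irreducible_poly g -> f %| tw i g -> same_orbit q g f.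
Proof.
move=> mf mg irf irg dv; apply: (@norm_tw_orbit i).
have g0 : g != 0 by exact: irredp_neq0.
apply: irred_monic_dvd => //.
- rewrite monicE /norm_tw lead_coefZ lead_coefE size_tw coef_tw.
  rewrite -lead_coefE (eqP mg) mulr1 exprnP exprz_exp -expfzDr // addNr expr0z //.
- have [s1 s2] := tw_irred i irg; split=> [|d d1]; first by rewrite size_scale.
  rewrite dvdpZr // => /(s2 _ d1) dp.
  by rewrite (eqp_trans dp) // eqp_sym eqp_scale.
- by rewrite dvdpZr.
Qed.

Lemma same_orbit_tw f g : same_orbit q f g -> exists i c, c != 0 /\ g = c *: tw i f.
Proof.
case=> n [e|e].
  by exists n, (q ^ (- (n%:Z * (size f).-1%:Z))); rewrite e iter_sigmaS.
exists (- n%:Z), (q ^ (n%:Z * (size g).-1%:Z)); split=> //.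
rewrite e iter_sigmaS /norm_tw /tw comp_polyZ -/(tw _ _) -/(tw _ _) twD addNr tw0.
by rewrite scalerA -expfzDr // subrr expr0z scale1r.
Qed.

Section Eventually.
Variables (kbar : closedFieldType) (iota : {rmorphism k -> kbar}).

(** A common root x makes [q^i x] a root of [p] and x a root of [chi]. As p(0) is nonzero, each pair
    of roots is met for at most one [i], and there are finitely many pairs. *)
Lemma coprimep_tw p chi : p`_0 != 0 -> chi != 0 ->
  exists J : int, forall i, J <= i -> coprimep (tw i p) chi.
Proof.
move=> p0 chi0; have pn0 : p != 0 by apply: contraNneq p0 => ->; rewrite coef0.
have [s es] := closed_field_poly_normal (map_poly iota p).
have [r er] := closed_field_poly_normal (map_poly iota chi).
have rootE (pp : {poly k}) l : pp != 0 -> map_poly iota pp =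
    lead_coef (map_poly iota pp) *: \prod_(z <- l) ('X - z%:P) ->
    forall x, root (map_poly iota pp) x -> x \in l.
  move=> pp0 -> x; rewrite rootZ ?root_prod_XsubC //.
  by rewrite lead_coef_eq0 map_poly_eq0.
(* At most one exponent solves [q^i b = a]; the bound is one more than it, or 0 if there is none. *)
have one a b : a != 0 -> exists J : int, forall i, J <= i -> iota (q ^ i) * b != a.
  move=> a0; case: (classic (exists i0 : int, iota (q ^ i0) * b = a)) => [[i0 e]|H].
    exists (i0 + 1) => i le; apply/eqP => e'.
    have b0 : b != 0 by apply: contraNneq a0 => b0; rewrite -e b0 mulr0.
    move: e'; rewrite -e => /(mulIf b0)/fmorph_inj e'.
    have /qz_eq1 : q ^ (i - i0) = 1 by rewrite expfzDr // e' -expfzDr // subrr.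
    by lia.
  by exists 0 => i _; apply/eqP => e; case: H; exists i.
have [J HJ] : exists J : int, forall a b i, a \in s -> b \in r -> a != 0 -> J <= i ->
    iota (q ^ i) * b != a.
  elim: (s) => [|a s' [J1 IH]]; first by exists 0.
  have [J2 H2] : exists J : int, forall b i, b \in r -> a != 0 -> J <= i ->
      iota (q ^ i) * b != a.
    have [->|an0] := eqVneq a 0; first by exists 0.
    elim: (r) => [|b r' [J2 IH2]]; first by exists 0.
    have [J3 H3] := one a b an0.
    exists (Num.max J2 J3) => b' i; rewrite inE => /orP[/eqP ->|br] _ le.
      by apply: H3; lia.
    by apply: IH2 => //; lia.
  exists (Num.max J1 J2) => a' b i; rewrite inE => /orP[/eqP ->|as'] br an0 le.
    by apply: H2 => //; lia.
  by apply: IH => //; lia.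
exists J => i le; rewrite -(coprimep_map iota); apply/Pdiv.ClosedField.coprimepP => x.
rewrite /tw map_comp_poly map_polyZ map_polyX /root horner_comp hornerZ hornerX => rx.
apply/negP => rx'.
have xr : x \in r by exact: (rootE chi).
have xs : iota (q ^ i) * x \in s by exact: (rootE p).
have : iota (q ^ i) * x != 0.
  apply: contraNneq p0 => e0; move: rx; rewrite e0 => rx.
  by have := rx; rewrite horner_coef0 coef_map fmorph_eq0.
by move/(HJ _ _ _ xs xr)/(_ le)/eqP; apply.
Qed.
End Eventually.
End Twist.

(** * Filtrations *)

Section Filtration.
Variables (k : fieldType) (a b : nat) (s : nat) (e : 'I_a -> 'I_b -> int).
Hypothesis s_gt0 : (0 < s)%N.
Local Notation t := (tLS k).
Implicit Types (M N : 'M[LS k]_(a, b)) (i l : int).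

(* The coefficient of [t ^ l] in the entry [(x, y)] has weight [s l + e x y]. *)
Definition Fil i M := forall x y l, s%:Z * l + e x y < i -> co (M x y) l = 0.

Lemma FilB i M N : Fil i M -> Fil i N -> Fil i (M - N).
Proof. by move=> h1 h2 x y l lt; rewrite !mxE coD coN h1 ?h2 // subrr. Qed.
Lemma Fil0 i : Fil i 0.
Proof. by move=> x y l lt; rewrite mxE co0. Qed.
Lemma FilN i M : Fil i M -> Fil i (- M).
Proof. by move=> h; rewrite -sub0r; apply: FilB => //; exact: Fil0. Qed.
Lemma FilD i M N : Fil i M -> Fil i N -> Fil i (M + N).
Proof. by move=> h1 h2; rewrite -[N]opprK; apply: FilB => //; exact: FilN. Qed.
Lemma Fil_sum i I (r : seq I) (P : pred I) (G : I -> 'M[LS k]_(a, b)) :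
  (forall x, P x -> Fil i (G x)) -> Fil i (\sum_(x <- r | P x) G x).
Proof. by move=> h; apply: (big_ind (Fil i)) => //; [exact: Fil0 | move=> ? ?; exact: FilD]. Qed.
Lemma Fil_le i j M : i <= j -> Fil j M -> Fil i M.
Proof. by move=> le h x y l lt; apply: h; apply: lt_le_trans lt le. Qed.
Lemma Fil_cst i c M : Fil i M -> Fil i (cstLS c *: M).
Proof. by move=> h x y l lt; rewrite mxE co_cst h ?mulr0. Qed.
Lemma Fil_t i n M : Fil i M -> Fil (i + s%:Z * n) (t ^ n *: M).
Proof. by move=> h x y l lt; rewrite mxE co_t h //; lia. Qed.

Let E := (\sum_x \sum_y `|e x y|)%N.
Let eE x y : `|e x y| <= E%:Z.
Proof. by rewrite /E (bigD1 x) //= (bigD1 y) //=; lia. Qed.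

Lemma low_weight i : exists L : int, forall x y l, l < L -> s%:Z * l + e x y < i.
Proof.
exists (- (`|i| + E%:Z)) => x y l lt; have := eE x y.
have h1 : l < 0 by lia.
have : s%:Z * l <= l by nia.
by lia.
Qed.

Lemma Fil_bound M : exists i, Fil i M.
Proof.
have [L HL] : exists L : int, forall x y l, l < L -> co (M x y) l = 0.
  have H x : exists L : int, forall y l, l < L -> co (M x y) l = 0.
    have [f Hf] : exists f : 'I_b -> int, forall y l, l < f y -> co (M x y) l = 0.
      exists (fun y => sval (constructive_indefinite_description _ (co_bound (M x y)))) => y l.
      by case: constructive_indefinite_description => /= N; apply.
    exists (- (\sum_y `|f y|)%N%:Z) => y l lt; apply: Hf.
    have : (`|f y| <= \sum_y `|f y|)%N by rewrite (bigD1 y) //= leq_addr.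
    by lia.
  exists (- (\sum_x `|sval (constructive_indefinite_description _ (H x))|)%N%:Z) => x y l.
  rewrite (bigD1 x) //=; case: constructive_indefinite_description => /= N HN lt.
  by apply: HN; lia.
exists (s%:Z * L - E%:Z) => x y l lt; apply: HL; have := eE x y; nia.
Qed.

Lemma Fil_sep M : (forall i, Fil i M) -> M = 0.
Proof.
move=> h; apply/matrixP => x y; rewrite mxE; apply: co_ext => l; rewrite co0.
by apply: (h (s%:Z * l + e x y + 1)); lia.
Qed.

Lemma Fil_lead M : M != 0 -> exists i, Fil i M /\ ~ Fil (i + 1) M.
Proof.
move=> M0; have [i hi] := Fil_bound M.
apply: NNPP => H; case/eqP: M0; apply: Fil_sep => j.
have all n : Fil (i + n%:Z) M.
  elim: n => [|n IH]; first by rewrite addr0.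
  apply: NNPP => nh; apply: H; exists (i + n%:Z); split=> //.
  by rewrite -addrA -PoszD addn1.
by apply: Fil_le (all `|j - i|%N); lia.
Qed.

Lemma Fil_complete i0 (u : nat -> 'M[LS k]_(a, b)) :
  (forall n, Fil (i0 + n%:Z) (u n)) ->
  exists M, forall n, Fil (i0 + n%:Z) (M - \sum_(i < n) u i).
Proof.
(* [u i] has no coefficient of weight below [i0 + i], so weight [w] is final once the terms with
   [i <= w - i0] are summed; negative counts are cut to 0. *)
move=> hu; pose K (w : int) : nat := if w - i0 + 1 is Posz n then n else 0%N.
pose S n := \sum_(i < n) u i.
have [L HL] := low_weight i0.
have ex x y : exists z, forall l, co z l = co (S (K (s%:Z * l + e x y)) x y) l.
  apply: (@co_mk _ _ L) => l /(HL x y) lt.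
  have -> : K (s%:Z * l + e x y) = 0%N.
    by rewrite /K; case E1: (_ - i0 + 1)%R => [n|n] //; lia.
  by rewrite /S big_ord0 mxE co0.
pose z x y := sval (constructive_indefinite_description _ (ex x y)).
exists (\matrix_(x, y) z x y) => n x y l lt; rewrite !mxE coD coN /z.
case: constructive_indefinite_description => /= z0 ->.
set K0 := K _; have leK : (K0 <= n)%N.
  by rewrite /K0 /K; case E1: (_ - i0 + 1)%R => [m|m] //; lia.
have -> : \sum_(i < n) u i = S K0 + \sum_(K0 <= i < n) u i.
  by rewrite /S -!(big_mkord xpredT u) -big_cat_nat.
rewrite mxE coD opprD addrA subrr sub0r.
suff F : Fil (s%:Z * l + e x y + 1) (\sum_(K0 <= i < n) u i).
  by rewrite (F x y l) ?oppr0 //; lia.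
rewrite big_nat_cond; apply: Fil_sum => i /andP[/andP[le _] _].
apply: Fil_le (hu i); move: le; rewrite /K0 /K.
by case E1: (_ - i0 + 1)%R => [m|m]; lia.
Qed.

(** Source and target start at separate weights [i0] and [i1] because p(B') for another slope shifts
    the filtration. *)
Lemma Fil_approx (D : 'M[LS k]_(a, b) -> 'M[LS k]_(a, b)) i0 i1 :
  {morph D : u v / u + v} ->
  (forall n : nat, forall M, Fil (i0 + n%:Z) M -> Fil (i1 + n%:Z) (D M)) ->
  (forall n : nat, forall N, Fil (i1 + n%:Z) N ->
     exists M, Fil (i0 + n%:Z) M /\ Fil (i1 + n%:Z + 1) (N - D M)) ->
  forall N, Fil i1 N -> exists M, Fil i0 M /\ D M = N.
Proof.
move=> Da h1 h2 N hN.
have [|||||M [hM eM]] := @approx_surj _ _ (fun n => Fil (i0 + n%:Z))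
    (fun n => Fil (i1 + n%:Z)) D Da _ h1 _ _ _ N.
- by move=> n x y; exact: FilB.
- move=> n y /h2 [x [hx hy]]; exists x; split=> //.
  by rewrite -addn1 PoszD addrA.
- by move=> u; exact: Fil_complete.
- move=> y hy; apply: Fil_sep => i; apply: Fil_le (hy `|i - i1|%N); lia.
- by rewrite addr0.
- by exists M; rewrite addr0 in hM.
Qed.

End Filtration.

(** * The modules V_{r,s}(P) *)

Section VrsCol.
Variables (k : fieldType) (q : k).
Hypothesis q0 : q != 0.
Variables (r : int) (s : nat) (P : {poly k}).
Hypotheses (s_gt0 : (0 < s)%N) (monP : P \is monic) (P0 : P`_0 != 0) (szP : (1 < size P)%N).
Local Notation t := (tLS k).
Local Notation m := (degS P).
Implicit Types (M N : 'M[LS k]_(m, s)) (l : int) (c : nat).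

Definition VM : 'M[LS k]_(m, s) -> 'M[LS k]_(m, s) :=
  VrsM (sigma_q q) t r (fun j : 'I_m => cstLS (- P`_j)).
Local Notation Phi := VM.

Lemma VM_semilin : semilin q Phi.
Proof.
split=> [M N|a M]; apply/matrixP => i j; rewrite !mxE.
  by case: ifP => _; [| case: ifP => _]; rewrite !(sigmaD q0); ring.
by case: ifP => _; [| case: ifP => _]; rewrite !(sigmaM q0); ring.
Qed.

(* The coefficient of [t ^ l] in column [c], with [v_j] encoded as [x ^ j]. In these
   coordinates [B = t^-r Phi^s] is diagonal: it multiplies by [q ^ wt c l * x] modulo [P]. *)
Definition Col M c l : {poly k} :=
  if insub c is Some c' then \poly_(j < m) (if insub j is Some j' then co (M j' c') l else 0)
  else 0.

Lemma m_gt0 : (0 < m)%N. Proof. by rewrite /degS -ltnS prednK // ltnW. Qed.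

Lemma size_Col M c l : (size (Col M c l) <= m)%N.
Proof. by rewrite /Col; case: insub => [c'|]; rewrite ?size_poly0 // size_poly. Qed.

Lemma Col_ltP M c l : (size (Col M c l) < size P)%N.
Proof. by apply: leq_ltn_trans (size_Col M c l) _; rewrite /degS ltn_predL ltnW. Qed.

Lemma coef_Col M (c : 'I_s) l (j : 'I_m) : (Col M c l)`_j = co (M j c) l.
Proof. by rewrite /Col valK coef_poly ltn_ord valK. Qed.

Lemma Col_ge M c l : (s <= c)%N -> Col M c l = 0.
Proof. by move=> le; rewrite /Col insubF // ltnNge le. Qed.

Lemma Col_eqP M c l (p : {poly k}) (lt : (c < s)%N) : (size p <= m)%N ->
  (forall j : 'I_m, co (M j (Ordinal lt)) l = p`_j) -> Col M c l = p.
Proof.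
move=> sp h; apply/polyP => j; case: (ltnP j m) => [jm|jm].
  by rewrite -(h (Ordinal jm)) -(coef_Col M (Ordinal lt) l (Ordinal jm)).
by rewrite !nth_default //; [apply: leq_trans sp _ | apply: leq_trans (size_Col _ _ _) _].
Qed.

Lemma Col_ext M N : (forall c l, (c < s)%N -> Col M c l = Col N c l) -> M = N.
Proof.
move=> h; apply/matrixP => i j; apply: co_ext => l.
by rewrite -!coef_Col h.
Qed.

Lemma ColB M N c l : Col (M - N) c l = Col M c l - Col N c l.
Proof.
case: (ltnP c s) => lt; last by rewrite !Col_ge ?subr0.
apply: (Col_eqP (lt := lt)) => [|j].
  by rewrite (leq_trans (size_polyD _ _)) // geq_max size_polyN !size_Col.
by rewrite coefB !mxE coD coN -!coef_Col.
Qed.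
Lemma Col0 c l : Col 0 c l = 0.
Proof. by have := ColB 0 0 c l; rewrite subrr => ->; rewrite subrr. Qed.
Lemma ColN N c l : Col (- N) c l = - Col N c l.
Proof. by rewrite -sub0r ColB Col0 sub0r. Qed.
Lemma ColD M N c l : Col (M + N) c l = Col M c l + Col N c l.
Proof. by rewrite -{1}[N]opprK ColB ColN opprK. Qed.
Lemma Col_cst a M c l : Col (cstLS a *: M) c l = a *: Col M c l.
Proof.
case: (ltnP c s) => lt; last by rewrite !Col_ge ?scaler0.
apply: (Col_eqP (lt := lt)) => [|j]; first by rewrite (leq_trans (size_scale_leq _ _)) ?size_Col.
by rewrite coefZ mxE co_cst -coef_Col.
Qed.
Lemma Col_t n M c l : Col (t ^ n *: M) c l = Col M c (l - n).
Proof.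
case: (ltnP c s) => lt; last by rewrite !Col_ge.
by apply: (Col_eqP (lt := lt)) => [|j]; rewrite ?size_Col // mxE co_t -coef_Col.
Qed.

Lemma mulX_modP (u : {poly k}) : (size u <= m)%N ->
  ('X * u) %% P = 'X * u - u`_m.-1 *: P.
Proof.
move=> su; have e : 'X * u = u`_m.-1 *: P + ('X * u - u`_m.-1 *: P) by rewrite addrC subrK.
rewrite {1}e modpD modpZl modpp scaler0 add0r modp_small //.
have mE : size P = m.+1 by rewrite /degS prednK // ltnW.
rewrite mE ltnS; apply/leq_sizeP => j; rewrite leq_eqVlt => /orP[/eqP <-|lt].
  rewrite coefB coefXM coefZ -(prednK m_gt0) /= (prednK m_gt0).
  by have := eqP monP; rewrite lead_coefE -/m => ->; rewrite mulr1 subrr.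
rewrite coefB coefXM coefZ [P`_j]nth_default ?mE // mulr0 subr0.
case: j lt => // j lt; rewrite nth_default //=.
exact: leq_trans su lt.
Qed.

Lemma Col_PhiS M c l : (c.+1 < s)%N -> Col (Phi M) c.+1 l = q ^ l *: Col M c l.
Proof.
move=> lt; apply: (Col_eqP (lt := lt)) => [|j].
  by rewrite (leq_trans (size_scale_leq _ _)) ?size_Col.
have lt' := ltnW lt.
rewrite coefZ mxE /= co_sigma //.
have -> : insubd (Ordinal lt) c = Ordinal lt' by apply: val_inj; rewrite val_insubd lt'.
by rewrite -coef_Col.
Qed.

Lemma Col_Phi0 M l : Col (Phi M) 0 l = q ^ (l - r) *: (('X * Col M s.-1 (l - r)) %% P).
Proof.
have mE : size P = m.+1 by rewrite /degS prednK // ltnW.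
have ls : (s.-1 < s)%N by rewrite ltn_predL.
rewrite mulX_modP ?size_Col //.
apply: (Col_eqP (lt := s_gt0)) => [|j].
  rewrite (leq_trans (size_scale_leq _ _)) // -mulX_modP ?size_Col //.
  by rewrite -ltnS -mE ltn_modp -size_poly_gt0 ltnW.
rewrite mxE /= co_t coD co_cst !co_sigma // coefZ coefB coefXM coefZ mulNr mulrDr.
rewrite (fun_if (fun x => co x (l - r))) co0 co_sigma // -!coef_Col !val_insubd /=.
rewrite ls ltn_predL m_gt0 (leq_ltn_trans (leq_pred _) (ltn_ord j)).
case: eqP => [->|/eqP]; rewrite ?ltnn; first by ring.
by rewrite -lt0n => ->; ring.
Qed.

Lemma Col_iter_ge n M c l : (c + n < s)%N ->
  Col (iter n Phi M) (c + n) l = q ^ (l * n%:Z) *: Col M c l.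
Proof.
elim: n => [|n IH] lt; first by rewrite addn0 mulr0 expr0z scale1r.
rewrite addnS in lt *; rewrite iterS Col_PhiS // IH; last exact: ltnW.
by rewrite scalerA -expfzDr //; congr (_ ^ _ *: _); lia.
Qed.

(** Column [c < n] is reached from column [s - n + c] through exactly one passage from the last
    column to column 0, which contributes [t^r] and the factor x. The [n - c] steps up to this
    passage see exponent [l - r], the [c] later ones exponent [l]. *)
Lemma Col_iter_lt n M c l : (c < n)%N -> (n <= s)%N ->
  Col (iter n Phi M) c l = q ^ (l * c%:Z + (l - r) * (n - c)%N%:Z) *:
    (('X * Col M (s - n + c) (l - r)) %% P).
Proof.
move=> cn ns.
have H X : Col (iter c Phi X) c l = q ^ (l * c%:Z) *: Col X 0 l.
  by have := @Col_iter_ge c X 0 l; rewrite add0n => -> //; exact: leq_trans ns.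
have e : n = (c + (n - c.+1).+1)%N by lia.
rewrite {1}e iterD H.
rewrite iterS Col_Phi0.
have -> : s.-1 = (s - n + c + (n - c.+1))%N by lia.
rewrite Col_iter_ge; last by lia.
rewrite -scalerAr modpZl !scalerA -!expfzDr //.
congr (_ ^ _ *: ((_ * Col M _ _) %% _)); lia.
Qed.

Definition wt c l : int := s%:Z * l + r * c%:Z.

Lemma Col_Bop M c l : (c < s)%N ->
  Col (Bop r s Phi M) c l = q ^ wt c l *: (('X * Col M c l) %% P).
Proof.
move=> lt; rewrite /Bop Col_t Col_iter_lt // subnn add0n opprK addrK.
by congr (_ ^ _ *: _); rewrite /wt; nia.
Qed.

Lemma Col_act p M c l : (c < s)%N ->
  Col (act (Bop r s Phi) p M) c l = (tw q (wt c l) p * Col M c l) %% P.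
Proof.
move=> lt; have kB := Bop_kadd q0 VM_semilin r s.
elim/poly_ind: p => [|p a IH].
  by rewrite act0 /tw comp_poly0 mul0r mod0p Col0.
rewrite actD actMX // actC // ColD Col_cst Col_Bop // IH.
rewrite /tw comp_polyD comp_polyM comp_polyX comp_polyC mulrDl modpD.
congr (_ + _); last by rewrite mul_polyC modpZl modp_small // Col_ltP.
rewrite modp_mul -modpZl; congr (_ %% _); rewrite -!mul_polyC; ring.
Qed.

Lemma Col_mk (phi : nat -> int -> {poly k}) (L : int) :
  (forall c l, (size (phi c l) <= m)%N) -> (forall c l, l < L -> phi c l = 0) ->
  exists M, forall c l, (c < s)%N -> Col M c l = phi c l.
Proof.
move=> sz lo.
have ex (j c : nat) : exists z, forall l, co z l = (phi c l)`_j.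
  by apply: (@co_mk _ _ L) => l lt; rewrite lo // coef0.
exists (\matrix_(j, c) sval (constructive_indefinite_description _ (ex j c))) => c l lt.
apply: (Col_eqP (lt := lt)) => // j; rewrite mxE.
by case: constructive_indefinite_description.
Qed.

Definition vec0 : 'M[LS k]_(m, s) :=
  \matrix_(j, c) ((j == 0 :> nat) && (c == 0 :> nat))%:R.

Lemma Col_vec0 c l : (c < s)%N -> Col vec0 c l = ((c == 0%N) && (l == 0))%:R.
Proof.
move=> lt; apply: (Col_eqP (lt := lt)) => [|j].
  by case: andP => _; rewrite ?size_poly1 ?size_poly0 ?m_gt0.
rewrite mxE /=; case: (c =P 0%N) => ce /=; last by rewrite andbF co0 coef0.
rewrite andbT -(rmorph_nat (@cstLS k)) [LHS]co_cst1.
by case: (l == 0); rewrite ?coef0 ?coef1 ?mulr0n ?mulr1n.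
Qed.

End VrsCol.

(** * Stable subspaces and torsion vectors *)

Section StableSpaces.
Variables (k : fieldType) (q : k).
Hypothesis q0 : q != 0.
Variables (V : vectType (LS k)) (Phi : V -> V).
Hypotheses (sl : semilin q Phi) (bij : bijective Phi).
Implicit Types (X Y U : {vspace V}) (v w : V).

Lemma semilin_sum n (c : 'I_n -> LS k) (x : 'I_n -> V) :
  Phi (\sum_i c i *: x i) = \sum_i sigma_q q (c i) *: Phi (x i).
Proof.
rewrite (kadd_sum (semilin_kadd q0 sl)); apply: eq_bigr => i _; exact: sl.2.
Qed.

(* [Phi] is injective and semilinear, so [Phi X] has the dimension of [X]. *)
Lemma stable_inv X v : Dq_stable Phi X -> Phi v \in X -> v \in X.
Proof.
move=> sX; have [sg' sgK sgK'] := sigma_bij q0; have inj := bij_inj bij.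
pose n := \dim X; pose b i := (vbasis X)`_i.
pose B := [tuple Phi (b i) | i < n].
have nthB (i : 'I_n) : B`_i = Phi (b i) by rewrite -tnth_nth tnth_mktuple.
have frB : free B.
  apply/freeP => c; under eq_bigr do rewrite nthB.
  move=> e i.
  have /inj e2 : Phi (\sum_i sg' (c i) *: b i) = Phi 0.
    rewrite semilin_sum (kadd0 (semilin_kadd q0 sl)) -[RHS]e.
    by apply: eq_bigr => j _; rewrite sgK'.
  have /freeP/(_ (fun i => sg' (c i)) e2 i) fi := basis_free (vbasisP X).
  by rewrite -[c i]sgK' fi (sigma0 q0).
have bB : basis_of X B.
  rewrite basisEfree frB size_tuple leqnn andbT; apply/span_subvP => x /mapP [i _ ->].
  by apply: sX; rewrite vbasis_mem ?memt_nth // mem_nth // size_tuple.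
move=> /(coord_basis bB) e.
have -> : v = \sum_i sg' (coord B i (Phi v)) *: b i.
  apply: inj; rewrite semilin_sum [LHS]e; apply: eq_bigr => i _.
  by rewrite sgK' nthB.
by apply: rpred_sum => i _; apply: rpredZ; rewrite vbasis_mem // mem_nth // size_tuple.
Qed.

Lemma stable_iter X n v : Dq_stable Phi X -> v \in X -> iter n Phi v \in X.
Proof. by move=> sX vX; elim: n => //= n; exact: sX. Qed.

Lemma stable_iter_inv X n v : Dq_stable Phi X -> iter n Phi v \in X -> v \in X.
Proof. by move=> sX; elim: n => //= n IH /(stable_inv sX). Qed.

Lemma stable_Eop X l c v : Dq_stable Phi X -> v \in X -> Eop Phi l c v \in X.
Proof. by move=> sX vX; apply: rpredZ; exact: stable_iter. Qed.

Lemma stable_Eop_inv X l c v : Dq_stable Phi X -> Eop Phi l c v \in X -> v \in X.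
Proof.
move=> sX; rewrite /Eop rpredZeq expfz_eq0 (negbTE (tLS_neq0 k)) andbF /=.
exact: stable_iter_inv.
Qed.

Lemma stable_Bop X r s v : Dq_stable Phi X -> v \in X -> Bop r s Phi v \in X.
Proof. exact: stable_Eop. Qed.

Lemma stable_act X r s p v : Dq_stable Phi X -> v \in X -> act (Bop r s Phi) p v \in X.
Proof. by move=> sX; apply: act_stable => w; exact: stable_Bop. Qed.

Lemma stable0 : Dq_stable Phi 0%VS.
Proof. by move=> v; rewrite !memv0 => /eqP ->; rewrite (kadd0 (semilin_kadd q0 sl)). Qed.
Lemma stableT : Dq_stable Phi fullv.
Proof. by move=> v _; exact: memvf. Qed.
Lemma stableD X Y : Dq_stable Phi X -> Dq_stable Phi Y -> Dq_stable Phi (X + Y).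
Proof.
move=> sX sY v /memv_addP [x xX [y yY ->]]; rewrite (sl.1 x y).
by apply: memv_add; [exact: sX | exact: sY].
Qed.

Lemma Eop_surj l c v : exists w, v = Eop Phi l c w.
Proof.
have [Psi PK KP] := bij.
exists (iter c Psi (tLS k ^ (- l) *: v)); rewrite /Eop.
have -> : forall u, iter c Phi (iter c Psi u) = u.
  by elim: c => // c IH u; rewrite (iterSr c Phi) iterS KP IH.
by rewrite scalerA -tLSD subrr expr0z scale1r.
Qed.

(** These vectors form a k-space but in general not a k((t))-subspace, as an infinite sum over
    different weights need not be torsion. *)
Definition tors r s v := exists p : {poly k}, p`_0 != 0 /\ act (Bop r s Phi) p v = 0.

Lemma torsB r s v w : tors r s v -> tors r s w -> tors r s (v - w).
Proof.
have kB := Bop_kadd q0 sl r s.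
move=> [p [p0 pv]] [p' [p0' pw]]; exists (p * p'); split.
  by rewrite coef0M mulf_neq0.
rewrite actB2 // [p * p']mulrC actM // pv (act02 kB) mulrC actM // pw.
by rewrite (act02 kB) subrr.
Qed.
Lemma tors0 r s : tors r s 0.
Proof.
exists 1; split; first by rewrite coef1 oner_neq0.
by rewrite (act02 (Bop_kadd q0 sl r s)).
Qed.
Lemma torsD r s v w : tors r s v -> tors r s w -> tors r s (v + w).
Proof.
by move=> tv tw; rewrite -[w]opprK; apply: torsB => //; rewrite -[- w]sub0r; apply: torsB => //; exact: tors0.
Qed.

(* Modulo a good subspace, a torsion class lifts to a torsion vector: if [p(B) w]
   lies in [X], subtract from [w] the [x] found below. *)
Definition good X := Dq_stable Phi X /\
  forall (r : int) (s : nat) (p : {poly k}), (0 < s)%N -> coprime `|r| s -> p`_0 != 0 ->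
  forall y, y \in X -> exists x, x \in X /\ tors r s (y - act (Bop r s Phi) p x).

Lemma good0 : good 0%VS.
Proof.
split=> [|r s p s0 co p0 y]; first exact: stable0.
rewrite memv0 => /eqP ->; exists 0; rewrite mem0v; split=> //.
by rewrite (act02 (Bop_kadd q0 sl r s)) subrr; exact: tors0.
Qed.

Lemma goodD X Y : good X -> good Y -> good (X + Y).
Proof.
move=> [sX gX] [sY gY]; split=> [|r s p s0 co p0 y]; first exact: stableD.
case/memv_addP => x /(gX _ _ _ s0 co p0) [x' [x'X tx]] [z /(gY _ _ _ s0 co p0) [z' [z'Y tz]] ->].
exists (x' + z'); split; first exact: memv_add.
rewrite (actD2 (Bop_kadd q0 sl r s)) opprD addrACA; exact: torsD.
Qed.

End StableSpaces.

(** * Torsion and surjectivity in V_{r,s}(P) *)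

Section VrsTorsion.
Variables (k : fieldType) (q : k).
Hypothesis q0 : q != 0.
Hypothesis qnr : forall n : nat, (0 < n)%N -> q ^+ n != 1.
Variables (r : int) (s : nat) (P : {poly k}).
Hypotheses (s_gt0 : (0 < s)%N) (co_rs : coprime `|r| s).
Hypotheses (monP : P \is monic) (P0 : P`_0 != 0) (szP : (1 < size P)%N).
Local Notation t := (tLS k).
Local Notation m := (degS P).
Local Notation Phi := (@VM k q r s P).
Local Notation FilV := (@Fil k m s s (fun _ c => r * c%:Z)).
Implicit Types (M N : 'M[LS k]_(m, s)).

Lemma FilV_Col i M : FilV i M <->
  forall c l, (c < s)%N -> wt r s c l < i -> Col M c l = 0.
Proof.
split=> [h c l lt wlt|h j c l wlt].
  apply: (Col_eqP (lt := lt)) => [|j]; first by rewrite size_poly0.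
  by rewrite coef0 h.
by rewrite -coef_Col h ?coef0.
Qed.

Lemma Col_low N : exists L : int, forall c l, l < L -> Col N c l = 0.
Proof.
have [i] := @Fil_bound k m s s (fun _ c => r * c%:Z) s_gt0 N; move/FilV_Col => h.
have [L HL] := low_weight (fun (_ : 'I_1) (c : 'I_s) => r * c%:Z) s_gt0 i.
exists L => c l lt; case: (ltnP c s) => cs; last exact: Col_ge.
by apply: h => //; exact: (HL ord0 (Ordinal cs)).
Qed.

Lemma mulX_modP0 (u : {poly k}) : (size u < size P)%N -> ('X * u) %% P = 0 -> u = 0.
Proof.
move=> su /eqP; rewrite -/(_ %| _) Gauss_dvdpr; last first.
  by rewrite coprimepX /root horner_coef0.
move=> dv; apply/eqP; apply: contraTT su => u0.
by rewrite -leqNgt dvdp_leq.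
Qed.

Lemma FilV_Phi i M : FilV i M -> FilV (i + r) (Phi M).
Proof.
move/FilV_Col => h; apply/FilV_Col => -[|c] l lt; rewrite /wt => wlt.
  rewrite Col_Phi0 // h ?mulr0 ?mod0p ?scaler0 ?ltn_predL //.
  by rewrite /wt; nia.
rewrite Col_PhiS // h ?scaler0 //; first exact: ltnW.
by rewrite /wt; nia.
Qed.

(** [Phi] shifts weights by exactly [r]: the passage to column 0 loses nothing because x is
    invertible modulo [P], P(0) being nonzero. *)
Lemma FilV_Phi_inv i M : FilV (i + r) (Phi M) -> FilV i M.
Proof.
move/FilV_Col => h; apply/FilV_Col => c l lt wlt.
case: (ltnP c.+1 s) => lt'.
  have := h c.+1 l lt'; rewrite Col_PhiS // => H.
  have /eqP : q ^ l *: Col M c l = 0 by apply: H; move: wlt; rewrite /wt; nia.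
  by rewrite scaler_eq0 expfz_eq0 (negbTE q0) andbF => /eqP.
have ce : c = s.-1 by apply/eqP; rewrite eqn_leq -ltnS prednK // lt -ltnS prednK.
have := h 0%N (l + r) s_gt0; rewrite Col_Phi0 // addrK -ce => H.
have /eqP : q ^ l *: (('X * Col M c l) %% P) = 0.
  by apply: H; move: wlt; rewrite /wt ce; nia.
rewrite scaler_eq0 expfz_eq0 (negbTE q0) andbF => /eqP /mulX_modP0; apply.
exact: Col_ltP.
Qed.

Lemma VM_inj : injective Phi.
Proof.
move=> M N e; have e0 : Phi (M - N) = 0 by rewrite (kaddB (semilin_kadd q0 (VM_semilin q0 r s P))) e subrr.
apply: subr0_eq; apply: (Fil_sep s_gt0 (e := fun _ c => r * c%:Z)) => i.
by apply: FilV_Phi_inv; rewrite e0; exact: Fil0.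
Qed.

Lemma VM_surj N : exists M, Phi M = N.
Proof.
have : coprimep 'X P by rewrite coprimep_sym coprimepX /root horner_coef0.
case/Bezout_eq1_coprimepP => -[v w] /= vw.
pose phi (c : nat) l := if (c.+1 < s)%N then q ^ (- l) *: Col N c.+1 l
  else q ^ (- l) *: ((v * Col N 0 (l + r)) %% P).
have Pn0 : P != 0 by rewrite -size_poly_gt0 ltnW.
have [L HL] := Col_low N.
(* The last column of the preimage takes its value from column 0 of [N] at exponent [l + r], with
   [v] the inverse of x modulo [P]; this explains the margin in the lower bound. *)
have [||M HM] := @Col_mk k s P phi (L - `|r|).
- move=> c l; rewrite /phi; case: ifP => _; rewrite (leq_trans (size_scale_leq _ _)) ?size_Col //.
  by rewrite -ltnS /degS prednK ?ltn_modp // ltnW.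
- move=> c l lt; rewrite /phi; case: ifP => _; rewrite HL ?mulr0 ?mod0p ?scaler0 //; lia.
exists M; apply: Col_ext => -[|c] l lt.
  rewrite Col_Phi0 // HM ?ltn_predL // /phi prednK // ltnn subrK.
  rewrite -scalerAr modpZl scalerA -expfzDr // subrr expr0z scale1r.
  rewrite modp_mul mulrA ['X * v]mulrC.
  have -> : v * 'X = 1 - w * P by rewrite -vw addrK.
  rewrite mulrBl mul1r modpD modpN mulrAC modp_mull oppr0 addr0.
  by rewrite modp_small ?Col_ltP.
rewrite Col_PhiS // HM ?(ltnW lt) // /phi lt scalerA -expfzDr // subrr expr0z scale1r //.
Qed.

Lemma VM_bij : bijective Phi.
Proof.
have H N := constructive_indefinite_description _ (VM_surj N).
exists (fun N => sval (H N)) => [M|N]; last by case: (H N).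
by apply: VM_inj; case: (H (Phi M)).
Qed.

Section OtherSlope.
Variables (r' : int) (s' : nat).
Let B' := Bop r' s' Phi.
(** The difference of slopes [r/s - r'/s'], multiplied by [s s']. *)
Let nu : int := s'%:Z * r - s%:Z * r'.
Let slV := VM_semilin q0 r s P.
Let kB' : kadd B' := Bop_kadd q0 slV r' s'.

Lemma FilV_Bop i M : FilV i M -> FilV (i + nu) (B' M).
Proof.
move=> h; have : FilV (i + s'%:Z * r) (iter s' Phi M).
  elim: (s') => [|n IH]; first by rewrite mul0r addr0.
  have := FilV_Phi IH; rewrite iterS.
  by have -> : i + n%:Z * r + r = i + n.+1%:Z * r by lia.
move/(Fil_t (n := - r') s_gt0); rewrite /B' /Bop.
by have -> : i + s'%:Z * r + s%:Z * - r' = i + nu by rewrite /nu; lia.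
Qed.

Lemma FilV_Bop_inv i M : FilV (i + nu) (B' M) -> FilV i M.
Proof.
move/(Fil_t (n := r') s_gt0); rewrite /B' /Bop scalerA -tLSD subrr expr0z scale1r.
have -> : i + nu + s%:Z * r' = i + s'%:Z * r by rewrite /nu; lia.
elim: (s') => [|n IH]; first by rewrite mul0r addr0.
rewrite iterS => h; apply: IH; apply: FilV_Phi_inv.
by have -> : i + n%:Z * r + r = i + n.+1%:Z * r by lia.
Qed.

Lemma FilV_iterBop n i M : FilV i M -> FilV (i + n%:Z * nu) (iter n B' M).
Proof.
move=> h; elim: n => [|n IH]; first by rewrite mul0r addr0.
by have := FilV_Bop IH; have -> : i + n%:Z * nu + nu = i + n.+1%:Z * nu by lia.
Qed.

Lemma FilV_iterBop_inv n i M : FilV (i + n%:Z * nu) (iter n B' M) -> FilV i M.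
Proof.
elim: n => [|n IH]; first by rewrite mul0r addr0.
have -> : i + n.+1%:Z * nu = i + n%:Z * nu + nu by lia.
by move/FilV_Bop_inv/IH.
Qed.

Lemma iterBop_surj n N : exists M, iter n B' M = N.
Proof.
elim: n N => [|n IH] N; first by exists N.
have [w ew] := Eop_surj VM_bij (- r') s' N; have [M eM] := IH w.
by exists M; rewrite iterS eM ew.
Qed.

(* [B'] shifts the filtration by [nu], so the constant term of [p(B')] dominates
   when [nu > 0] and the leading term when [nu < 0]. *)
Lemma act_dominant (p : {poly k}) : nu != 0 -> p`_0 != 0 -> exists n a, a != 0 /\
  forall i M, FilV i M -> FilV (i + n%:Z * nu + 1) (act B' p M - cstLS a *: iter n B' M).
Proof.
move=> nu0 p0; have pn0 : p != 0 by apply: contraNneq p0 => ->; rewrite coef0.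
have sp : (0 < size p)%N by rewrite size_poly_gt0.
have H (n0 : 'I_(size p)) : (forall n : 'I_(size p), n != n0 -> n0%:Z * nu < n%:Z * nu) ->
    forall i M, FilV i M ->
    FilV (i + n0%:Z * nu + 1) (act B' p M - cstLS p`_n0 *: iter n0 B' M).
  move=> lt i M h; rewrite act_split.
  apply: Fil_sum => n /lt {}lt; apply: Fil_cst.
  by apply: Fil_le (FilV_iterBop (n := n) h); lia.
case: (ltrgtP nu 0) nu0 => // [neg|pos] _.
  have ls : ((size p).-1 < size p)%N by rewrite ltn_predL.
  exists (size p).-1, (lead_coef p); split; first by rewrite lead_coef_eq0.
  apply: (H (Ordinal ls)) => n nn0; have := ltn_ord n; move: nn0.
  by rewrite -(inj_eq val_inj) /=; nia.
exists 0%N, p`_0; split=> //; apply: (H (Ordinal sp)) => n.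
by rewrite -(inj_eq val_inj) /=; nia.
Qed.

(** For nonzero [nu] the dominant term of p(B') carries the leading part of [M] injectively to the
    weight [i + n nu], and no other term of p(B') M has a part there that could cancel it. *)
Lemma torsion_slope0 (p : {poly k}) M : p`_0 != 0 -> M != 0 -> act B' p M = 0 -> nu = 0.
Proof.
move=> p0 M0 pM; apply/eqP; apply: contraT => nu0.
have [n [a [a0 h]]] := act_dominant nu0 p0.
have [i [h1 h2]] := Fil_lead (fun _ c => r * c%:Z) s_gt0 M0; case: h2.
apply: (@FilV_iterBop_inv n).
have := h _ _ h1; rewrite pM sub0r => /FilN; rewrite opprK => /(Fil_cst a^-1).
by rewrite scalerA -rmorphM mulVf // rmorph1 scale1r addrAC.
Qed.

(** The dominant term is bijective and shifts weights by exactly [n nu]; inverting it solves the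
    equation up to the next weight, and approximation does the rest. *)
Lemma act_surj_slope (p : {poly k}) : nu != 0 -> p`_0 != 0 -> forall N, exists M, act B' p M = N.
Proof.
move=> nu0 p0 N; have [n [a [a0 h]]] := act_dominant nu0 p0.
have [i hi] := @Fil_bound k m s s (fun _ c => r * c%:Z) s_gt0 N.
have [|||M [_ <-]] := @Fil_approx k m s s (fun _ c => r * c%:Z) s_gt0 (act B' p)
    (i - n%:Z * nu) i _ _ _ N hi; last by exists M.
- exact: (kaddD (act_kadd kB' p)).
- move=> j M hM; rewrite -[act B' p M](subrK (cstLS a *: iter n B' M)).
  apply: FilD; first by apply: Fil_le (h _ _ hM); lia.
  by apply: Fil_cst; apply: Fil_le (FilV_iterBop (n := n) hM); lia.
move=> j N' hN'; have [M eM] := iterBop_surj n (cstLS a^-1 *: N').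
exists M; have hM : FilV (i - n%:Z * nu + j%:Z) M.
  apply: (@FilV_iterBop_inv n); rewrite eM; apply: Fil_cst.
  by apply: Fil_le hN'; lia.
split=> //; have := h _ _ hM; rewrite eM scalerA -rmorphM mulfV // rmorph1 scale1r.
move=> /FilN; rewrite opprB; apply: Fil_le; lia.
Qed.

End OtherSlope.

Lemma slope_eq (r' : int) (s' : nat) : (0 < s')%N -> coprime `|r'| s' ->
  s'%:Z * r - s%:Z * r' = 0 -> r' = r /\ s' = s.
Proof.
move=> s'0 co' /eqP; rewrite subr_eq0 => /eqP e.
have e2 : (s' * `|r| = s * `|r'|)%N by have := congr1 absz e; rewrite !abszM.
have d1 : (s %| s')%N.
  by rewrite -(@Gauss_dvdl s s' `|r|%N) ?e2 ?dvdn_mulr // coprime_sym.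
have d2 : (s' %| s)%N.
  by rewrite -(@Gauss_dvdl s' s `|r'|%N) -?e2 ?dvdn_mulr // coprime_sym.
have es : s' = s by apply/eqP; rewrite eqn_dvd d1 d2.
by split=> //; move: e; rewrite es; nia.
Qed.

Lemma torsion_slope r' s' (p : {poly k}) M : (0 < s')%N -> coprime `|r'| s' ->
  p`_0 != 0 -> M != 0 -> act (Bop r' s' Phi) p M = 0 -> r' = r /\ s' = s.
Proof. by move=> h1 h2 h3 h4 h5; apply: slope_eq => //; exact: torsion_slope0 h5. Qed.

(** [s] divides [r (c' - c)], hence [c' - c], because [r] and [s] are coprime; and [c' - c] is
    smaller than [s]. *)
Lemma wt_inj c c' l l' : (c < s)%N -> (c' < s)%N -> wt r s c l = wt r s c' l' ->
  c = c' /\ l = l'.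
Proof.
wlog le : c c' l l' / (c <= c')%N.
  move=> H h1 h2 e; case: (leqP c c') => le; first exact: H.
  by have [] := H c' c l' l (ltnW le) h2 h1 (esym e).
rewrite /wt => h1 h2 e; have e1 : s%:Z * (l - l') = r * (c' - c)%N%:Z by nia.
have : (s %| c' - c)%N.
  rewrite -(@Gauss_dvdr s `|r|%N); last by rewrite coprime_sym.
  by have := congr1 absz e1; rewrite !abszM /= => <-; rewrite dvdn_mulr.
have c0 : (c' - c)%N = 0%N \/ (s <= c' - c)%N -> c = c' by lia.
move=> dv; have ec : c = c'.
  apply: c0; case: (posnP (c' - c)) => h; [by left | right; exact: dvdn_leq].
by split=> //; move: e; rewrite ec; nia.
Qed.

Lemma act_Col_dvd p M : act (Bop r s Phi) p M = 0 ->
  forall c l, (c < s)%N -> P %| tw q (wt r s c l) p * Col M c l.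
Proof. by move=> e c l lt; rewrite /dvdp -Col_act // e Col0. Qed.

Lemma act_Col_dvd_inv p M : 
  (forall c l, (c < s)%N -> P %| tw q (wt r s c l) p * Col M c l) ->
  act (Bop r s Phi) p M = 0.
Proof.
move=> h; apply: Col_ext => c l lt; rewrite Col_act // Col0.
by apply/eqP; exact: h.
Qed.

Lemma act_vec0 : act (Bop r s Phi) P (vec0 s P) = 0.
Proof.
apply: act_Col_dvd_inv => c l lt; rewrite Col_vec0 //.
case: andP => [[/eqP -> /eqP ->]|]; last by rewrite mulr0 dvdp0.
by rewrite /wt !mulr0 addr0 tw0 mulr1.
Qed.

(** [t^l0 Phi^c0] moves the piece at column 0, exponent 0 to column [c0], exponent [l0], and no
    power of q appears because the starting exponent is 0. *)
Lemma Col_single M c0 l0 : (c0 < s)%N ->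
  (forall c l, (c < s)%N -> (c, l) != (c0, l0) -> Col M c l = 0) ->
  M = Eop Phi l0 c0 (act (Bop r s Phi) (Col M c0 l0) (vec0 s P)).
Proof.
move=> lt0 h; apply: Col_ext => c l lt; rewrite /Eop Col_t.
set A := act _ _ _.
have ColA c' l' : (c' < s)%N ->
    Col A c' l' = if (c' == 0%N) && (l' == 0) then Col M c0 l0 else 0.
  move=> lt'; rewrite /A Col_act // Col_vec0 //; case: andP => [[/eqP -> /eqP ->]|_].
    by rewrite /wt !mulr0 addr0 tw0 mulr1 modp_small ?Col_ltP.
  by rewrite mulr0 mod0p.
case: (ltnP c c0) => lc.
  (* A column below [c0] comes from column [s - c0 + c], which is positive, where [A] vanishes. *)
  rewrite Col_iter_lt ?(ltnW lt0) // ColA; last by lia.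
  rewrite addn_eq0 subn_eq0 leqNgt lt0 /= mulr0 mod0p scaler0 h //.
  by rewrite xpair_eqE ltn_eqF.
have := Col_iter_ge (n := c0) (c := c - c0) q0 r s_gt0 monP P0 szP A (l - l0).
rewrite subnK // => -> //; rewrite ColA; last by lia.
case: andP => [[/eqP e1 /eqP e2]|ne].
  have -> : c = c0 by lia.
  by rewrite e2 mul0r expr0z scale1r; congr Col; lia.
rewrite scaler0; apply: h => //; apply: contra_notN ne; rewrite xpair_eqE => /andP[/eqP-> /eqP->].
by rewrite subnn subrr !eqxx.
Qed.

Section Primary.
Variables (f : {poly k}) (e : nat).
Hypotheses (fS : inS f) (Pe : P = f ^+ e).

(** If [f] did not divide the twist of [g] in some weight, that twist would be prime to [P], and [P]
    would divide a column of smaller degree. Two occupied weights would make [f] divide a proper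
    twist of itself, against [tw_dvd_self]. *)
Lemma torsion_primary g j M : inS g -> M != 0 ->
  act (Bop r s Phi) (g ^+ j) M = 0 ->
  exists c l, [/\ (c < s)%N, f %| tw q (wt r s c l) g, Col M c l != 0 &
    M = Eop Phi l c (act (Bop r s Phi) (Col M c l) (vec0 s P))].
Proof.
move=> [mg ig g0] M0 /act_Col_dvd dv; have [mf irf f0] := fS.
have key c l : (c < s)%N -> Col M c l != 0 -> f %| tw q (wt r s c l) g.
  move=> lt C0; have d := dv c l lt; rewrite twXn // in d.
  case E : (f %| _) => //.
  have : coprimep P (tw q (wt r s c l) g ^+ j).
    by rewrite Pe coprimep_expl // coprimep_expr // irreducible_poly_coprime // E.
  move/Gauss_dvdpr => H; rewrite H in d.
  by have := dvdp_leq C0 d; rewrite leqNgt Col_ltP.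
have [c [l [lt C0]]] : exists c l, (c < s)%N /\ Col M c l != 0.
  apply: NNPP => H; case/eqP: M0; apply: Col_ext => c l lt; rewrite Col0.
  by apply/eqP; apply: contraT => C0; case: H; exists c, l.
exists c, l; split=> //; first exact: key.
apply: Col_single => // c' l' lt' ne; apply/eqP; apply: contraNT ne => C0'.
have d1 := key _ _ lt C0; have d2 := key _ _ lt' C0'.
have eq1 : f %= tw q (wt r s c l) g.
  by apply: (tw_irred q0 _ ig).2 => //; rewrite gtn_eqF // irf.1.
have dd : f %| tw q (wt r s c' l' - wt r s c l) f.
  set d := wt r s c' l' - wt r s c l.
  have e2 : tw q d f %= tw q d (tw q (wt r s c l) g).
    by rewrite /eqp !(tw_dvd q0).
  by rewrite (eqp_dvdr _ e2) twD // subrK.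
have /eqP := tw_dvd_self q0 qnr irf f0 dd; rewrite subr_eq0 => /eqP we.
by have [-> ->] := wt_inj lt' lt we.
Qed.

End Primary.

(** For another slope p(B) is onto. For the slope r/s itself, p(q^i x) is a unit modulo [P] for
    [i >= J] and can be inverted column by column; what is left of [N] lies in finitely many weights
    and is torsion. *)
Lemma Vrs_good (kbar : closedFieldType) (iota : {rmorphism k -> kbar}) :
  good Phi fullv.
Proof.
split=> [|r' s' p s'0 co' p0 N _]; first by move=> v _; exact: memvf.
have slV := VM_semilin q0 r s P.
have [nu0|nu0] := eqVneq (s'%:Z * r - s%:Z * r') 0; last first.
  have [M <-] := act_surj_slope nu0 p0 N; exists M; rewrite memvf subrr.
  by split=> //; exact: (tors0 q0 slV).
have [-> ->] := slope_eq s'0 co' nu0.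
have Pn0 : P != 0 by rewrite -size_poly_gt0 ltnW.
have [J HJ] := coprimep_tw q0 qnr iota p0 Pn0.
have bz i : exists u, J <= i -> u * tw q i p %% P = 1 %% P.
  case: (lerP J i) => [le|_]; last by exists 0.
  have /Bezout_eq1_coprimepP [[u v] /= e] := HJ i le; exists u => _.
  by rewrite -e modpD modp_mull addr0.
pose u i := sval (constructive_indefinite_description _ (bz i)).
have [L HL] := Col_low N.
pose phi c l := if J <= wt r s c l then (u (wt r s c l) * Col N c l) %% P else 0.
have [||M HM] := @Col_mk k s P phi L.
- move=> c l; rewrite /phi; case: ifP => _; rewrite ?size_poly0 //.
  by rewrite -ltnS /degS prednK ?ltn_modp // ltnW.
- by move=> c l lt; rewrite /phi HL // mulr0 mod0p if_same.
exists M; split; first exact: memvf.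
set Y := N - _.
have ColY c l : (c < s)%N -> Col Y c l = if J <= wt r s c l then 0 else Col N c l.
  move=> lt; rewrite /Y ColB Col_act // HM // /phi; case: ifP => le; last first.
    by rewrite mulr0 mod0p subr0.
  rewrite modp_mul mulrA [tw _ _ _ * _]mulrC -[_ * Col N c l]mulrC -modp_mul.
  rewrite /u; case: constructive_indefinite_description => /= u0 /(_ le) ->.
  by rewrite modp_mul mulr1 modp_small ?Col_ltP // subrr.
have [i hi] := @Fil_bound k m s s (fun _ c => r * c%:Z) s_gt0 N.
pose K := `|J - i|%N.
(* The factor [tw (- w) P] kills weight [w], where it acts as [P] itself; the product runs over the
   weights from [i], the lowest one of [N], up to [J]. *)
exists (\prod_(n < K) tw q (- (i + n%:Z)) P); split.
  elim: K => [|K IH]; first by rewrite big_ord0 coef1 oner_neq0.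
  by rewrite big_ord_recr coef0M mulf_neq0 // tw_coef0.
apply: act_Col_dvd_inv => c l lt; rewrite ColY //.
case: (lerP J (wt r s c l)) => lw; first by rewrite mulr0 dvdp0.
case: (ltrP (wt r s c l) i) => lw'.
  by move/FilV_Col: hi => ->; rewrite ?mulr0 ?dvdp0.
have ltK : (`|wt r s c l - i| < K)%N by rewrite /K; lia.
apply: dvdp_mulr; rewrite (bigD1 (Ordinal ltK)) //= twM // dvdp_mulr //.
rewrite twD //; set z := (_ - _)%R; have -> : z = 0 by rewrite /z; lia.
by rewrite tw0.
Qed.

End VrsTorsion.

(** * Existence of torsion vectors *)

Section TorsionLattice.
Variables (k : fieldType) (Q : k) (kbar : closedFieldType) (iota : {rmorphism k -> kbar}).
Hypothesis Q0 : Q != 0.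
Hypothesis Qnr : forall n : nat, (0 < n)%N -> Q ^+ n != 1.
Variables (n : nat) (B : 'rV[LS k]_n.+1 -> 'rV[LS k]_n.+1) (m : 'I_n.+1 -> int).
Local Notation t := (tLS k).
Local Notation FilL := (@Fil k 1 n.+1 1 (fun _ j => - m j)).
Implicit Types (c : 'rV[LS k]_n.+1) (i : int).
Hypothesis kB : kadd B.
Hypothesis B_t : forall (i : int) c, B (t ^ i *: c) = cstLS (Q ^ i) *: (t ^ i *: B c).
Hypothesis B_Fil : forall c, FilL 0 c -> FilL 0 (B c).
Variable x0 : 'rV[LS k]_n.+1.
Hypothesis x0_Fil : FilL 0 x0.
Hypothesis B_nonnil : forall N, ~ FilL 1 (iter N B x0).

(** [FilL 0] is the lattice L with basis [t^(m j) e_j] and [FilL 1] is t L; [lc] is reduction of L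
    modulo t L and [lift] a section of it. *)
Let lc c : 'rV[k]_n.+1 := \row_j co (c 0 j) (m j).
Let lift (x : 'rV[k]_n.+1) : 'rV[LS k]_n.+1 := \row_j (t ^ (m j) * cstLS (x 0 j)).

Let lcD c c' : lc (c + c') = lc c + lc c'.
Proof. by apply/rowP => j; rewrite !mxE coD. Qed.
Let lcB c c' : lc (c - c') = lc c - lc c'.
Proof. by apply/rowP => j; rewrite !mxE coD coN. Qed.
Let lcZ a c : lc (cstLS a *: c) = a *: lc c.
Proof. by apply/rowP => j; rewrite !mxE co_cst. Qed.
Let lc_sum I (r : seq I) (P : pred I) (G : I -> 'rV[LS k]_n.+1) :
  lc (\sum_(x <- r | P x) G x) = \sum_(x <- r | P x) lc (G x).
Proof.
apply: big_morph; first exact: lcD.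
by apply/rowP => j; rewrite !mxE co0.
Qed.

Let Fil1P c : FilL 0 c -> lc c = 0 -> FilL 1 c.
Proof.
move=> h /rowP e x j l lt; rewrite !ord1.
case: (ltrP l (m j)) => le; first by rewrite h //; lia.
by have := e j; rewrite !mxE => e'; have -> : l = m j by lia.
Qed.
Let Fil1_lc c : FilL 1 c -> lc c = 0.
Proof. by move=> h; apply/rowP => j; rewrite !mxE h //; lia. Qed.

Let lift_lc x : lc (lift x) = x.
Proof. by apply/rowP => j; rewrite !mxE co_t subrr co_cst1 eqxx. Qed.
Let lift_Fil x : FilL 0 (lift x).
Proof.
move=> a j l lt; rewrite mxE co_t co_cst1.
by case: eqP => // e; lia.
Qed.

Let FilL_t i j c : FilL i c -> FilL (i + j) (t ^ j *: c).
Proof. by move=> h; have := @Fil_t k 1 n.+1 1 (fun _ j => - m j) isT i j c h; rewrite mul1r. Qed.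

Let B_FilL i c : FilL i c -> FilL i (B c).
Proof.
move=> h; have h0 : FilL 0 (t ^ (- i) *: c) by have := FilL_t (j := - i) h; rewrite subrr.
have -> : c = t ^ i *: (t ^ (- i) *: c) by rewrite scalerA -tLSD subrr expr0z scale1r.
by rewrite B_t; apply: Fil_cst; have := FilL_t (j := i) (B_Fil h0); rewrite add0r.
Qed.

Let iter_FilL i N c : FilL i c -> FilL i (iter N B c).
Proof. by move=> h; elim: N => //= N; exact: B_FilL. Qed.

Let act_FilL i p c : FilL i c -> FilL i (act B p c).
Proof. by move=> h; apply: Fil_sum => N _; apply: Fil_cst; apply: iter_FilL. Qed.

(** The k-linear map induced by [B] on L / t L, acting on row vectors. On [t^i L / t^(i+1) L] the
    induced map is [Q^i A], whence the twists by [Q]. *)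
Let A : 'M[k]_n.+1 := \matrix_i lc (B (lift (delta_mx 0 i))).

Let lcBA c : FilL 0 c -> lc (B c) = lc c *m A.
Proof.
move=> h; have e : lift (lc c) = \sum_i cstLS (lc c 0 i) *: lift (delta_mx 0 i).
  apply/rowP => j; rewrite summxE (bigD1 j) //= big1 ?addr0 => [|i ij].
    by rewrite !mxE !eqxx rmorph1 mulr1 mulrC.
  by rewrite !mxE eq_sym (negbTE ij) andbF rmorph0 !mulr0.
have F1 : FilL 1 (c - lift (lc c)).
  by apply: Fil1P; [apply: FilB => //; exact: lift_Fil | rewrite lcB lift_lc subrr].
have : lc (B (c - lift (lc c))) = 0 by apply: Fil1_lc; exact: B_FilL.
rewrite (kaddB kB) lcB => /subr0_eq ->.
rewrite e (kadd_sum kB) lc_sum mulmx_sum_row; apply: eq_bigr => i _.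
by rewrite (kaddZ kB) lcZ rowK.
Qed.

Let lc_act p c : FilL 0 c -> lc (act B p c) = lc c *m horner_mx A p.
Proof.
move=> h; elim/poly_ind: p => [|p a IH].
  rewrite act0 raddf0 mulmx0; by apply/rowP => j; rewrite !mxE co0.
rewrite actD (actMX kB) actC lcD lcZ lcBA ?IH; last exact: act_FilL.
rewrite rmorphD rmorphM /= horner_mx_X horner_mx_C mulmxDr mulmxA.
by rewrite mul_mx_scalar.
Qed.

Let act_tE i p c : act B p (t ^ i *: c) = t ^ i *: act B (tw Q i p) c.
Proof.
apply: (@act_twist k _ B kB (Q ^ i) (fun c => t ^ i *: c)) => [|v]; last exact: B_t.
by split=> [u v|a v]; rewrite ?scalerDr // !scalerA mulrC.
Qed.

(* Write the characteristic polynomial of [A] as [x ^ a * p] with [p(0) != 0]. For the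
   largest [j] such that [p(Q ^ j A)] is singular, a kernel vector gives an approximate
   solution of [p(B) c = 0] in [t ^ j L], and [p(B)] maps [t ^ (j + 1) L] onto itself. *)
Lemma lattice_torsion : exists c (p : {poly k}), [/\ c != 0, p`_0 != 0 & act B p c = 0].
Proof.
have chi0 : char_poly A != 0 by exact: monic_neq0 (char_poly_monic A).
have [a [p rp ep]] := multiplicity_XsubC (char_poly A) 0.
move: rp; rewrite chi0 /= => rp; rewrite subr0 in ep.
have p0 : p`_0 != 0 by rewrite -horner_coef0.
pose Pj (j : nat) := horner_mx A (tw Q j p).
(* If p(A) were invertible, [A^a p(A) = 0] (Cayley-Hamilton) would give [A^a = 0], against the
   non-nilpotence of [B] on [x0] modulo t. *)
have nu0 : Pj 0%N \notin unitmx.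
  apply/negP => u; apply: (@B_nonnil a); apply: Fil1P; first exact: iter_FilL.
  have -> : iter a B x0 = act B ('X^a) x0 by rewrite (actXn kB).
  have e : horner_mx A 'X^a *m Pj 0%N = 0.
    by rewrite -(Cayley_Hamilton A) ep mulrC rmorphM /= /Pj tw0.
  by rewrite lc_act // -(mulmxK u (horner_mx A 'X^a)) e mul0mx mulmx0.
have [J HJ] := coprimep_tw Q0 Qnr iota p0 chi0.
have uJ (j : nat) : J <= j%:Z -> Pj j \in unitmx.
  move/HJ => /Bezout_eq1_coprimepP [[u v] /= e].
  have : horner_mx A u *m Pj j = 1%:M.
    rewrite -[1%:M]/(1 : 'M_n.+1) -(rmorph1 (horner_mx A)) -e rmorphD !rmorphM /=.
    by rewrite Cayley_Hamilton mulr0 addr0.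
  by case/mulmx1_unit.
have ex : exists j, Pj j \notin unitmx by exists 0%N.
have bd j : Pj j \notin unitmx -> (j <= `|J|)%N.
  by apply: contraNT; rewrite -ltnNge => lt; apply: uJ; lia.
case: (ex_maxnP ex bd) => j nuj maxj {ex bd nu0}.
have [x xP xn0] : exists2 x : 'rV[k]_n.+1, x *m Pj j = 0 & x != 0.
  have : kermx (Pj j) != 0 by rewrite kermx_eq0 row_free_unit.
  by case/rowV0Pn => x /sub_kermxP xP xn0; exists x.
pose w0 := t ^ j%:Z *: lift x.
have Dw0 : FilL (j%:Z + 1) (act B p w0).
  rewrite /w0 act_tE addrC; apply: FilL_t; apply: Fil1P; first exact: act_FilL.
  by rewrite lc_act // lift_lc.
have [|||w1 [w1F e1]] := @Fil_approx k 1 n.+1 1 (fun _ j => - m j) isT (act B p)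
    (j%:Z + 1) (j%:Z + 1) _ _ _ _ Dw0.
- exact: (kaddD (act_kadd kB p)).
- by move=> N c; exact: act_FilL.
- move=> N c hc; set i := j%:Z + 1 + N%:Z.
  have iE : i = (j + 1 + N)%N%:Z by rewrite /i; lia.
  pose y := t ^ (- i) *: c.
  have y0 : FilL 0 y by have := FilL_t (j := - i) hc; rewrite subrr.
  have cE : c = t ^ i *: y by rewrite /y scalerA -tLSD subrr expr0z scale1r.
  have ui : Pj (j + 1 + N)%N \in unitmx.
    by apply: contraT => /maxj; lia.
  pose z := lc y *m invmx (Pj (j + 1 + N)%N).
  exists (t ^ i *: lift z); split; first by have := FilL_t (j := i) (lift_Fil z); rewrite add0r.
  rewrite act_tE cE -scalerBr addrC; apply: FilL_t; apply: Fil1P.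
    by apply: FilB => //; apply: act_FilL.
  by rewrite lcB lc_act // lift_lc iE mulmxKV // subrr.
(* The difference is nonzero: [w1] lies in [t^(j+1) L], whereas [w0] has the nonzero class of [x] in
   [t^j L / t^(j+1) L]. *)
exists (w0 - w1), p; split=> //; last by rewrite (actB2 kB) e1 subrr.
apply: contraNneq xn0 => /subr0_eq e0; rewrite -(lift_lc x); apply/eqP; apply: Fil1_lc.
have := w1F; rewrite -e0 => /(FilL_t (j := - j%:Z)).
by rewrite addrAC subrr add0r /w0 scalerA -tLSD addNr expr0z scale1r.
Qed.

End TorsionLattice.

Lemma coM_supp (k : fieldType) (x y : LS k) l : co (x * y) l != 0 ->
  exists l1 l2, [/\ l1 + l2 = l, co x l1 != 0 & co y l2 != 0].
Proof.
have [N [a [b [-> ->]]]] := LS_ex2 x y.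
have -> : tLS k ^- N * a%:F * (tLS k ^- N * b%:F) = tLS k ^- (N + N) * (a * b)%:F.
  by rewrite tofracM exprD invfM; ring.
rewrite co_expnE; case E: (l + _)%R => [i|i] /=; last by rewrite eqxx.
move=> h; have [j hj] : exists j : 'I_i.+1, pcoef a j * pcoef b (i - j) != 0.
  apply/existsP; apply: contraNT h; rewrite negb_exists => /forallP h.
  by rewrite big1 // => j _; have := h j; rewrite negbK => /eqP.
move: hj; rewrite mulf_eq0 negb_or => /andP[ha hb].
have := ltn_ord j; rewrite ltnS => le.
exists (j%:Z - N%:Z), ((i - j)%N%:Z - N%:Z); split; first by lia.
  by rewrite co_expnE subrK.
by rewrite co_expnE subrK.
Qed.

Lemma ceil_ex (s : nat) (z : int) : (0 < s)%N ->
  exists L : int, forall l, (s%:Z * l < z) = (l < L).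
Proof.
move=> s0; have [z0|z0] := lerP z 0.
  exists (- (`|z| %/ s)%N%:Z) => l.
  have := divn_eq `|z| s; have := ltn_pmod `|z|%N s0.
  move: (`|z| %/ s)%N (`|z| %% s)%N => d e; nia.
exists ((`|z|.-1 %/ s).+1%:Z) => l.
have := divn_eq `|z|.-1 s; have := ltn_pmod `|z|.-1 s0.
move: (`|z|.-1 %/ s)%N (`|z|.-1 %% s)%N => d e; nia.
Qed.

(* The companion module of a relation [Phi^n v = sum_j a_j Phi^j v]; [r/s] is
   the smallest slope of its Newton polygon, attained at the index [j0]. *)
Section Companion.
Variables (k : fieldType) (q : k) (kbar : closedFieldType) (iota : {rmorphism k -> kbar}).
Hypothesis q0 : q != 0.
Hypothesis qnr : forall n : nat, (0 < n)%N -> q ^+ n != 1.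
Local Notation t := (tLS k).
Variables (n : nat) (a : 'I_n.+1 -> LS k).
Variables (r : int) (s : nat).
Hypothesis s_gt0 : (0 < s)%N.
(** On the Newton polygon: no point lies below the line of slope r/s through the point of
    [Phi^(n+1)], the point of [j0] lies on it, and no smaller index gives a point on it. *)
Hypothesis H1 : forall (i : 'I_n.+1) l, s%:Z * l + r * i%:Z < r * n.+1%:Z -> co (a i) l = 0.
Variables (j0 : 'I_n.+1) (l0 : int).
Hypothesis H2 : s%:Z * l0 + r * j0%:Z = r * n.+1%:Z.
Hypothesis H2' : co (a j0) l0 != 0.
Hypothesis H3 : forall (i : 'I_n.+1) l, (i < j0)%N -> s%:Z * l + r * i%:Z = r * n.+1%:Z ->
  co (a i) l = 0.
Implicit Types (c : 'rV[LS k]_n.+1) (i l : int).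

Definition comp_mod c : 'rV[LS k]_n.+1 :=
  \row_j ((if (0 < j)%N then sigma_q q (c 0 (inord j.-1)) else 0)
          + sigma_q q (c 0 ord_max) * a j).
Local Notation Phi := comp_mod.

Lemma comp_semilin : semilin q Phi.
Proof.
split=> [u v|b v]; apply/rowP => j; rewrite !mxE.
  by case: ifP => _; rewrite !(sigmaD q0); ring.
by case: ifP => _; rewrite !(sigmaM q0); ring.
Qed.

Local Notation FilN := (@Fil k 1 n.+1 s (fun _ j => r * (j : nat)%:Z)).

Let inord_pred (j : 'I_n.+1) : (0 < j)%N -> (inord j.-1 : 'I_n.+1) = j.-1 :> nat.
Proof. by move=> j1; rewrite inordK // (leq_ltn_trans (leq_pred _)). Qed.

Let predE (j : nat) : (0 < j)%N -> j.-1%:Z = j%:Z - 1.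
Proof. by case: j => // j _; rewrite intS addrC addKr. Qed.

Let co_comp c j l : co (Phi c 0 j) l =
  (if (0 < j)%N then q ^ l * co (c 0 (inord j.-1)) l else 0)
  + co (sigma_q q (c 0 ord_max) * a j) l.
Proof. by rewrite mxE coD; case: ifP => _; rewrite ?co0 // co_sigma. Qed.

Let prod_supp i c (j : 'I_n.+1) l : FilN i c ->
  co (sigma_q q (c 0 ord_max) * a j) l != 0 ->
  exists l1 l2, [/\ l1 + l2 = l, co (c 0 ord_max) l1 != 0, co (a j) l2 != 0,
    i <= s%:Z * l1 + r * n%:Z & r * n.+1%:Z <= s%:Z * l2 + r * j%:Z].
Proof.
move=> h /coM_supp [l1 [l2 [e h1 h2]]]; exists l1, l2.
rewrite co_sigma // mulf_eq0 expfz_eq0 (negbTE q0) andbF /= in h1.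
split=> //; first by rewrite leNgt; apply: contra h1 => lt; rewrite h.
by rewrite leNgt; apply: contra h2 => lt; rewrite H1.
Qed.

Let comp_Fil i c : FilN i c -> FilN (i + r) (Phi c).
Proof.
move=> h x j l /= lt; rewrite ord1 co_comp.
have -> : co (sigma_q q (c 0 ord_max) * a j) l = 0.
  apply/eqP; apply: contraT => /(prod_supp h) [l1 [l2 [e _ _ h1 h2]]]; nia.
rewrite addr0; case: posnP => // j1; rewrite h ?mulr0 // inord_pred //.
by rewrite predE //; lia.
Qed.

(* The leading part of [c] is supported on the indices from [j0] on; the companion
   map is injective on such leading parts, so none of its powers raises the filtration. *)
Definition tight i c := FilN i c /\
  (exists (j : 'I_n.+1) l, [/\ (j0 <= j)%N, s%:Z * l + r * j%:Z = i & co (c 0 j) l != 0]) /\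
  (forall (j : 'I_n.+1) l, (j < j0)%N -> s%:Z * l + r * j%:Z = i -> co (c 0 j) l = 0).

(** If the leading part of [c] involves the last index, the relation creates a leading term at [j0],
    which nothing shifted from below [j0] can cancel. Otherwise the leading term at [j] simply moves
    to [j + 1]. *)
Lemma tight_comp i c : tight i c -> tight (i + r) (Phi c).
Proof.
move=> [h [[j [l [j0j e jl]]] low]]; split; first exact: comp_Fil.
split; last first.
  move=> j' l' lt e'; rewrite co_comp.
  have -> : co (sigma_q q (c 0 ord_max) * a j') l' = 0.
    apply/eqP; apply: contraT => /(prod_supp h) [l1 [l2 [e2 _ a2 h1 h2]]].
    by case/eqP: a2; apply: H3 => //; nia.
  rewrite addr0; case: posnP => // j1; rewrite low ?mulr0 // inord_pred //; first by lia.
  by rewrite predE //; lia.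
case: (classic (exists l', s%:Z * l' + r * n%:Z = i /\ co (c 0 ord_max) l' != 0)).
  move=> [l' [e' c']]; exists j0, (l' + l0); split=> //; first by nia.
  have [||_ eP] := @coM _ (sigma_q q (c 0 ord_max)) (a j0) l' l0.
  - by move=> l1 lt; rewrite co_sigma // h ?mulr0 //=; nia.
  - by move=> l1 lt; rewrite H1 //; nia.
  rewrite co_comp eP co_sigma //.
  have -> : (if (0 < j0)%N then q ^ (l' + l0) * co (c 0 (inord j0.-1)) (l' + l0) else 0) = 0.
    case: posnP => // j1; rewrite low ?mulr0 // inord_pred //; first by lia.
    by rewrite predE //; lia.
  by rewrite add0r !mulf_neq0 // expfz_neq0.
move=> nmax; have jn : (j < n)%N.
  rewrite ltn_neqAle -ltnS ltn_ord andbT; apply/eqP => jn; case: nmax; exists l.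
  have -> : ord_max = j by apply: val_inj; rewrite /= jn.
  by split=> //; move: e; rewrite jn.
have j1n : (j.+1 < n.+1)%N by [].
exists (Ordinal j1n), l; split; [exact: leqW | by rewrite /=; nia |].
rewrite co_comp /=.
have -> : co (sigma_q q (c 0 ord_max) * a (Ordinal j1n)) l = 0.
  apply/eqP; apply: contraT => /(prod_supp h) [l1 [l2 [e2 c1 _ h1 h2]]].
  by case: nmax; exists l1; split=> //; move: h2 => /=; nia.
have -> : inord j = j by apply: val_inj; rewrite /= inordK.
by rewrite addr0 mulf_neq0 // expfz_neq0.
Qed.

Lemma tight_t i z c : tight i c -> tight (i + s%:Z * z) (t ^ z *: c).
Proof.
move=> [h [[j [l [j0j e jl]]] low]]; split; first exact: Fil_t.
split; first by exists j, (l + z); split; rewrite ?mxE ?co_t ?addrK //; lia.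
by move=> j' l' lt e'; rewrite mxE co_t low //; nia.
Qed.

Lemma tight_Bop i c : tight i c -> tight i (Bop r s Phi c).
Proof.
move=> h; have : tight (i + s%:Z * r) (iter s Phi c).
  elim: (s) => [|N IH]; first by rewrite mul0r addr0.
  have := tight_comp IH; rewrite iterS.
  by have -> : i + N%:Z * r + r = i + N.+1%:Z * r by lia.
by move/(@tight_t _ (- r) _); rewrite /Bop mulrN addrK.
Qed.

(** The vectors of weight at least 0 form a lattice stable under [B], with basis [t^(m j) e_j] for
    [m j] the ceiling of [- r j / s]. [lattice_torsion] applies with [Q = q^s], as
    [Phi^s t = q^s t Phi^s]. *)
Lemma companion_torsion : exists c (p : {poly k}),
  [/\ c != 0, p`_0 != 0 & act (Bop r s Phi) p c = 0].
Proof.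
have cm j : exists L : int, forall l, (s%:Z * l < - (r * j%:Z)) = (l < L) by exact: ceil_ex.
pose m (j : 'I_n.+1) := sval (constructive_indefinite_description _ (cm j)).
have mE (j : 'I_n.+1) l : (s%:Z * l < - (r * j%:Z)) = (l < m j).
  by rewrite /m; case: constructive_indefinite_description.
(* [z] puts the weight of [t^z e_(j0)] in the range from 0 to [s - 1]. By tightness all its images
   under powers of [B] keep this weight, so they stay outside t L, whose weights are at least
   [s]. *)
have [z hz] := ceil_ex (- (r * j0%:Z)) s_gt0.
pose i := r * j0%:Z + s%:Z * z.
have zi : 0 <= i < s%:Z.
  have := hz z; rewrite ltxx => /negbT; have := hz (z - 1); rewrite /i.
  have -> : z - 1 < z by lia.
  move=> h1 h2; move: h1 h2; rewrite -leNgt; nia.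
have tx : tight i (t ^ z *: delta_mx 0 j0).
  rewrite /i; apply: tight_t; split.
    move=> x j l; rewrite ord1 mxE eqxx /= -(rmorph_nat (@cstLS k)) co_cst1.
    case: (l =P 0) => [->|]; last by rewrite mulr0n.
    by case: (j =P j0) => [->|]; [rewrite mulr0 add0r ltxx | rewrite mul0rn].
  split; first exists j0, 0; first split=> //; first by rewrite mulr0 add0r.
    by rewrite mxE !eqxx -(rmorph_nat (@cstLS k)) co_cst1 eqxx oner_neq0.
  by move=> j l lt _; rewrite mxE eqxx /= -(inj_eq val_inj) ltn_eqF // co0.
have tN N : tight i (iter N (Bop r s Phi) (t ^ z *: delta_mx 0 j0)).
  by elim: N => //= N; exact: tight_Bop.
have sl := comp_semilin.
have FN c : FilN 0 c <-> @Fil k 1 n.+1 1 (fun _ j => - m j) 0 c.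
  split=> h x j l /= lt; apply: h => /=; first by have := mE j l; lia.
  by have := mE j l; lia.
have FN1 c : @Fil k 1 n.+1 1 (fun _ j => - m j) 1 c -> FilN s c.
  by move=> h x j l /= lt; apply: h => /=; have := mE j (l - 1); lia.
apply: (@lattice_torsion k (q ^+ s) kbar iota _ _ n (Bop r s Phi) m _ _ _
   (t ^ z *: delta_mx 0 j0)).
- by rewrite expf_neq0.
- by move=> N N0; rewrite -exprM qnr // muln_gt0 s_gt0.
- exact: (Bop_kadd q0 sl).
- move=> l c; rewrite /Bop (iter_t q0 sl) !scalerA; congr (_ *: _).
  have -> : q ^ (l * s%:Z) = (q ^+ s) ^ l by rewrite exprnP exprz_exp mulrC.
  by ring.
- move=> c /FN h; apply/FN.
  have H N : FilN (0 + N%:Z * r) (iter N Phi c).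
    elim: N => [|N IH]; first by rewrite mul0r addr0.
    have := comp_Fil IH; rewrite iterS.
    by have -> : 0 + N%:Z * r + r = 0 + N.+1%:Z * r by lia.
  move: (H s).
  by move/(Fil_t (n := - r) s_gt0); rewrite mulrN addrK.
- by apply/FN; apply: Fil_le (tx.1); lia.
- move=> N /FN1 h; have [_ [[j [l [_ e /eqP c0]]] _]] := tN N.
  by apply: c0; apply: h; lia.
Qed.

End Companion.

(** * Torsion vectors modulo a stable subspace *)

Section SlopeVector.
Variables (k : fieldType) (q : k) (kbar : closedFieldType) (iota : {rmorphism k -> kbar}).
Hypothesis q0 : q != 0.
Hypothesis qnr : forall n : nat, (0 < n)%N -> q ^+ n != 1.
Local Notation t := (tLS k).
Variables (V : vectType (LS k)) (Phi : V -> V).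
Hypotheses (sl : semilin q Phi) (bij : bijective Phi).
Implicit Types (X Y : {vspace V}) (v w : V).

(** [n] is the least exponent for which a relation exists; the dimension of [V] bounds it. In a
    dependence among lower powers, the largest index with nonzero coefficient would give a shorter
    relation. *)
Lemma cyclic_relation X v : v \notin X -> exists n (a : 'I_n -> LS k),
  iter n Phi v - \sum_(i < n) a i *: iter i Phi v \in X /\
  (forall c : 'I_n -> LS k, \sum_(i < n) c i *: iter i Phi v \in X -> forall i, c i = 0).
Proof.
move=> vX.
pose rel n := exists a : 'I_n -> LS k, iter n Phi v - \sum_(i < n) a i *: iter i Phi v \in X.
pose W n := (X + \sum_(i < n) <[iter i Phi v]>)%VS.
have Wrel n : iter n Phi v \in W n -> rel n.
  case/memv_addP => x xX [y /memv_sumP [u uP ->] e].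
  have [a aP] : exists a : 'I_n -> LS k, forall i, u i = a i *: iter i Phi v.
    have H i := constructive_indefinite_description _ (vlineP _ _ (uP i isT)).
    by exists (fun i => sval (H i)) => i; case: (H i).
  exists a; rewrite e (eq_bigr _ (fun i _ => aP i)).
  by rewrite -addrA subrr addr0.
have ex : exists n, (if pdec (rel n) then true else false).
  apply: NNPP => H; have nr n : ~ rel n.
    by move=> h; apply: H; exists n; case: pdec.
  have dW n : (n <= \dim (W n))%N.
    elim: n => // n IH; apply: leq_ltn_trans IH _.
    have sub : (W n <= W n.+1)%VS.
      by rewrite /W big_ord_recr /= addvA addvSl.
    rewrite ltn_neqAle dimvS // andbT; apply/eqP => e.
    have {}e : W n = W n.+1 by apply/eqP; rewrite eqEdim sub e leqnn.
    apply: (nr n); apply: Wrel; rewrite e /W big_ord_recr /= addvA.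
    by apply: (subvP (addvSr _ _)); exact: memv_line.
  have := leq_trans (dW (\dim {:V}).+1) (dimvS (subvf _)).
  by rewrite ltnn.
case: (ex_minnP ex) => n; case: pdec => // -[a ha] _ min; exists n, a; split=> // c hc.
have {}min N : rel N -> (n <= N)%N by move=> h; apply: min; case: pdec.
apply: NNPP => /not_all_ex_not [i0 /eqP ci0].
case: (@arg_maxnP _ i0 (fun i => c i != 0) (fun i => nat_of_ord i) ci0) => i ci maxi.
suff /min : rel i by rewrite leqNgt ltn_ord.
exists (fun j : 'I_i => - (c i)^-1 * c (widen_ord (ltnW (ltn_ord i)) j)).
have -> : iter i Phi v - \sum_(j < i) (- (c i)^-1 * c (widen_ord (ltnW (ltn_ord i)) j)) *: iter j Phi v
    = (c i)^-1 *: \sum_(j < n) c j *: iter j Phi v; last exact: rpredZ.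
rewrite -sumrN scaler_sumr [RHS](bigD1 i) //= scalerA mulVf // scale1r; congr (_ + _).
pose G (j : nat) := (c i)^-1 *: ((if insub j is Some j' then c j' else 0) *: iter j Phi v).
rewrite (eq_bigr (fun j : 'I_i => G j)); last first.
  move=> j _; rewrite /G insubT ?(ltn_trans (ltn_ord j)) // => lt.
  rewrite -scaleNr mulNr opprK -scalerA; congr (_ *: (c _ *: _)); exact: val_inj.
rewrite (big_ord_widen_cond n xpredT G (ltnW (ltn_ord i))).
rewrite [RHS](bigID (fun j : 'I_n => (j < i)%N)) /= [X in _ = _ + X]big1 ?addr0.
  apply: eq_big => [j|j _]; last by rewrite /G valK.
  by have [lt|le] := ltnP j i; rewrite ?andbF //= andbT -(inj_eq val_inj) /= ltn_eqF.
move=> j /andP[ji]; rewrite -leqNgt => le; have [->|cj] := eqVneq (c j) 0.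
  by rewrite scale0r scaler0.
have le2 := maxi j cj; case/eqP: ji; apply: val_inj => /=; apply/eqP.
by rewrite eqn_leq le; move: le2; rewrite /geq /= => ->.
Qed.

(** Sending [e_i] to [Phi^i v] maps the companion module to [Y], commutes with [Phi] modulo [X] and,
    by independence, sends no nonzero vector into [X]. So a torsion vector of the companion module
    gives one of [Y] modulo [X]. *)
Lemma slope_torsion X Y : Dq_stable Phi X -> Dq_stable Phi Y -> ~~ (Y <= X)%VS ->
  exists (r : int) (s : nat) (p : {poly k}) (w : V),
  [/\ (0 < s)%N, coprime `|r| s, p`_0 != 0, w \in Y /\ w \notin X & act (Bop r s Phi) p w \in X].
Proof.
move=> sX sY /subvPn [v vY vX].
have [[|n] [a [ha ind]]] := cyclic_relation vX.
  by move: ha; rewrite big_ord0 subr0 (negbTE vX).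
have val_ex i : exists l, a i != 0 -> (forall i', i' < l -> co (a i) i' = 0) /\ co (a i) l != 0.
  have [->|/lval_ex [l hl]] := eqVneq (a i) 0; first by exists 0.
  by exists l.
pose va i := sval (constructive_indefinite_description _ (val_ex i)).
have vaP i : a i != 0 -> (forall i', i' < va i -> co (a i) i' = 0) /\ co (a i) (va i) != 0.
  by rewrite /va; case: constructive_indefinite_description.
(* Otherwise [Phi^(n+1) v] lies in [X], and then so does [v], as [Phi] is bijective. *)
have [i1 ai1] : exists i, a i != 0.
  apply/existsP; apply: contraNT vX; rewrite negb_exists => /forallP h.
  apply: (stable_iter_inv q0 sl bij (n := n.+1)) => //; move: ha.
  by rewrite big1 ?subr0 // => i _; have := h i; rewrite negbK => /eqP ->; rewrite scale0r.
(* The slope from the point of [Phi^(n+1)] to that of [a i]. The least slope in lowest terms is r/s,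
   and [j0] is the first index attaining it. *)
pose rho (i : 'I_n.+1) : rat := (va i)%:~R / (n.+1 - i)%N%:R.
case: (@Order.TotalTheory.arg_minP _ _ _ i1 (fun i => a i != 0) rho ai1) => i2 ai2 min2.
pose T (i : 'I_n.+1) := (a i != 0) && (rho i == rho i2).
have Ti2 : T i2 by rewrite /T ai2 eqxx.
case: (@arg_minnP _ i2 T (fun i => nat_of_ord i) Ti2) => j0 /andP[aj0 /eqP ej0] min0.
pose r := numq (rho i2); pose s := `|denq (rho i2)|%N.
have sE : s%:Z = denq (rho i2) by rewrite /s absz_denq.
have s0 : (0 < s)%N by rewrite -ltz_nat sE denq_gt0.
have dpos (i : 'I_n.+1) : (0 : rat) < (n.+1 - i)%N%:R by rewrite ltr0n subn_gt0.
have rhoE : rho i2 = r%:~R / s%:Z%:~R by rewrite sE divq_num_den.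
have sp : (0 : rat) < s%:Z%:~R by rewrite ltr0z.
have cmp i : (rho i2 <= rho i) = (r * (n.+1 - i)%N%:Z <= s%:Z * va i).
  rewrite rhoE /rho ler_pdivrMr // mulrAC ler_pdivlMr // pmulrn.
  by rewrite -!rmorphM ler_int [va i * _]mulrC.
have cmpe i : (rho i == rho i2) = (r * (n.+1 - i)%N%:Z == s%:Z * va i).
  rewrite eq_sym rhoE /rho eqr_div ?lt0r_neq0 // pmulrn.
  by rewrite -!rmorphM eqr_int [va i * _]mulrC.
have subE (i : 'I_n.+1) : (n.+1 - i)%N%:Z = n.+1%:Z - i%:Z by have := ltn_ord i; lia.
have [||||c [p [c0 p0 cp]]] := @companion_torsion k q kbar iota q0 qnr n a r s s0 _ j0 (va j0).
- move=> i l lt; have [->|ai] := eqVneq (a i) 0; first exact: co0.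
  have [low _] := vaP i ai; apply: low; have := min2 i ai; rewrite cmp subE => le.
  nia.
- by have := eqxx (rho j0); rewrite {2}ej0 cmpe subE => /eqP e; lia.
- by have [] := vaP _ aj0.
- move=> i l lt e; have [->|ai] := eqVneq (a i) 0; first exact: co0.
  have [low _] := vaP i ai; apply: low; have := min2 i ai; rewrite cmp subE => le.
  have : ~~ T i by apply: contraL lt => /min0; rewrite leqNgt.
  rewrite /T ai cmpe subE /= => ne.
  have : r * (n.+1%:Z - i%:Z) = s%:Z * l by rewrite mulrBr -e; ring.
  by move=> e2; rewrite e2 in le ne; nia.
pose phi (c : 'rV[LS k]_n.+1) : V := \sum_i c 0 i *: iter i Phi v.
have philin : linear phi.
  move=> b u u'; rewrite /phi scaler_sumr -big_split; apply: eq_bigr => i _.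
  by rewrite !mxE scalerDl scalerA.
have phik := kadd_linear philin.
have comm1 u : phi (comp_mod q a u) - Phi (phi u) \in X.
  have -> : phi (comp_mod q a u) - Phi (phi u) = - (sigma_q q (u 0 ord_max) *:
     (iter n.+1 Phi v - \sum_(i < n.+1) a i *: iter i Phi v)).
    rewrite /phi (semilin_sum q0 sl).
    rewrite (eq_bigr (fun i : 'I_n.+1 => (if (0 < i)%N then sigma_q q (u 0 (inord i.-1)) else 0)
      *: iter i Phi v + sigma_q q (u 0 ord_max) *: (a i *: iter i Phi v))); last first.
      by move=> i _; rewrite mxE scalerDl scalerA.
    rewrite big_split /= -scaler_sumr.
    rewrite [X in X + _ - _]big_ord_recl /= scale0r add0r [X in _ - X]big_ord_recr /=.
    set S1 := \sum_(i < n) _; set S2 := \sum_(i < n) _.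
    have -> : S2 = S1.
      apply: eq_bigr => i _; congr (sigma_q q (u 0 _) *: _).
      by apply: val_inj; rewrite /= /bump /= add0n inordK // ltnS ltnW.
    by rewrite scalerBr opprB opprD addrACA subrr add0r.
  by rewrite rpredN rpredZ.
have commn N u : phi (iter N (comp_mod q a) u) - iter N Phi (phi u) \in X.
  elim: N => [|N IH]; first by rewrite subrr mem0v.
  have := memvD (comm1 (iter N (comp_mod q a) u)) (sX _ IH).
  by rewrite (kaddB (semilin_kadd q0 sl)) addrA subrK.
have commB u : phi (Bop r s (comp_mod q a) u) - Bop r s Phi (phi u) \in X.
  have phiZ b x : phi (b *: x) = b *: phi x.
    by have := philin b x 0; rewrite !addr0 (kadd0 phik) addr0.
  by rewrite /Bop phiZ -scalerBr rpredZ.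
exists r, s, p, (phi c); split=> //.
- by rewrite /r /s coprime_num_den.
- split; last first.
    apply: contra c0 => /(ind (fun i => c 0 i)) h.
    by apply/eqP/rowP => i; rewrite h mxE.
  by apply: rpred_sum => i _; apply: rpredZ; exact: stable_iter.
have := act_morph p c phik (Bop_kadd q0 sl r s) (fun w => @stable_Bop k V Phi X r s w sX) commB.
by rewrite cp (kadd0 phik) sub0r rpredN.
Qed.

(** Irreducible factors are removed from [p] as long as the cofactor still sends [w] into [X]; the
    degree decreases, and a constant cofactor cannot do so. *)
Lemma irred_refine X r s (p : {poly k}) w : Dq_stable Phi X -> w \notin X -> p`_0 != 0 ->
  act (Bop r s Phi) p w \in X -> exists g h : {poly k}, [/\ inS g, h`_0 != 0,
    act (Bop r s Phi) h w \notin X & act (Bop r s Phi) g (act (Bop r s Phi) h w) \in X].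
Proof.
move=> sX wX; have kB := Bop_kadd q0 sl r s.
have [N] := ubnP (size p); elim: N p => // N IH p lt p0 pX.
have pn0 : p != 0 by apply: contraNneq p0 => ->; rewrite coef0.
have [sp|sp] := ltnP 1 (size p); last first.
  have [a pa] : exists a, p = a%:P by exists p`_0; exact: size1_polyC.
  case/negP: wX; move: pX; rewrite pa actC rpredZeq fmorph_eq0 => /orP[/eqP a0|//].
  by move: pn0; rewrite pa a0 eqxx.
have [g [mg ig /dvdpP [h e]]] := irred_factor sp.
have := p0; rewrite e coef0M mulf_eq0 negb_or => /andP[h0 g0].
have [hX|hX] := boolP (act (Bop r s Phi) h w \in X).
  have hn0 : h != 0 by apply: contraNneq h0 => ->; rewrite coef0.
  by apply: IH hX => //; apply: leq_trans (size_mulr_lt hn0 ig.1) _; rewrite -e -ltnS.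
by exists g, h; split=> //; rewrite -actM // mulrC -e.
Qed.

End SlopeVector.

(** * Maps out of V_{r,s}(P) *)

Section UniversalMap.
Variables (k : fieldType) (q : k).
Hypothesis q0 : q != 0.
Local Notation t := (tLS k).
Local Notation cst := (@cstLS k).
Variables (r : int) (s : nat) (P : {poly k}).
Hypotheses (s_gt0 : (0 < s)%N) (monP : P \is monic) (P0 : P`_0 != 0) (szP : (1 < size P)%N).
Local Notation m := (degS P).
Local Notation VP := (@VM k q r s P).

Lemma VM_delta_lt (j : 'I_m) (i : 'I_s) (lt : (i.+1 < s)%N) :
  VP (delta_mx j i) = delta_mx j (Ordinal lt).
Proof.
apply/matrixP => j' i'; rewrite !mxE -[i' == _](inj_eq val_inj) /=.
have lei : (i'.-1 < s)%N := leq_ltn_trans (leq_pred _) (ltn_ord i').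
case: (posnP i') => [->|i1].
  have -> : (insubd i' s.-1 == i) = false.
    by rewrite -(inj_eq val_inj) val_insubd /= ltn_predL s_gt0 gtn_eqF // -ltnS prednK.
  by rewrite !andbF (sigma0 q0) if_same mulr0 addr0 mulr0.
rewrite -[insubd _ _ == _](inj_eq val_inj) val_insubd lei -[in RHS](prednK i1) eqSS.
by case: andP => _; rewrite ?(sigma1 q0) ?(sigma0 q0).
Qed.

Lemma VM_delta_last (j : 'I_m) (i : 'I_s) : i.+1 = s ->
  VP (delta_mx j i) = t ^ r *: \sum_(j' < m)
    ((j' == j.+1 :> nat)%:R + cst (- P`_j') * (j.+1 == m)%:R) *: delta_mx j' (Ordinal s_gt0).
Proof.
move=> iE; apply/matrixP => j' i'.
rewrite mxE [RHS]mxE summxE (bigD1 j') //= big1 ?addr0 => [|j2 ne]; last first.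
  by rewrite !mxE [j' == _]eq_sym (negbTE ne) mulr0.
rewrite !mxE eqxx /= -[i' == _](inj_eq val_inj) /=.
have lei : (i'.-1 < s)%N := leq_ltn_trans (leq_pred _) (ltn_ord i').
case: (posnP i') => [i0|i1]; last first.
  rewrite !mulr0.
  have -> : (insubd i' i'.-1 == i) = false.
    rewrite -(inj_eq val_inj) val_insubd lei ltn_eqF //=.
    by rewrite -ltnS iE prednK // ltn_ord.
  by rewrite andbF (sigma0 q0).
have -> : insubd i' s.-1 = i.
  by apply: val_inj; rewrite val_insubd ltn_predL s_gt0 /=; lia.
rewrite ?i0 ?eqxx ?andbT mulr1 ?mulr1; congr (_ * (_ + _ * _)).
  case: (posnP j') => [->|j1] //.
  rewrite -(inj_eq val_inj) val_insubd (leq_ltn_trans (leq_pred _) (ltn_ord j')).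
  rewrite -[in RHS](prednK j1) eqSS.
  by case: eqP => _; rewrite ?(sigma1 q0) ?(sigma0 q0).
rewrite -(inj_eq val_inj) val_insubd ltn_predL (leq_ltn_trans _ (ltn_ord j')) //.
have -> : (m.-1 == j) = (j.+1 == m).
  by rewrite eq_sym -eqSS prednK // (leq_ltn_trans _ (ltn_ord j')).
by case: eqP => _; rewrite ?(sigma1 q0) ?(sigma0 q0).
Qed.

Section Map.
Variables (V : vectType (LS k)) (Phi : V -> V).
Hypothesis sl : semilin q Phi.
Variables (X : {vspace V}) (w : V).
Hypothesis sX : Dq_stable Phi X.
Local Notation B := (Bop r s Phi).
Hypothesis wX : act B P w \in X.

(* The map from [V_{r,s}(P)] modulo [X] sending the generator [v_0] to [w]. *)
Definition um (M : 'M[LS k]_(m, s)) : V :=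
  \sum_(j < m) \sum_(i < s) M j i *: iter i Phi (iter j B w).

Lemma um_linear : linear um.
Proof.
move=> a M N; rewrite /um scaler_sumr -big_split; apply: eq_bigr => j _ /=.
rewrite scaler_sumr -big_split; apply: eq_bigr => i _ /=.
by rewrite !mxE scalerDl scalerA.
Qed.
HB.instance Definition _ := GRing.isLinear.Build (LS k) 'M[LS k]_(m, s) V _ um um_linear.

Lemma umZ a M : um (a *: M) = a *: um M.
Proof. exact: linearZ. Qed.

Lemma um_sum I (rr : seq I) (G : I -> 'M[LS k]_(m, s)) :
  um (\sum_(x <- rr) G x) = \sum_(x <- rr) um (G x).
Proof. exact: linear_sum. Qed.

Lemma um_delta j i : um (delta_mx j i) = iter i Phi (iter j B w).
Proof.
rewrite /um (bigD1 j) //= [X in _ + X]big1 => [|j' ne]; last first.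
  by rewrite big1 // => i' _; rewrite mxE (negbTE ne) scale0r.
rewrite addr0 (bigD1 i) //= [X in _ + X]big1 => [|i' ne]; last first.
  by rewrite mxE (negbTE ne) andbF scale0r.
by rewrite addr0 mxE !eqxx scale1r.
Qed.

(** Both composites are semilinear, so basis vectors suffice. They differ only at
    [Phi^(s-1) v_(m-1)], where the difference is [- t^r P(B) w]. *)
Lemma um_comm M : um (VP M) - Phi (um M) \in X.
Proof.
have slV := VM_semilin q0 r s P; have kP := semilin_kadd q0 sl.
pose D M := um (VP M) - Phi (um M).
rewrite -/(D M).
have Dsum I (rr : seq I) (G : I -> 'M[LS k]_(m, s)) :
    D (\sum_(x <- rr) G x) = \sum_(x <- rr) D (G x).
  rewrite /D (kadd_sum (semilin_kadd q0 slV)) !um_sum (kadd_sum kP).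
  by rewrite -sumrB.
rewrite (matrix_sum_delta M) Dsum; apply: rpred_sum => j _.
rewrite Dsum; apply: rpred_sum => i _.
rewrite /D slV.2 !umZ sl.2 -scalerBr; apply: rpredZ.
have [lt|ge] := ltnP i.+1 s; first by rewrite VM_delta_lt !um_delta subrr mem0v.
have iE : i.+1 = s by apply/eqP; rewrite eqn_leq ltn_ord ge.
rewrite VM_delta_last // umZ um_sum.
rewrite (eq_bigr (fun j' : 'I_m => ((j' == j.+1 :> nat)%:R + cst (- P`_j') * (j.+1 == m)%:R)
    *: iter j' B w)); last by move=> j' _; rewrite umZ um_delta.
have -> : Phi (um (delta_mx j i)) = t ^ r *: iter j.+1 B w.
  rewrite um_delta -iterS iE iterS {2}/Bop scalerA -tLSD subrr expr0z scale1r //.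
rewrite -scalerBr; apply: rpredZ.
have [jm|jm] := eqVneq j.+1 m; last first.
  have lt : (j.+1 < m)%N by rewrite ltn_neqAle jm ltn_ord.
  rewrite (bigD1 (Ordinal lt)) //= [X in _ + X - _]big1 => [|j' ne].
    by rewrite eqxx mulr0 !addr0 scale1r subrr mem0v.
  have -> : (j' == j.+1 :> nat) = false by apply/negbTE; rewrite -(inj_eq val_inj) in ne.
  by rewrite mulr0 addr0 scale0r.
have mE : size P = m.+1 by rewrite /degS prednK // ltnW.
have -> : \sum_(j' < m) ((j' == j.+1 :> nat)%:R + cst (- P`_j') * true%:R) *: iter j' B w
    - iter j.+1 B w = - act B P w; last by rewrite rpredN.
rewrite (@act_widen _ _ _ m.+1) ?mE // big_ord_recr /= opprD.
congr (_ - _).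
  rewrite -sumrN; apply: eq_bigr => j' _.
  by rewrite jm ltn_eqF ?ltn_ord // add0r mulr1 rmorphN scaleNr.
have lc : P`_m = 1 by have := eqP monP; rewrite lead_coefE.
by rewrite lc rmorph1 scale1r -iterS jm.
Qed.

End Map.
End UniversalMap.

Section UniversalMapProps.
Variables (k : fieldType) (q : k).
Hypothesis q0 : q != 0.
Local Notation t := (tLS k).
Variables (r : int) (s : nat) (P : {poly k}).
Hypotheses (s_gt0 : (0 < s)%N) (co_rs : coprime `|r| s).
Hypotheses (monP : P \is monic) (P0 : P`_0 != 0) (szP : (1 < size P)%N).
Local Notation m := (degS P).
Local Notation VP := (@VM k q r s P).
Let slV : semilin q VP := VM_semilin q0 r s P.

Lemma Vrs_gen (K : {vspace 'M[LS k]_(m, s)}) : Dq_stable VP K -> vec0 s P \in K -> K = fullv.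
Proof.
move=> sK vK; apply/eqP; rewrite eqEsubv subvf /=; apply/subvP => M _.
rewrite (matrix_sum_delta M); apply: rpred_sum => j _; apply: rpred_sum => i _.
apply: rpredZ => {M}; set M := delta_mx _ _.
have -> : M = Eop VP 0 i (act (Bop r s VP) (Col M i 0) (vec0 s P)).
  apply: Col_single => // c l lt ne; apply: (Col_eqP (lt := lt)) => [|j'].
    by rewrite size_poly0.
  rewrite coef0 mxE -[Ordinal lt == i](inj_eq val_inj) /= -(rmorph_nat (@cstLS k)) co_cst1.
  by move: ne; rewrite xpair_eqE; case: (c == i); case: (l == 0) => //= _; rewrite ?andbF ?mul0rn.
by apply: stable_Eop => //; exact: stable_act.
Qed.

Variables (V : vectType (LS k)) (Phi : V -> V).
Hypothesis sl : semilin q Phi.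
Local Notation B := (Bop r s Phi).
Local Notation um := (@um k r s P V Phi).

Lemma um_vec0 w : um w (vec0 s P) = w.
Proof.
have m0 := m_gt0 szP.
have -> : vec0 s P = delta_mx (Ordinal m0) (Ordinal s_gt0).
  by apply/matrixP => i j; rewrite !mxE.
by rewrite um_delta.
Qed.

Lemma um_mem (Y : {vspace V}) w M : Dq_stable Phi Y -> w \in Y -> um w M \in Y.
Proof.
move=> sY wY; do 2!(apply: rpred_sum => ? _); apply: rpredZ; apply: stable_iter => //.
by elim: (nat_of_ord _) => //= n; exact: stable_Bop.
Qed.

Section Relative.
Variables (X : {vspace V}) (w : V).
Hypotheses (sX : Dq_stable Phi X) (wX : act B P w \in X).

Lemma um_commB r' s' M : um w (Bop r' s' VP M) - Bop r' s' Phi (um w M) \in X.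
Proof.
rewrite /Bop umZ -scalerBr; apply: rpredZ.
elim: s' => [|n IH]; first by rewrite subrr mem0v.
have h1 := um_comm q0 s_gt0 monP P0 szP sl wX (iter n VP M); have := memvD h1 (sX IH).
by rewrite (kaddB (semilin_kadd q0 sl)) addrA subrK.
Qed.

Lemma um_act r' s' p M : um w (act (Bop r' s' VP) p M) - act (Bop r' s' Phi) p (um w M) \in X.
Proof.
apply: act_morph; [|exact: (Bop_kadd q0 sl)| |exact: um_commB].
  apply: kadd_linear; exact: um_linear.
by move=> u; exact: stable_Bop.
Qed.

Definition umL : 'Hom('M[LS k]_(m, s), V) := linfun (um w).
Lemma umLE M : umL M = um w M. Proof. by rewrite lfunE. Qed.

Lemma um_preim_stable (K : {vspace V}) : Dq_stable Phi K -> (X <= K)%VS ->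
  Dq_stable VP (umL @^-1: K)%VS.
Proof.
move=> sK /subvP sub M; rewrite -!memv_preim !umLE => MK.
rewrite -(subrK (Phi (um w M)) (um w (VP M))); apply: memvD; last exact: sK.
by apply: sub; exact: (um_comm q0 s_gt0 monP P0 szP sl wX).
Qed.

Lemma um_addimg_stable : Dq_stable Phi (X + limg umL).
Proof.
move=> v /memv_addP [x xX [y /memv_imgP [M _ ->] ->]].
rewrite umLE sl.1; have hd := um_comm q0 s_gt0 monP P0 szP sl wX M.
have -> : Phi x + Phi (um w M) = (Phi x - (um w (VP M) - Phi (um w M))) + umL (VP M).
  by rewrite umLE opprB -addrA subrK.
apply: memv_add; last by rewrite memv_img // memvf.
by rewrite memvB // sX.
Qed.
End Relative.

Section Absolute.
Variable w : V.
Hypothesis w0 : act B P w = 0.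

Lemma um_comm0 M : um w (VP M) = Phi (um w M).
Proof.
apply/eqP; rewrite -subr_eq0 -memv0.
apply: (um_comm q0 s_gt0 monP P0 szP sl); rewrite w0; exact: mem0v.
Qed.

Lemma um_act0 r' s' p M : um w (act (Bop r' s' VP) p M) = act (Bop r' s' Phi) p (um w M).
Proof.
apply/eqP; rewrite -subr_eq0 -memv0; apply: um_act => //; last by rewrite w0 mem0v.
exact: (stable0 q0 sl).
Qed.

Lemma um_img_stable : Dq_stable Phi (limg (umL w)).
Proof.
move=> v /memv_imgP [M _ ->]; rewrite umLE -um_comm0 -umLE.
by rewrite memv_img // memvf.
Qed.

Lemma um_img_good : good VP fullv -> good Phi (limg (umL w)).
Proof.
move=> [_ gV]; split=> [|r' s' p s0 co p0 y /memv_imgP [N _ ->]]; first exact: um_img_stable.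
have [M [_ [p' [p0' e]]]] := gV r' s' p s0 co p0 N (memvf N).
exists (umL w M); split; first by rewrite memv_img // memvf.
have hk := kadd_linear (@um_linear k r s P V Phi w).
by exists p'; split=> //; rewrite !umLE -um_act0 -(kaddB hk) -um_act0 e (kadd0 hk).
Qed.

Lemma um_iso : injective (um w) -> limg (umL w) = fullv -> Dq_iso VP Phi.
Proof.
move=> inj img; exists (um w); split; [exact: um_linear | | exact: um_comm0].
have H v : exists M, um w M = v.
  have : v \in limg (umL w) by rewrite img memvf.
  by case/memv_imgP => M _ ->; exists M; rewrite umLE.
exists (fun v => sval (constructive_indefinite_description _ (H v))) => [M|v].
  by apply: inj; case: constructive_indefinite_description.
by case: constructive_indefinite_description.
Qed.

Lemma um_dim : injective (um w) -> \dim (limg (umL w)) = (m * s)%N.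
Proof.
move=> inj; have ker0 : lker (umL w) == 0%VS.
  by apply/lker0P => M N; rewrite !umLE; exact: inj.
rewrite limg_dim_eq; first by rewrite dimvf /dim /= .
by move/eqP: ker0 => ->; rewrite capv0.
Qed.

End Absolute.
End UniversalMapProps.

(** * Submodules of V_{r,s}(f^e) *)

Section PrimaryModule.
Variables (k : fieldType) (q : k) (kbar : closedFieldType) (iota : {rmorphism k -> kbar}).
Hypothesis q0 : q != 0.
Hypothesis qnr : forall n : nat, (0 < n)%N -> q ^+ n != 1.

Lemma inS_exp (f : {poly k}) e : inS f -> (0 < e)%N ->
  [/\ f ^+ e \is monic, (f ^+ e)`_0 != 0, (1 < size (f ^+ e))%N & degS (f ^+ e) = (degS f * e)%N].
Proof.
move=> [mf irf f0] e0; split.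
- exact: rpredX.
- by rewrite -horner_coef0 horner_exp horner_coef0 expf_neq0.
- rewrite -[size _]prednK ?size_exp ?ltnS ?muln_gt0 ?e0 ?andbT.
    by have := irf.1; case: (size f) => [|[]].
  by rewrite size_poly_gt0 expf_neq0 // irredp_neq0.
- by rewrite /degS size_exp.
Qed.

Variables (r : int) (s : nat) (f : {poly k}) (e : nat).
Hypotheses (s_gt0 : (0 < s)%N) (co_rs : coprime `|r| s) (fS : inS f) (e0 : (0 < e)%N).
Local Notation P := (f ^+ e).
Local Notation VP := (@VM k q r s P).

(** Every nonzero submodule contains the same vector. A torsion vector of [K] has the form
    [t^l Phi^c u(B) v_0], so u(B) v_0 is in [K]; [f u] is divisible by [f^e] while [u] is not, so
    [u] is [f^(e-1)] times a factor prime to [f], which a Bezout relation removes. *)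
Lemma Vrs_socle (K : {vspace 'M[LS k]_(degS P, s)}) : Dq_stable VP K -> K != 0%VS ->
  act (Bop r s VP) (f ^+ e.-1) (vec0 s P) \in K.
Proof.
move=> sK K0; have [monP P0 szP _] := inS_exp fS e0; have [mf irf f0] := fS.
have slV := VM_semilin q0 r s P; have bV := VM_bij q0 (r := r) s_gt0 co_rs monP P0 szP.
have kB := Bop_kadd q0 slV r s.
have [||r' [s' [p [w1 [s'0 co' p0 [w1K w1X] pw]]]]] :=
  slope_torsion iota q0 qnr slV bV (X := 0%VS) _ sK.
- exact: (stable0 q0 slV).
- by rewrite subv0.
have [g [h [gS h0]]] := irred_refine q0 slV (stable0 q0 slV) w1X p0 pw.
set w := act _ h w1; rewrite !memv0 => w0 /eqP gw.
have wK : w \in K by exact: stable_act.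
have g0 : g`_0 != 0 by case: gS.
have [er es] := torsion_slope q0 s_gt0 co_rs monP P0 szP s'0 co' g0 w0 gw.
rewrite er es in gw.
have [c [l [lt dv C0 we]]] := torsion_primary (e := e) (j := 1%N) q0 qnr s_gt0 co_rs monP P0 szP fS (erefl _) gS w0 gw.
set u := Col w c l in C0 we.
have xK : act (Bop r s VP) u (vec0 s P) \in K.
  by apply: (stable_Eop_inv q0 slV bV (l := l) (c := c)) => //; rewrite -we.
have eqg : f %= tw q (wt r s c l) g.
  apply: (tw_irred q0 _ _).2 => //; [by case: gS | by rewrite gtn_eqF // irf.1].
have Pu : P %| f * u.
  have := act_Col_dvd q0 s_gt0 monP P0 szP gw l lt.
  by rewrite (eqp_dvdr _ (eqp_mulr u eqg)).
have f0' : f != 0 by exact: irredp_neq0.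
have eE : e = e.-1.+1 by rewrite prednK.
have [h1 uE] : exists h1, u = h1 * f ^+ e.-1.
  by apply/dvdpP; move: Pu; rewrite {1}eE exprS dvdp_mul2l.
have cop : coprimep h1 f.
  rewrite coprimep_sym irreducible_poly_coprime //; apply: contraL (Col_ltP szP w c l) => /dvdpP [h2 h1E].
  rewrite -leqNgt; apply: dvdp_leq => //; rewrite -/u uE h1E -mulrA -exprS -eE.
  exact: dvdp_mulIr.
have [[a b] /= ab] := Bezout_eq1_coprimepP _ _ cop.
have -> : f ^+ e.-1 = a * u + b * P.
  by rewrite uE [X in _ + b * f ^+ X]eE exprS !mulrA -mulrDl ab mul1r.
rewrite actD (actM kB) (actM kB b) (act_vec0 q0 r s_gt0 monP P0 szP) (act02 kB) addr0.
exact: stable_act.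
Qed.

Variables (V : vectType (LS k)) (Phi : V -> V) (w : V).
Hypothesis sl : semilin q Phi.
Hypotheses (w0 : act (Bop r s Phi) P w = 0) (w1 : act (Bop r s Phi) (f ^+ e.-1) w != 0).

(** A nonzero kernel would contain the vector of [Vrs_socle], whose image is [f^(e-1)(B) w]. *)
Lemma um_primary_inj : injective (@um k r s P V Phi w).
Proof.
have [monP P0 szP _] := inS_exp fS e0; have st0 := stable0 q0 sl.
have w0' : act (Bop r s Phi) P w \in (0 : {vspace V})%VS by rewrite w0 mem0v.
have sK := um_preim_stable q0 s_gt0 monP P0 szP sl w0' st0 (subvv _).
suff K0 : lker (umL r s P Phi w) == 0%VS.
  by move/lker0P: K0 => inj M N e1; apply: inj; rewrite !umLE.
rewrite -[_ == _]negbK; apply/negP; rewrite -lpreim0 => K0; have := Vrs_socle sK K0; rewrite lpreim0.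
rewrite memv_ker umLE (um_act0 q0 s_gt0 monP P0 szP sl w0) um_vec0 //.
by rewrite (negbTE w1).
Qed.

End PrimaryModule.

(** * Decomposition *)

Section Decomposition.
Variables (k : fieldType) (q : k) (kbar : closedFieldType) (iota : {rmorphism k -> kbar}).
Hypothesis q0 : q != 0.
Hypothesis qnr : forall n : nat, (0 < n)%N -> q ^+ n != 1.
Variables (V : vectType (LS k)) (Phi : V -> V).
Hypotheses (sl : semilin q Phi) (bij : bijective Phi).
Implicit Types (X Y U K : {vspace V}) (v w : V).

Lemma max_vspace (Q : {vspace V} -> Prop) X0 : Q X0 ->
  exists X, Q X /\ forall Y, Q Y -> (\dim Y <= \dim X)%N.
Proof.
move=> Q0; pose T n := if pdec (exists X, Q X /\ \dim X = n) then true else false.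
have ex : exists n, T n.
  by exists (\dim X0); rewrite /T; case: pdec => // -[]; exists X0.
have bd n : T n -> (n <= \dim {:V})%N.
  by rewrite /T; case: pdec => // h _; case: h => X [_ <-]; apply: dimvS; exact: subvf.
case: (ex_maxnP ex bd) => n; rewrite {1}/T; case: pdec => // h _; case: h => X [QX <-] max.
exists X; split=> // Y QY; apply: max; rewrite /T; case: pdec => // -[]; by exists Y.
Qed.

Lemma act_coprime X r s (g h : {poly k}) v : Dq_stable Phi X -> coprimep g h ->
  act (Bop r s Phi) g v \in X -> act (Bop r s Phi) h v \in X -> v \in X.
Proof.
move=> sX /Bezout_eq1_coprimepP [[a b] /= e] h1 h2; have kB := Bop_kadd q0 sl r s.
rewrite -(act1 (Bop r s Phi) v) -e actD !(actM kB).
by apply: memvD; exact: stable_act.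
Qed.

Lemma torsion_monic r s w : w != 0 -> tors Phi r s w -> exists P : {poly k},
  [/\ P \is monic, P`_0 != 0, (1 < size P)%N & act (Bop r s Phi) P w = 0].
Proof.
move=> w0 [p [p0 pw]]; have pn0 : p != 0 by apply: contraNneq p0 => ->; rewrite coef0.
have l0 : (lead_coef p)^-1 != 0 by rewrite invr_eq0 lead_coef_eq0.
exists ((lead_coef p)^-1 *: p); split.
- by rewrite monicE lead_coefZ mulVf ?lead_coef_eq0.
- by rewrite coefZ mulf_neq0.
- rewrite size_scale // ltnNge; apply: contra w0 => /size1_polyC e.
  by move: pw; rewrite e actC => /eqP; rewrite scaler_eq0 fmorph_eq0 (negbTE p0).
- by rewrite actZ pw scaler0.
Qed.

(** [X] is a good subspace of [Y] of maximal dimension. Were it proper, a torsion class modulo [X]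
    would lift to a torsion vector, and the submodule generated by the latter is good and lies in
    [Y]. *)
Lemma torsion_span Y : Dq_stable Phi Y ->
  (forall r s w, (0 < s)%N -> coprime `|r| s -> tors Phi r s w -> w \in Y) -> Y = fullv.
Proof.
move=> sY tY; have [|X [[gX XY] max]] := @max_vspace (fun X => good Phi X /\ (X <= Y)%VS) 0%VS.
  by split; [exact: (good0 q0 sl) | exact: sub0v].
suff XT : X = fullv by apply/eqP; rewrite eqEsubv subvf -XT.
apply/eqP; rewrite eqEsubv subvf /=; apply: contraT => nX.
have [sX gX'] := gX.
have [r [s [p [w [s0 co p0 [_ wX] pw]]]]] := slope_torsion iota q0 qnr sl bij sX (@stableT k V Phi) nX.
have kB := Bop_kadd q0 sl r s.
have [x [xX [p' [p0' pe]]]] := gX' r s p s0 co p0 _ pw.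
have tw' : tors Phi r s (w - x).
  exists (p' * p); split; first by rewrite coef0M mulf_neq0.
  by rewrite (actM kB) (actB2 kB).
have wx0 : w - x != 0 by rewrite subr_eq0; apply: contraNneq wX => ->.
have [P [mP P0 sP Pw]] := torsion_monic wx0 tw'.
pose C := limg (umL r s P Phi (w - x)).
have gC : good Phi C.
  exact: (um_img_good q0 s0 mP P0 sP sl Pw (Vrs_good q0 qnr s0 co mP P0 sP iota)).
have CY : (C <= Y)%VS.
  apply/subvP => y /memv_imgP [M _ ->]; rewrite umLE; apply: um_mem => //.
  exact: tY tw'.
have := max (X + C)%VS (conj (goodD q0 sl gX gC) _).
rewrite subv_add XY CY => /(_ isT).
rewrite leqNgt => /negP; case; rewrite ltnNge; apply/negP => le.
have eX : X = (X + C)%VS by apply/eqP; rewrite eqEdim addvSl le.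
case/negP: wX; rewrite -(subrK x w); apply: memvD => //.
rewrite eX; apply: (subvP (addvSr _ _)).
by rewrite -(um_vec0 r s0 sP Phi (w - x)) -umLE memv_img // memvf.
Qed.

(* [C] is the image of [V_{r,s}(f ^ e)] with [e] maximal and [U] is a stable subspace
   maximal for [U :&: C = 0]; a torsion vector outside [U + C] would enlarge [U]. *)
Lemma indecomposable_primary : Dq_indecomposable Phi -> exists r s (f : {poly k}) e,
  [/\ (0 < s)%N, coprime `|r| s, inS f, (0 < e)%N & Dq_iso (@VM k q r s (f ^+ e)) Phi].
Proof.
move=> [V0 indec].
have st0 := stable0 q0 sl.
have nV : ~~ (fullv <= (0 : {vspace V}))%VS by rewrite subv0.
have [r [s [p [w1 [s0 co p0 [_ w1X] pw]]]]] := slope_torsion iota q0 qnr sl bij st0 (@stableT k V Phi) nV.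
have [f [h [fS _]]] := irred_refine q0 sl st0 w1X p0 pw.
set w2 := act _ h w1; rewrite !memv0 => w20 /eqP fw2.
have kB r' s' := Bop_kadd q0 sl r' s'.
set B := Bop r s Phi in fw2.
pose Q e := exists w, [/\ (0 < e)%N, act B (f ^+ e) w = 0 & act B (f ^+ e.-1) w != 0].
pose T n := if pdec (Q n) then true else false.
have TP n : Q n -> T n by move=> h'; rewrite /T; case: pdec.
have TP' n : T n -> Q n by rewrite /T; case: pdec.
have ex : exists n, T n by exists 1%N; apply: TP; exists w2; rewrite expr0 act1.
(* V_{r,s}(f^n), of dimension [n s deg f], embeds into [V]. *)
have bd n : T n -> (n <= \dim {:V})%N.
  move/TP' => [w [n0 h1 h2]]; have [mP P0 sP dP] := inS_exp fS n0.
  have inj := um_primary_inj iota q0 qnr s0 co fS n0 sl h1 h2.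
  have dE := um_dim inj.
  have : (degS (f ^+ n) * s <= \dim {:V})%N by rewrite -dE; apply: dimvS; exact: subvf.
  rewrite dP; apply: leq_trans; have : (0 < degS f)%N by apply: m_gt0; case: fS => _ [].
  by move=> d0; rewrite mulnAC leq_pmull // muln_gt0 d0.
case: (ex_maxnP ex bd) => e /TP' [w [e0 we we1]] maxe.
have {}maxe j v : act B (f ^+ j) v = 0 -> act B (f ^+ e) v = 0.
  elim: j => [|j IH] fj.
    by apply: (act_dvd (kB r s) _ fj); rewrite expr0 dvd1p.
  have [z|nz] := eqVneq (act B (f ^+ j) v) 0; first exact: IH.
  have le : (j.+1 <= e)%N by apply: maxe; apply: TP; exists v.
  by apply: (act_dvd (kB r s) _ fj); apply: dvdp_exp2l.
have [mP P0 sP dP] := inS_exp fS e0.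
have inj := um_primary_inj iota q0 qnr s0 co fS e0 sl we we1.
have umact r' s' := um_act0 q0 s0 mP P0 sP sl we r' s'.
have hk := kadd_linear (@um_linear k r s (f ^+ e) V Phi w).
pose C := limg (umL r s (f ^+ e) Phi w).
have sC : Dq_stable Phi C by exact: (um_img_stable q0 s0 mP P0 sP sl we).
have wC : w \in C by rewrite -(um_vec0 r s0 sP Phi w) -umLE memv_img // memvf.
have [|U [[sU UC] maxU]] := @max_vspace (fun U => Dq_stable Phi U /\ (U :&: C = 0)%VS) 0%VS.
  by split=> //; rewrite cap0v.
have sX : Dq_stable Phi (U + C) := stableD sl sU sC.
have XT : (U + C)%VS = fullv.
  apply: torsion_span => // r' s' v s'0 co' [p' [p'0 pv]].
  apply: contraT => vX; set B' := Bop r' s' Phi in pv.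
  have pvX : act B' p' v \in (U + C)%VS by rewrite pv mem0v.
  have [g [h' [gS _]]] := irred_refine q0 sl sX vX p'0 pvX.
  set v1 := act _ h' v => v1X gv1; have [mg ig g0] := gS.
  have pv1 : act B' p' v1 = 0 by rewrite /v1 (actMC (kB r' s')) pv (act02 (kB r' s')).
  have pn0 : p' != 0 by apply: contraNneq p'0 => ->; rewrite coef0.
  (* Applying the part of [p'] prime to [g] leaves a vector [v2] that is killed by a power of g(B)
     but is still outside [U + C]. *)
  have [j [h2 [pE cop]]] := irred_multiplicity pn0 ig.
  pose v2 := act B' h2 v1.
  have v2X : v2 \notin (U + C)%VS by apply: contra v1X => h3; exact: (act_coprime sX cop gv1 h3).
  have gv2 : act B' g v2 \in (U + C)%VS.
    by rewrite /v2 (actMC (kB r' s')); exact: stable_act.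
  have gjv2 : act B' (g ^+ j) v2 = 0 by rewrite /v2 -(actM (kB r' s')) -pE.
  have [u uU [c cC gv2E]] := memv_addP gv2.
  (* If [g^n(B)] kills [v2], the images of [u] and [c] under [g^(n-1)(B)] are opposite, hence lie in
     the intersection of [U] and [C], which is 0. *)
  have key n : act B' (g ^+ n) v2 = 0 -> act B' (g ^+ n.-1) c = 0.
    case: n => [|n] gn.
      by case/negP: v2X; move: gn; rewrite act1 => ->; exact: mem0v.
    have : act B' (g ^+ n) (u + c) = 0 by rewrite -gv2E -(actM (kB r' s')) -exprSr.
    rewrite (actD2 (kB r' s')) => /eqP; rewrite addrC addr_eq0 => /eqP ce.
    apply/eqP; rewrite -memv0 -UC memv_cap [X in _ && X]stable_act // andbT ce.
    by rewrite rpredN; exact: stable_act.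
  (* The component of g(B) v2 in [C] is divisible by g(B) inside [C], so [v2] can be corrected by an
     element of [C]. The maximality of [e] is used here. *)
  have [c' [c'C c'E]] : exists c', c' \in C /\ act B' g c' = c.
    have [M _ cM] := memv_imgP cC; rewrite umLE in cM.
    have [M0|M0] := eqVneq M 0.
      by exists 0; rewrite mem0v (act02 (kB r' s')) cM M0 (kadd0 hk).
    have keyM n : act B' (g ^+ n) v2 = 0 -> act (Bop r' s' (@VM k q r s (f ^+ e))) (g ^+ n.-1) M = 0.
      by move/key; rewrite cM -umact => e1; apply: inj; rewrite e1 (kadd0 hk).
    have gn0 n : (g ^+ n)`_0 != 0 by rewrite -horner_coef0 horner_exp horner_coef0 expf_neq0.
    have gM := keyM _ gjv2.
    have [er es] := torsion_slope q0 s0 co mP P0 sP s'0 co' (gn0 _) M0 gM.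
    subst r' s'.
    have [c0 [l [lt dv C0 ME]]] := torsion_primary q0 qnr s0 co mP P0 sP fS (erefl _) gS M0 gM.
    set i := wt r s c0 l in dv.
    have eqg : f %= tw q i g.
      apply: (tw_irred q0 _ ig).2 => //; rewrite gtn_eqF //.
      by case: fS => _ [].
    have eqgn n : f ^+ n %= tw q i (g ^+ n) by rewrite twXn // eqp_exp.
    (* The bijection [t^l Phi^c0] turns g(B) into an associate of f(B), so the maximal exponent [e]
       bounds the powers of [g] as well: [g^e(B) v2 = 0]. *)
    have [v3 v3E] := Eop_surj bij l c0 v2.
    have actE n : act B (g ^+ n) v2 = Eop Phi l c0 (act B (tw q i (g ^+ n)) v3).
      by rewrite v3E (act_Eop q0 sl).
    have Einj x : Eop Phi l c0 x = 0 -> x = 0.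
      move=> ex0; apply/eqP; rewrite -memv0.
      by apply: (stable_Eop_inv q0 sl bij st0 (l := l) (c := c0)); rewrite ex0 mem0v.
    have gev2 : act B (g ^+ e) v2 = 0.
      rewrite actE (_ : act _ _ v3 = 0) ?(kadd0 (Eop_kadd q0 sl l c0)) //.
      have : act B (f ^+ j) v3 = 0.
        apply: (act_dvd (kB r s) (p1 := tw q i (g ^+ j))); last by apply: Einj; rewrite -actE.
        by have := eqgn j; rewrite /eqp => /andP[].
      move/maxe => h3; apply: (act_dvd (kB r s) _ h3).
      by have := eqgn e; rewrite /eqp => /andP[].
    (* [f^e] divides [f^(e-1)] times the only column of [M], so the twist of [g] divides this
       column; the quotient [u2] yields the preimage. *)
    have := act_Col_dvd q0 s0 mP P0 sP (keyM _ gev2) l lt; rewrite -/i.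
    rewrite (eqp_dvdr _ (eqp_mulr _ (_ : _ %= f ^+ e.-1))); last by rewrite eqp_sym.
    have f0 : f != 0 by case: fS => _ /irredp_neq0.
    rewrite -{1}[in f ^+ e](prednK e0) exprSr dvdp_mul2l ?expf_neq0 //.
    rewrite (eqp_dvdl _ eqg) => /dvdpP [u2 u2E].
    exists (um r Phi w (Eop (@VM k q r s (f ^+ e)) l c0
       (act (Bop r s (@VM k q r s (f ^+ e))) u2 (vec0 s (f ^+ e))))).
    split; first by rewrite -umLE memv_img // memvf.
    rewrite /B' -umact (act_Eop q0 (VM_semilin q0 r s _)) -/(tw _ _ _) -/i.
    rewrite -(actM (Bop_kadd q0 (VM_semilin q0 r s _) r s)) mulrC -u2E -ME.
    by rewrite cM.
  pose v' := v2 - c'.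
  have v'X : v' \notin (U + C)%VS.
    apply: contra v2X => h3; rewrite -(subrK c' v2); apply: memvD => //.
    by apply: (subvP (addvSr _ _)).
  have gv' : act B' (g ^+ 1) v' \in U.
    by rewrite expr1 (actB2 (kB r' s')) c'E gv2E addrK.
  have [mg1 g10 sg1 _] := inS_exp gS (ltn0Sn 0).
  pose L := umL r' s' (g ^+ 1) Phi v'.
  have v'L : v' \in limg L.
    by rewrite -{1}(um_vec0 r' s'0 sg1 Phi v') -umLE memv_img // memvf.
  have sU' : Dq_stable Phi (U + limg L) by exact: (um_addimg_stable q0 s'0 mg1 g10 sg1 sl sU gv').
  (* A nonzero stable subspace of V_{r',s'}(g) contains [v_0], whose image [v'] is outside [U + C].
     Hence [U] can be enlarged by the image of [L] without meeting [C]. *)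
  have K0 : (L @^-1: (U + C) = 0)%VS.
    apply/eqP; apply: contraT => nz; case/negP: v'X.
    have sK := um_preim_stable q0 s'0 mg1 g10 sg1 sl gv' sX (addvSl _ _).
    have := Vrs_socle iota q0 qnr s'0 co' gS (ltn0Sn 0) sK nz.
    by rewrite expr0 act1 -memv_preim umLE um_vec0.
  have U'C : ((U + limg L) :&: C = 0)%VS.
    apply/eqP; rewrite -subv0; apply/subvP => x; rewrite memv_cap => /andP[].
    case/memv_addP => u1 u1U [y /memv_imgP [M _ ->] xE] xC.
    have M0 : M = 0.
      apply/eqP; rewrite -memv0 -K0 -memv_preim.
      have -> : L M = x - u1 by rewrite xE addrAC subrr add0r.
      apply: memvB; first by apply: (subvP (addvSr _ _)).
      by apply: (subvP (addvSl _ _)).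
    rewrite -UC memv_cap xC andbT xE M0 linear0 addr0 //.
  have := maxU (U + limg L)%VS (conj sU' U'C) => le.
  have eU : U = (U + limg L)%VS by apply/eqP; rewrite eqEdim addvSl le.
  case/negP: v'X; apply: (subvP (addvSl _ _)); rewrite eU.
  by apply: (subvP (addvSr _ _)).
have [|U0|C0] := indec U C sU sC _ XT.
- by apply/directv_addP.
- exists r, s, f, e; split=> //; apply: (um_iso q0 s0 mP P0 sP sl we) => //.
  by rewrite -/C -XT U0 add0v.
- move: wC; rewrite C0 memv0 => /eqP w0; case/eqP: we1.
  by rewrite w0 (act02 (kB r s)).
Qed.

End Decomposition.

(** * Isomorphisms *)

Section Isomorphisms.
Variables (k : fieldType).
Local Notation F := (LS k).

Lemma Dq_iso_sym (V W : vectType F) (Phi : V -> V) (Psi : W -> W) :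
  Dq_iso Phi Psi -> Dq_iso Psi Phi.
Proof.
move=> [h [hl hb hc]]; have [g hK gK] := hb; exists g; split.
- by move=> a u v; apply: (bij_inj hb); rewrite hl !gK.
- by exists h.
- by move=> v; apply: (bij_inj hb); rewrite hc !gK.
Qed.

Lemma Dq_iso_trans (V W U : vectType F) (Phi : V -> V) (Psi : W -> W) (Xi : U -> U) :
  Dq_iso Phi Psi -> Dq_iso Psi Xi -> Dq_iso Phi Xi.
Proof.
move=> [h [hl hb hc]] [g [gl gb gc]]; exists (g \o h); split.
- by move=> a u v; rewrite /= hl gl.
- exact: bij_comp.
- by move=> v; rewrite /= hc gc.
Qed.

Lemma linear_hom (V W : vectType F) (h : V -> W) : linear h ->
  exists L : 'Hom(V, W), forall v, L v = h v.
Proof.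
move=> hl; have hM := GRing.isLinear.Build F V W *:%R h hl.
pose hL : {linear V -> W} := HB.pack h hM.
by exists (linfun hL) => v; rewrite lfunE.
Qed.

Lemma Dq_iso_dim (V W : vectType F) (Phi : V -> V) (Psi : W -> W) :
  Dq_iso Phi Psi -> \dim {:V} = \dim {:W}.
Proof.
move=> [h [hl hb hc]]; have [L LE] := linear_hom hl.
have ker0 : (lker L = 0)%VS.
  apply/eqP/lker0P => u v; rewrite !LE; exact: (bij_inj hb).
rewrite -(limg_dim_eq (f := L)) ?ker0 ?capv0 //; congr (\dim _).
apply/eqP; rewrite eqEsubv subvf /=; apply/subvP => w _.
by have [g hK gK] := hb; rewrite -[w]gK -LE memv_img // memvf.
Qed.

Lemma Dq_iso_irreducible (V W : vectType F) (Phi : V -> V) (Psi : W -> W) :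
  Dq_iso Phi Psi -> Dq_irreducible Phi -> Dq_irreducible Psi.
Proof.
move=> iso [V0 irr]; have dE := Dq_iso_dim iso.
have [h [hl hb hc]] := iso; have [L LE] := linear_hom hl; have [g hK gK] := hb.
split=> [|U sU]; first by rewrite -dimv_eq0 -dE dimv_eq0.
have sK : Dq_stable Phi (L @^-1: U)%VS.
  by move=> v; rewrite -!memv_preim !LE hc; exact: sU.
case: (irr _ sK) => K; [left | right].
  apply/eqP; rewrite -subv0; apply/subvP => w wU.
  have : g w \in (L @^-1: U)%VS by rewrite -memv_preim LE gK.
  rewrite K memv0 => /eqP g0; rewrite -[w]gK g0 memv0.
  by rewrite -(LE 0) linear0.
apply/eqP; rewrite eqEsubv subvf /=; apply/subvP => w _.
have : g w \in (L @^-1: U)%VS by rewrite K memvf.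
by rewrite -memv_preim LE gK.
Qed.

Lemma Vrs_VM_iso (q : k) r s f : Dq_iso (@VM k q r s f) (Vrs q r s f).
Proof.
exists mxvec; split.
- exact: linearP.
- by exists vec_mx; [exact: mxvecK | exact: vec_mxK].
- by move=> v; rewrite /Vrs /VrsRow mxvecK.
Qed.

End Isomorphisms.

Section PrimaryIsomorphisms.
Variables (k : fieldType) (q : k) (kbar : closedFieldType) (iota : {rmorphism k -> kbar}).
Hypothesis q0 : q != 0.
Hypothesis qnr : forall n : nat, (0 < n)%N -> q ^+ n != 1.
Implicit Types (f g : {poly k}) (r : int) (s d : nat).

Lemma inS_poly f : inS f -> [/\ f \is monic, f`_0 != 0 & (1 < size f)%N].
Proof. by case=> mf [sf _] f0. Qed.

Lemma vec0_neq0 s f : (0 < s)%N -> (1 < size f)%N -> vec0 s f != 0 :> 'M[LS k]_(degS f, s).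
Proof.
move=> s0 sf; apply/eqP => /matrixP /(_ (Ordinal (m_gt0 sf)) (Ordinal s0)).
by rewrite !mxE /= => /eqP; rewrite oner_eq0.
Qed.

Lemma Vrs_is_Dq r s f : (0 < s)%N -> coprime `|r| s -> inS f ->
  is_Dq_module (sigma_q q) (Vrs q r s f).
Proof.
move=> s0 co /inS_poly [mf f0 sf]; have [h1 h2] := VM_semilin q0 r s f.
have [g gK Kg] := VM_bij q0 s0 co mf f0 sf (r := r).
have E x : Vrs q r s f x = mxvec (@VM k q r s f (vec_mx x)) by [].
split=> [u v||a v]; rewrite ?E.
- by rewrite (linearD vec_mx) h1 (linearD mxvec).
- exists (fun x => mxvec (g (vec_mx x))) => x; rewrite E mxvecK.
    by rewrite gK vec_mxK.
  by rewrite Kg vec_mxK.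
- by rewrite (linearZ_LR vec_mx) h2 (linearZ_LR mxvec).
Qed.

Lemma Vrs_irreducible r s f : (0 < s)%N -> coprime `|r| s -> inS f ->
  Dq_irreducible (Vrs q r s f).
Proof.
move=> s0 co fS; have [mf f0 sf] := inS_poly fS.
apply: (Dq_iso_irreducible (Vrs_VM_iso q r s f)).
have v0 := vec0_neq0 s0 sf.
split=> [|U sU].
  apply: contraNneq v0 => e; rewrite -memv0 -e; exact: memvf.
have [->|U0] := eqVneq U 0%VS; [by left | right].
apply: (Vrs_gen q0 s0 co mf f0 sf sU).
by have := Vrs_socle iota q0 qnr s0 co fS (ltn0Sn 0) sU U0; rewrite expr0 act1.
Qed.

(** The image of [v_0] is a nonzero vector killed by [f^d(B)]; its slope and type give r, s and the
    orbit, and comparing dimensions gives [d]. *)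
Lemma primary_iso_data d r s f d' r' s' g :
  (0 < d)%N -> (0 < s)%N -> coprime `|r| s -> inS f ->
  (0 < d')%N -> (0 < s')%N -> coprime `|r'| s' -> inS g ->
  Dq_iso (@VM k q r s (f ^+ d)) (@VM k q r' s' (g ^+ d')) ->
  [/\ d = d', r = r', s = s' & same_orbit q f g].
Proof.
move=> d0 s0 co fS d'0 s'0 co' gS iso.
have [mf f0 sf dF] := inS_exp fS d0; have [mg g0 sg dG] := inS_exp gS d'0.
have dE := Dq_iso_dim iso; have [h [hl hb hc]] := iso.
have hk := kadd_linear hl; have slG := VM_semilin q0 r' s' (g ^+ d').
pose M := h (vec0 s (f ^+ d)).
have M0 : M != 0.
  apply: contraNneq (vec0_neq0 s0 sf) => M0; apply/eqP/(bij_inj hb).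
  by rewrite -/M M0 (kadd0 hk).
have hB v : h (Bop r s (@VM k q r s (f ^+ d)) v) = Bop r s (@VM k q r' s' (g ^+ d')) (h v).
  rewrite /Bop; have -> : forall a u, h (a *: u) = a *: h u.
    by move=> a u; have := hl a u 0; rewrite !addr0 (kadd0 hk) addr0.
  congr (_ *: _); have H n : h (iter n (@VM k q r s (f ^+ d)) v) = iter n (@VM k q r' s' (g ^+ d')) (h v).
    by elim: n => //= n IH; rewrite hc IH.
  exact: H.
have fM : act (Bop r s (@VM k q r' s' (g ^+ d'))) (f ^+ d) M = 0.
  rewrite /M -(act_morph0 _ _ hk (Bop_kadd q0 slG r s) hB).
  by rewrite (act_vec0 q0 r s0 mf f0 sf) (kadd0 hk).
have [er es] := torsion_slope q0 s'0 co' mg g0 sg s0 co f0 M0 fM.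
subst r' s'.
have [c [l [lt dv _ _]]] := torsion_primary q0 qnr s0 co mg g0 sg gS (erefl _) fS M0 fM.
have [mf1 if1 _] := fS; have [mg1 ig1 _] := gS.
have orb := dvd_tw_orbit q0 mg1 mf1 ig1 if1 dv.
split=> //; have [i [a [a0 ge]]] := same_orbit_tw q0 orb.
have dd : degS g = degS f by rewrite /degS ge size_scale // size_tw.
have := dE; rewrite !dimvf /dim /= dF dG dd => /eqP.
rewrite eqn_pmul2r // eqn_pmul2l; first by move/eqP.
by apply: m_gt0; case: if1.
Qed.

(** Bezout for r and s: every power of q arises as a commutation factor of some [t^l Phi^c], so
    every power of sigma_q is realised by an isomorphism. *)
Lemma weight_surj r s (i : int) : (0 < s)%N -> coprime `|r| s ->
  exists (c : nat) (l : int), s%:Z * l + r * c%:Z = i.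
Proof.
move=> s0 co; have [u [v e]] := Bezoutz r s%:Z.
have {}e : u * r + v * s%:Z = 1.
  by rewrite e /gcdz; move: co; rewrite /coprime => /eqP ->.
have c0 : (0 <= (u * i %% s%:Z)%Z) by apply: modz_ge0; lia.
exists `|(u * i %% s%:Z)%Z|%N, (v * i + r * (u * i %/ s%:Z)%Z).
have -> : `|(u * i %% s%:Z)%Z|%N%:Z = (u * i %% s%:Z)%Z by rewrite gez0_abs.
have := divz_eq (u * i) s%:Z; move: (u * i %/ s%:Z)%Z (u * i %% s%:Z)%Z => a b ab.
have -> : b = u * i - a * s%:Z by rewrite ab; ring.
by rewrite -[RHS]mul1r -e; ring.
Qed.

(** With [t^l Phi^c] of weight [i], the vector [t^l Phi^c v_0] of V_{r,s}(g) is killed by f(B),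
    because [tw q i f] is a multiple of [g]. The resulting map is injective, and the degrees of f
    and g agree. *)
Lemma same_orbit_iso r s f g : (0 < s)%N -> coprime `|r| s -> inS f -> inS g ->
  same_orbit q f g -> Dq_iso (Vrs q r s f) (Vrs q r s g).
Proof.
move=> s0 co fS gS orb; have [mf f0 sf] := inS_poly fS; have [mg g0 sg] := inS_poly gS.
apply: Dq_iso_trans (Dq_iso_sym (Vrs_VM_iso _ _ _ _)) (Dq_iso_trans _ (Vrs_VM_iso _ _ _ _)).
have [i [a [a0 ge]]] := same_orbit_tw q0 orb.
have [c [l wE]] := weight_surj i s0 co.
have slG := VM_semilin q0 r s g; have bG := VM_bij q0 s0 co mg g0 sg (r := r).
have kG := Bop_kadd q0 slG r s.
pose w := Eop (@VM k q r s g) l c (vec0 s g).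
have w0 : w != 0.
  apply: contraNneq (vec0_neq0 s0 sg) => e; rewrite -memv0.
  by apply: (stable_Eop_inv q0 slG bG (stable0 q0 slG) (l := l) (c := c)); rewrite -/w e mem0v.
have fw : act (Bop r s (@VM k q r s g)) f w = 0.
  rewrite (act_Eop q0 slG) wE -/(tw q i f).
  have -> : tw q i f = a^-1 *: g by rewrite ge scalerA mulVf // scale1r.
  rewrite actZ (act_vec0 q0 r s0 mg g0 sg) scaler0.
  exact: (kadd0 (Eop_kadd q0 slG l c)).
have inj : injective (@um k r s f _ (@VM k q r s g) w).
  apply: (um_primary_inj (e := 1) iota q0 qnr s0 co fS (ltn0Sn 0) slG fw).
  by rewrite expr0 act1.
apply: (um_iso q0 s0 mf f0 sf slG fw inj).
apply/eqP; rewrite eqEdim subvf (um_dim inj) dimvf /dim /=.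
by rewrite /degS ge size_scale // size_tw.
Qed.

Lemma Vrs_iso_iff r s f r' s' g :
  (0 < s)%N -> coprime `|r| s -> inS f -> (0 < s')%N -> coprime `|r'| s' -> inS g ->
  Dq_iso (Vrs q r s f) (Vrs q r' s' g) <-> [/\ r = r', s = s' & same_orbit q f g].
Proof.
move=> s0 co fS s'0 co' gS; split=> [iso|[<- <-]]; last exact: same_orbit_iso.
have iso' : Dq_iso (@VM k q r s (f ^+ 1)) (@VM k q r' s' (g ^+ 1)).
  exact: Dq_iso_trans (Vrs_VM_iso _ _ _ _) (Dq_iso_trans iso (Dq_iso_sym (Vrs_VM_iso _ _ _ _))).
by have [] := primary_iso_data (ltn0Sn 0) s0 co fS (ltn0Sn 0) s'0 co' gS iso'.
Qed.

Lemma is_Dq_semilin (V : vectType (LS k)) (Phi : V -> V) :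
  is_Dq_module (sigma_q q) Phi -> semilin q Phi /\ bijective Phi.
Proof. by case. Qed.

Lemma irreducible_Vrs (V : vectType (LS k)) (Phi : V -> V) :
  is_Dq_module (sigma_q q) Phi -> Dq_irreducible Phi ->
  exists r s f, [/\ (0 < s)%N, coprime `|r| s, inS f & Dq_iso Phi (Vrs q r s f)].
Proof.
move=> /is_Dq_semilin [sl bij] [V0 irr]; have st0 := stable0 q0 sl.
have nV : ~~ (fullv <= (0 : {vspace V}))%VS by rewrite subv0.
have [r [s [p [w1 [s0 co p0 [_ w1X] pw]]]]] := slope_torsion iota q0 qnr sl bij st0 (@stableT k V Phi) nV.
have [f [h [fS _]]] := irred_refine q0 sl st0 w1X p0 pw.
set w := act _ h w1; rewrite !memv0 => w0 /eqP fw.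
exists r, s, f; split=> //; have [mf f0 sf] := inS_poly fS.
apply: Dq_iso_sym (Dq_iso_trans (Dq_iso_sym (Vrs_VM_iso _ _ _ _)) _).
have inj : injective (@um k r s f V Phi w).
  apply: (um_primary_inj (e := 1) iota q0 qnr s0 co fS (ltn0Sn 0) sl fw).
  by rewrite expr0 act1.
apply: (um_iso q0 s0 mf f0 sf sl fw inj).
have := irr _ (um_img_stable q0 s0 mf f0 sf sl fw).
case=> // e; case/eqP: w0; apply/eqP; rewrite -memv0 -e.
by rewrite -{1}(um_vec0 r s0 sf Phi w) -umLE memv_img // memvf.
Qed.

End PrimaryIsomorphisms.

(** * The modules J_d (x) V_{r,s}(f) *)

Section Tensor.
Variables (k : fieldType) (q : k).
Hypothesis q0 : q != 0.
Local Notation F := (LS k).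
Local Notation cst := (@cstLS k).
Local Notation sg := (sigma_q q).

Lemma semilin_delta n (Phi : 'rV[F]_n -> 'rV[F]_n) u : semilin q Phi ->
  Phi u = \sum_j sg (u 0 j) *: Phi (delta_mx 0 j).
Proof.
move=> sl; rewrite {1}[u]row_sum_delta (kadd_sum (semilin_kadd q0 sl)).
by apply: eq_bigr => j _; rewrite sl.2.
Qed.

Section Def.
Variables (n1 n2 : nat) (Phi1 : 'rV[F]_n1 -> 'rV[F]_n1) (Phi2 : 'rV[F]_n2 -> 'rV[F]_n2).
Hypotheses (sl1 : semilin q Phi1) (sl2 : semilin q Phi2).
Local Notation TP := (tensor_mod sg Phi1 Phi2).

Lemma tensor_semilin : semilin q TP.
Proof.
split=> [M N|a M]; rewrite /tensor_mod.
  rewrite -big_split; apply: eq_bigr => i _; rewrite -big_split; apply: eq_bigr => j _ /=.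
  by rewrite mxE (sigmaD q0) scalerDl.
rewrite scaler_sumr; apply: eq_bigr => i _; rewrite scaler_sumr; apply: eq_bigr => j _ /=.
by rewrite mxE (sigmaM q0) scalerA.
Qed.

Definition ten (u : 'rV[F]_n1) (v : 'rV[F]_n2) : 'M[F]_(n1, n2) := u^T *m v.

Lemma tenE u v i j : ten u v i j = u 0 i * v 0 j.
Proof. by rewrite mxE big_ord1 mxE. Qed.

Lemma tensor_ten u v : TP (ten u v) = ten (Phi1 u) (Phi2 v).
Proof.
rewrite (semilin_delta u sl1) (semilin_delta v sl2) /tensor_mod {2}/ten.
rewrite (linear_sum trmx) mulmx_suml; apply: eq_bigr => i _ /=.
rewrite mulmx_sumr; apply: eq_bigr => j _.
by rewrite tenE (sigmaM q0) (linearZ_LR trmx) /= -scalemxAl -scalemxAr scalerA.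
Qed.

Lemma iter_tensor_ten N u v : iter N TP (ten u v) = ten (iter N Phi1 u) (iter N Phi2 v).
Proof. by elim: N => //= N ->; rewrite tensor_ten. Qed.

Lemma ten_neq0 u v : u != 0 -> v != 0 -> ten u v != 0.
Proof.
move=> /rV0Pn [i ui] /rV0Pn [j vj]; apply/eqP => /matrixP /(_ i j).
by rewrite tenE mxE => /eqP; rewrite mulf_eq0 (negbTE ui) (negbTE vj).
Qed.
End Def.
End Tensor.

Section Jordan.
Variables (k : fieldType) (q : k).
Hypothesis q0 : q != 0.
Hypothesis char0 : [pchar k] =i pred0.
Local Notation F := (LS k).
Local Notation cst := (@cstLS k).
Variable d' : nat.
Local Notation d := d'.+1.
Local Notation Pd := (('X - 1) ^+ d : {poly k}).

Let monPd : Pd \is monic.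
Proof. by rewrite rpredX // -polyC1 monicXsubC. Qed.
Let szPd : size Pd = d.+1.
Proof. by rewrite -polyC1 size_exp_XsubC. Qed.

(* The class of a constant polynomial [p(T)] in [J_d]. *)
Definition Jvec (p : {poly k}) : 'rV[F]_d := \row_j cst (p %% Pd)`_j.

Lemma JvecD p1 p2 : Jvec (p1 + p2) = Jvec p1 + Jvec p2.
Proof. by apply/rowP => j; rewrite !mxE modpD coefD rmorphD. Qed.
Lemma JvecZ a p : Jvec (a *: p) = cst a *: Jvec p.
Proof. by apply/rowP => j; rewrite !mxE modpZl coefZ rmorphM. Qed.
Lemma Jvec_dvd p : Pd %| p -> Jvec p = 0.
Proof. by move/eqP => e; apply/rowP => j; rewrite !mxE e coef0 rmorph0. Qed.
Lemma Jvec_eq0 p : Jvec p = 0 -> Pd %| p.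
Proof.
move/rowP => e; apply/eqP/polyP => j; rewrite coef0.
case: (ltnP j d) => lt.
  by have := e (Ordinal lt); rewrite !mxE => /eqP; rewrite fmorph_eq0 => /eqP.
rewrite nth_default //; apply: leq_trans lt.
by rewrite -ltnS -szPd ltn_modp monic_neq0.
Qed.

Lemma Jd_semilin : semilin q (Jd q d).
Proof.
split=> [u v|a u]; rewrite /Jd /cyc_mod.
  by rewrite -big_split; apply: eq_bigr => i _; rewrite mxE (sigmaD q0) scalerDl.
by rewrite scaler_sumr; apply: eq_bigr => i _; rewrite mxE (sigmaM q0) scalerA.
Qed.

(** [sigma_q] fixes constants, so on classes of polynomials over k the operator is multiplication by
    the variable in k[y]/(y - 1)^d. *)
Lemma Jd_Jvec p : Jd q d (Jvec p) = Jvec ('X * p).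
Proof.
have degPd : degS Pd = d by rewrite /degS szPd.
have PdE j : (('X - 1) ^+ d : {poly F})`_j = cst Pd`_j.
  by rewrite -coef_map rmorphXn rmorphB /= map_polyX rmorph1.
have sc : (size (p %% Pd)%R <= degS Pd)%N by rewrite degPd -ltnS -szPd ltn_modp monic_neq0.
have JE i : Jvec p 0 i = cst (p %% Pd)`_i by rewrite mxE.
apply/rowP => j; rewrite /Jd /cyc_mod summxE big_ord_recr /= [RHS]mxE.
rewrite -modp_mul [in RHS]mulX_modP ?szPd // degPd /= coefB coefXM coefZ.
rewrite [X in _ + X]mxE JE (sigma_cst q0) /Tmul ltnn !mxE PdE.
rewrite rmorphB rmorphM /= mulrN; congr (_ - _).
rewrite (eq_bigr (fun i : 'I_d' => cst (p %% Pd)`_i * (j == i.+1 :> nat)%:R)); last first.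
  move=> i _; rewrite mxE JE (sigma_cst q0); congr (_ * _).
  rewrite /Tmul /= ltnS ltn_ord mxE eqxx /= -[j == _](inj_eq val_inj) val_insubd /=.
  by rewrite ltnS ltn_ord.
case: (posnP j) => [j0|j1].
  by rewrite rmorph0 big1 // => i _; rewrite j0 mulr0.
have lt : (j.-1 < d')%N by rewrite -ltnS prednK.
rewrite (bigD1 (Ordinal lt)) //= big1 ?addr0 => [|i ne]; first by rewrite prednK // eqxx mulr1.
have -> : (j == i.+1 :> nat) = false; last by rewrite mulr0.
by apply: contraNF ne => /eqP e; apply/eqP/val_inj; rewrite /= e.
Qed.

Lemma iter_Jd_Jvec n p : iter n (Jd q d) (Jvec p) = Jvec ('X^n * p).
Proof.
elim: n => [|n IH]; first by rewrite mul1r.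
by rewrite iterS IH Jd_Jvec mulrA -exprS.
Qed.

Variables (r : int) (s : nat) (f : {poly k}).
Hypotheses (s_gt0 : (0 < s)%N) (fS : inS f).
Local Notation JV' := (JV q d r s f).
Local Notation VP := (@VM k q r s f).
Local Notation BV := (Bop r s VP).
Local Notation BJ := (Bop r s JV').

Let mf : f \is monic. Proof. by case: fS. Qed.
Let f0 : f`_0 != 0. Proof. by case: fS. Qed.
Let sf : (1 < size f)%N. Proof. by case: fS => _ []. Qed.
Let slV : semilin q VP := VM_semilin q0 r s f.
Let kV : kadd BV := Bop_kadd q0 slV r s.

Lemma Vrs_semilin : semilin q (Vrs q r s f).
Proof.
have E x : Vrs q r s f x = mxvec (VP (vec_mx x)) by [].
by split=> [u v|a u]; rewrite !E ?linearD ?linearZ /= ?slV.1 ?slV.2 ?linearD ?linearZ.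
Qed.

Lemma JV_semilin : semilin q JV'.
Proof. exact: (tensor_semilin q0). Qed.
Let kJ : kadd BJ := Bop_kadd q0 JV_semilin r s.

Definition Vvec (Q : {poly k}) : 'rV[F]_(degS f * s) := mxvec (act BV Q (vec0 s f)).

Lemma VvecD Q1 Q2 : Vvec (Q1 + Q2) = Vvec Q1 + Vvec Q2.
Proof. by rewrite /Vvec actD linearD. Qed.
Lemma VvecZ a Q : Vvec (a *: Q) = cst a *: Vvec Q.
Proof. by rewrite /Vvec actZ linearZ. Qed.
Lemma Vvec_dvd Q : f %| Q -> Vvec Q = 0.
Proof.
move=> dv; rewrite /Vvec (act_dvd kV dv) ?linear0 //.
exact: (act_vec0 q0 r s_gt0 mf f0 sf).
Qed.
Lemma Vvec_eq0 Q : Vvec Q = 0 -> f %| Q.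
Proof.
move/(congr1 vec_mx); rewrite /Vvec mxvecK linear0 => e.
have := act_Col_dvd q0 s_gt0 mf f0 sf e 0 s_gt0.
by rewrite Col_vec0 // mulr1 /wt !mulr0 addr0 tw0.
Qed.

Lemma BJ_ten p Q : BJ (ten (Jvec p) (Vvec Q)) = ten (Jvec ('X^s * p)) (Vvec (Q * 'X)).
Proof.
rewrite /Bop /JV (iter_tensor_ten q0 Jd_semilin Vrs_semilin) iter_Jd_Jvec.
rewrite /ten scalemxAr; congr (_ *m _).
have -> : iter s (Vrs q r s f) (Vvec Q) = mxvec (iter s VP (act BV Q (vec0 s f))).
  have H n : iter n (Vrs q r s f) (Vvec Q) = mxvec (iter n VP (act BV Q (vec0 s f))).
    by elim: n => // n IH; rewrite !iterS IH /Vrs /VrsRow mxvecK.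
  exact: H.
by rewrite /Vvec (actMX kV) /Bop linearZ.
Qed.

(* [theta] sends [y^i x^j], with [x] the outer variable, to [T^i (x) B^j v_0];
   on it the operator [B] acts as multiplication by [y^s x]. *)
Definition theta (R : {poly {poly k}}) : 'M[F]_(d, degS f * s) :=
  \sum_(i < size R) ten (Jvec R`_i) (Vvec 'X^i).

Lemma tenDl u u' v : ten (u + u') v = ten u v + ten u' v :> 'M[F]_(d, degS f * s).
Proof. by rewrite /ten linearD mulmxDl. Qed.
Lemma tenZl a u v : ten (a *: u) v = a *: ten u v :> 'M[F]_(d, degS f * s).
Proof. by rewrite /ten linearZ /= scalemxAl. Qed.
Lemma tenZr a u v : ten u (a *: v) = a *: ten u v :> 'M[F]_(d, degS f * s).
Proof. by rewrite /ten scalemxAr. Qed.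
Lemma ten0l v : ten 0 v = 0 :> 'M[F]_(d, degS f * s).
Proof. by rewrite /ten linear0 mul0mx. Qed.
Lemma ten0r u : ten u 0 = 0 :> 'M[F]_(d, degS f * s).
Proof. by rewrite /ten mulmx0. Qed.
Lemma Jvec0 : Jvec 0 = 0. Proof. by rewrite Jvec_dvd ?dvdp0. Qed.
Lemma Vvec0 : Vvec 0 = 0. Proof. by rewrite Vvec_dvd ?dvdp0. Qed.

Lemma theta_widen n (R : {poly {poly k}}) : (size R <= n)%N ->
  theta R = \sum_(i < n) ten (Jvec R`_i) (Vvec 'X^i).
Proof.
move=> le; rewrite /theta (big_ord_widen n (fun i => ten (Jvec R`_i) (Vvec 'X^i))) //.
rewrite big_mkcond; apply: eq_bigr => i _; case: ltnP => // ge.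
by rewrite nth_default // Jvec0 ten0l.
Qed.

Lemma thetaD R1 R2 : theta (R1 + R2) = theta R1 + theta R2.
Proof.
pose n := maxn (size R1) (size R2).
rewrite (@theta_widen n R1) ?leq_maxl // (@theta_widen n R2) ?leq_maxr //.
rewrite (@theta_widen n); last exact: leq_trans (size_polyD _ _) (leqnn _).
by rewrite -big_split; apply: eq_bigr => i _; rewrite coefD JvecD tenDl.
Qed.

Lemma theta0 : theta 0 = 0.
Proof. by rewrite /theta size_poly0 big_ord0. Qed.

Lemma theta_sum I (rr : seq I) (G : I -> {poly {poly k}}) :
  theta (\sum_(i <- rr) G i) = \sum_(i <- rr) theta (G i).
Proof. by apply: big_morph; [exact: thetaD | exact: theta0]. Qed.

Lemma theta_monom p i : theta (p%:P * 'X^i) = ten (Jvec p) (Vvec 'X^i).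
Proof.
have le : (size (p%:P * 'X^i)%R <= i.+1)%N.
  by rewrite mul_polyC (leq_trans (size_scale_leq _ _)) // size_polyXn.
rewrite (theta_widen le) (bigD1 ord_max) //= big1 ?addr0 => [|j ne].
  by rewrite coefCM coefXn eqxx mulr1.
by rewrite coefCM coefXn (_ : (j == i :> nat) = false) ?mulr0 ?Jvec0 ?ten0l //; apply/negbTE.
Qed.

Lemma theta_ten p Q : theta (p%:P * map_poly polyC Q) = ten (Jvec p) (Vvec Q).
Proof.
rewrite -[Q]coefK poly_def rmorph_sum mulr_sumr theta_sum.
have VS n (c : nat -> k) : Vvec (\sum_(i < n) c i *: 'X^i) = \sum_(i < n) cst (c i) *: Vvec 'X^i.
  by rewrite (big_morph Vvec VvecD Vvec0); apply: eq_bigr => i _; rewrite VvecZ.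
rewrite VS /ten mulmx_sumr; apply: eq_bigr => i _ /=.
rewrite -[RHS]/(ten (Jvec p) (cst Q`_i *: Vvec 'X^i)) tenZr -tenZl -JvecZ -theta_monom.
by rewrite map_polyZ map_polyXn -!mul_polyC polyCM; congr theta; ring.
Qed.

Lemma poly2_sum (R : {poly {poly k}}) : R = \sum_(i < size R) (R`_i)%:P * 'X^i.
Proof. by rewrite -{1}[R]coefK poly_def; apply: eq_bigr => i _; rewrite mul_polyC. Qed.

Lemma theta_Pd R : theta (Pd%:P * R) = 0.
Proof.
rewrite [R]poly2_sum mulr_sumr theta_sum big1 // => i _.
by rewrite mulrA -polyCM theta_monom Jvec_dvd ?ten0l // dvdp_mulIl.
Qed.

Lemma theta_f R : theta (map_poly polyC f * R) = 0.
Proof.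
rewrite [R]poly2_sum mulr_sumr theta_sum big1 // => i _.
rewrite mulrCA -(map_polyXn (@polyC k)) -rmorphM theta_ten Vvec_dvd ?ten0r //.
exact: dvdp_mulIl.
Qed.

Let Y : {poly {poly k}} := ('X^s)%:P * 'X.

Lemma BJ_theta R : BJ (theta R) = theta (Y * R).
Proof.
rewrite [X in theta (Y * X)](poly2_sum R) mulr_sumr theta_sum /theta (kadd_sum kJ).
apply: eq_bigr => i _; rewrite BJ_ten -exprSr -theta_monom; congr theta.
by rewrite /Y polyCM exprS; ring.
Qed.

Lemma iter_BJ_theta n R : iter n BJ (theta R) = theta (Y ^+ n * R).
Proof. by elim: n => [|n IH]; rewrite ?mul1r // iterS IH BJ_theta mulrA -exprS. Qed.

(** The polynomial [f(y^s x)], by which f(B) acts through [theta]. *)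
Let ft : {poly {poly k}} := \sum_(i < size f) (f`_i)%:P%:P * Y ^+ i.

Lemma thetaZ a R : theta (a%:P%:P * R) = cst a *: theta R.
Proof.
rewrite [R]poly2_sum mulr_sumr !theta_sum scaler_sumr; apply: eq_bigr => i _.
by rewrite mulrA -polyCM [a%:P * _]mul_polyC !theta_monom JvecZ tenZl.
Qed.

Lemma act_BJ_theta n R : act BJ (f ^+ n) (theta R) = theta (ft ^+ n * R).
Proof.
elim: n R => [|n IH] R; first by rewrite act1 mul1r.
rewrite exprSr (actM kJ) -[RHS]/(theta _) exprSr -mulrA -IH; congr act.
rewrite /ft mulr_suml theta_sum /act; apply: eq_bigr => i _.
by rewrite iter_BJ_theta -mulrA thetaZ.
Qed.

(** Taylor expansion of [f(y^s x)] at [y = 1], as [f(x) + (y - 1) s x f'(x)] plus a multiple of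
    [(y - 1)^2]; it rests on [y^n - 1 = (y - 1) (n + (y - 1) u)]. *)
Lemma ft_decomp : exists G G2, ft = map_poly polyC f + ('X - 1)%:P * G /\
  G = map_poly polyC (s%:R *: ('X * f^`())) + ('X - 1)%:P * G2.
Proof.
pose hh n : {poly k} := \sum_(j < n) 'X^j.
have hE n : 'X^n - 1 = ('X - 1) * hh n :> {poly k}.
  by rewrite subrX1; congr (_ * _); apply: eq_bigr => j _; rewrite expr1n mulr1.
have h2E n : exists u, hh n = n%:R + ('X - 1) * u.
  have : root (hh n - n%:R) 1.
    rewrite /root !hornerE horner_sum -[n%:R]polyC_natr hornerC.
    rewrite (eq_bigr (fun=> 1)) => [|i _]; last by rewrite hornerXn expr1n.
    by rewrite sumr_const card_ord subrr.
  case/factor_theorem => u; rewrite polyC1 => e; exists u.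
  by rewrite mulrC -e addrC subrK.
pose u n := sval (constructive_indefinite_description _ (h2E n)).
have uE n : hh n = n%:R + ('X - 1) * u n.
  by rewrite /u; case: constructive_indefinite_description.
exists (\sum_(i < size f) (f`_i)%:P%:P * (hh (s * i)%N)%:P * 'X^i).
exists (\sum_(i < size f) (f`_i)%:P%:P * (u (s * i)%N)%:P * 'X^i).
split.
  have fE : map_poly polyC f = \sum_(i < size f) (f`_i)%:P%:P * 'X^i.
    rewrite -{1}[f]coefK poly_def rmorph_sum; apply: eq_bigr => i _ /=.
    by rewrite map_polyZ map_polyXn -mul_polyC.
  rewrite fE mulr_sumr -big_split; apply: eq_bigr => i _ /=.
  rewrite /Y exprMn -polyC_exp -exprM.
  have -> : 'X^(s * i) = 1 + ('X - 1) * hh (s * i)%N :> {poly k} by rewrite -hE addrC subrK.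
  by rewrite polyCD polyCM polyC1; ring.
have -> : s%:R *: ('X * f^`()) = \sum_(i < size f) (f`_i * (s * i)%N%:R) *: 'X^i.
  apply/polyP => j; rewrite coefZ coefXM -(poly_def (size f) (fun i => f`_i * (s * i)%N%:R)) coef_poly.
  case: j => [|j] /=; first by rewrite muln0 mulr0 mulr0 if_same.
  rewrite coef_deriv; case: ltnP => lt; first by rewrite natrM -mulr_natr; ring.
  by rewrite nth_default // mul0rn mulr0.
rewrite rmorph_sum mulr_sumr -big_split; apply: eq_bigr => i _ /=.
rewrite map_polyZ map_polyXn -mul_polyC uE polyCD !polyCM.
by rewrite ?polyCM !polyC_natr; ring.
Qed.

Let z : {poly {poly k}} := ('X - 1)%:P.

(** [theta] kills multiples of [f(x)] and of [(y - 1)^d]. Modulo [f(x)] the power [ft^n] is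
    [(y - 1)^n G^n], so it vanishes for [n = d], and for [n = d - 1] only the value of [G] at
    [y = 1] remains. *)
Lemma theta_ft_top : theta (ft ^+ d) = 0 /\ theta (ft ^+ d') =
  ten (Jvec (('X - 1) ^+ d')) (Vvec ((s%:R *: ('X * f^`())) ^+ d')).
Proof.
have [G [G2 [ftE GE]]] := ft_decomp.
have H1 n : exists R, ft ^+ n = z ^+ n * G ^+ n + map_poly polyC f * R.
  elim: n => [|n [R e]]; first by exists 0; rewrite !expr0 mulr0 addr0 mulr1.
  exists (z ^+ n * G ^+ n + ft * R).
  by rewrite exprS e {1}ftE -/z mulrDl ftE -/z !exprS; ring.
have H2 n : exists R, G ^+ n = map_poly polyC ((s%:R *: ('X * f^`())) ^+ n) + z * R.
  elim: n => [|n [R e]]; first by exists 0; rewrite !expr0 mulr0 addr0 rmorph1.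
  exists (map_poly polyC (s%:R *: ('X * f^`())) * R + G2 * G ^+ n).
  by rewrite exprS {1}GE mulrDl e [in RHS]exprS rmorphM /= -/z; ring.
have zE n : z ^+ n = (('X - 1) ^+ n)%:P by rewrite /z polyC_exp.
split.
  have [R ->] := H1 d.
  by rewrite thetaD theta_f addr0 zE theta_Pd.
have [R ->] := H1 d'; have [R' ->] := H2 d'.
rewrite thetaD theta_f addr0 mulrDr thetaD mulrA -exprSr zE theta_ten zE theta_Pd addr0 //.
Qed.

Variables (kbar : closedFieldType) (iota : {rmorphism k -> kbar}).
Hypothesis qnr : forall n : nat, (0 < n)%N -> q ^+ n != 1.
Hypothesis co_rs : coprime `|r| s.

(** In characteristic zero [s] is nonzero and [f] is prime to f'; [f] is also prime to x, hence to
    every power of [s x f']. *)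
Lemma ten_top_neq0 :
  ten (Jvec (('X - 1) ^+ d')) (Vvec ((s%:R *: ('X * f^`())) ^+ d')) != 0.
Proof.
have nat0 n : (n%:R == 0 :> k) = (n == 0%N) by apply: (pcharf0P k).1.
have x0 : ('X - 1) ^+ d' != 0 :> {poly k} by rewrite expf_neq0 // -polyC1 polyXsubC_eq0.
apply: ten_neq0.
  apply/eqP => /Jvec_eq0 /(dvdp_leq x0).
  by rewrite szPd -polyC1 size_exp_XsubC ltnn.
have [_ irf _] := fS.
apply/eqP => /Vvec_eq0 /(irred_dvdX irf).
rewrite dvdpZr ?nat0 -?lt0n // Gauss_dvdpr; last first.
  by rewrite coprimepX /root horner_coef0.
move=> dv; have := irred_coprimep_deriv char0 mf irf.
by rewrite irreducible_poly_coprime // dv.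
Qed.

(** [theta 1] is [e_0 (x) v_0], killed by [f^d(B)] but not by [f^(d-1)(B)]. So V_{r,s}(f^d) embeds,
    and the dimensions agree. *)
Lemma JV_iso : Dq_iso (@VM k q r s (f ^+ d)) JV'.
Proof.
have [mfd fd0 sfd dE] := inS_exp fS (ltn0Sn d').
have [t1 t2] := theta_ft_top.
have w0 : act BJ (f ^+ d) (theta 1) = 0 by rewrite act_BJ_theta mulr1.
have w1 : act BJ (f ^+ d.-1) (theta 1) != 0.
  by rewrite act_BJ_theta mulr1 t2 ten_top_neq0.
have inj := um_primary_inj iota q0 qnr s_gt0 co_rs fS (ltn0Sn d') JV_semilin w0 w1.
apply: (um_iso q0 s_gt0 mfd fd0 sfd JV_semilin w0 inj).
apply/eqP; rewrite eqEdim subvf (um_dim inj) dimvf /dim /= dE.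
by rewrite mulnAC mulnC.
Qed.

End Jordan.

(** * Extension of scalars *)

Section FiniteSpan.
Variables (k kbar : fieldType) (iota : {rmorphism k -> kbar}).

Definition inspan (B : seq kbar) (x : kbar) :=
  exists c : 'I_(size B) -> k, x = \sum_(i < size B) iota (c i) * B`_i.

Lemma inspan0 B : inspan B 0.
Proof. by exists (fun=> 0); rewrite big1 // => i _; rewrite rmorph0 mul0r. Qed.
Lemma inspanD B x y : inspan B x -> inspan B y -> inspan B (x + y).
Proof.
move=> [c ->] [c' ->]; exists (fun i => c i + c' i); rewrite -big_split.
by apply: eq_bigr => i _; rewrite rmorphD mulrDl.
Qed.
Lemma inspanZ B a x : inspan B x -> inspan B (iota a * x).
Proof.
move=> [c ->]; exists (fun i => a * c i); rewrite mulr_sumr.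
by apply: eq_bigr => i _; rewrite rmorphM mulrA.
Qed.
Lemma inspan_sum B I (r : seq I) (P : pred I) (G : I -> kbar) :
  (forall i, P i -> inspan B (G i)) -> inspan B (\sum_(i <- r | P i) G i).
Proof. by move=> h; apply: big_ind => //; [exact: inspan0 | exact: inspanD]. Qed.
Lemma inspan_mem (B : seq kbar) x : x \in B -> inspan B x.
Proof.
move=> xB; have lt : (index x B < size B)%N by rewrite index_mem.
exists (fun i => (i == Ordinal lt)%:R); rewrite (bigD1 (Ordinal lt)) //= big1.
  by rewrite eqxx rmorph1 mul1r addr0 nth_index.
by move=> i /negbTE ->; rewrite rmorph0 mul0r.
Qed.
Lemma inspan_sub (B B' : seq kbar) x : {subset B <= B'} -> inspan B x -> inspan B' x.
Proof.
move=> sub [c ->]; apply: inspan_sum => i _; apply: inspanZ; apply: inspan_mem.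
by apply: sub; rewrite mem_nth.
Qed.
Lemma inspanM (B B' : seq kbar) x y : inspan B x -> inspan B' y ->
  inspan [seq u * v | u <- B, v <- B'] (x * y).
Proof.
move=> [c ->] [c' ->]; rewrite mulr_suml; apply: inspan_sum => i _.
rewrite mulr_sumr; apply: inspan_sum => j _; rewrite mulrACA -rmorphM.
by apply: inspanZ; apply: inspan_mem; apply/allpairs_f; rewrite mem_nth.
Qed.

Lemma fin_spanD a b : fin_span iota a -> fin_span iota b -> fin_span iota (a + b).
Proof.
move=> [B hB] [B' hB']; exists (B ++ B') => n; apply: inspanD.
  by apply: inspan_sub (hB n) => x xB; rewrite mem_cat xB.
by apply: inspan_sub (hB' n) => x xB; rewrite mem_cat xB orbT.
Qed.
Lemma fin_spanM a b : fin_span iota a -> fin_span iota b -> fin_span iota (a * b).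
Proof.
move=> [B hB] [B' hB']; exists [seq u * v | u <- B, v <- B'] => n.
by rewrite pcoefM; apply: inspan_sum => i _; exact: inspanM.
Qed.
Lemma fin_spanC c : fin_span iota (psC c).
Proof.
exists [:: c] => n; suff : inspan [:: c] (if n == 0%N then c else 0) by [].
case: eqP => _; last exact: inspan0.
by apply: inspan_mem; rewrite inE.
Qed.

Local Notation P := (in_kbar0 iota).

Lemma in_kbar0_cst c : P (cstLS c).
Proof.
exists (psC c), 1; split; [exact: oner_neq0 | exact: fin_spanC | | by rewrite tofrac1 divr1].
rewrite -(rmorph1 (@psC kbar)); exact: fin_spanC.
Qed.
Lemma in_kbar0D x y : P x -> P y -> P (x + y).
Proof.
move=> [a [b [b0 ha hb ->]]] [c [d [d0 hc hd ->]]].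
exists (a * d + c * b), (b * d); split.
- exact: mulf_neq0.
- by apply: fin_spanD; exact: fin_spanM.
- exact: fin_spanM.
- by rewrite addf_div ?tofrac_eq0 // tofracD !tofracM.
Qed.
Lemma in_kbar0M x y : P x -> P y -> P (x * y).
Proof.
move=> [a [b [b0 ha hb ->]]] [c [d [d0 hc hd ->]]].
exists (a * c), (b * d); split.
- exact: mulf_neq0.
- exact: fin_spanM.
- exact: fin_spanM.
- by rewrite mulf_div !tofracM.
Qed.

Lemma mx_over_mul m n p (A : 'M_(m, n)) (M : 'M_(n, p)) :
  mx_over P A -> mx_over P M -> mx_over P (A *m M).
Proof.
move=> hA hM i j; rewrite mxE; apply: (big_ind P).
- by rewrite -(rmorph0 (@cstLS kbar)); exact: in_kbar0_cst.
- exact: in_kbar0D.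
- by move=> x _; exact: in_kbar0M.
Qed.

End FiniteSpan.

Section ScalarExtension.
Variables (k : fieldType) (kbar : closedFieldType) (iota : {rmorphism k -> kbar}).

Lemma ps_map_zmod : zmod_morphism (ps_map iota).
Proof. by move=> a b; apply: ps_ext => n /=; rewrite rmorphB. Qed.
Lemma ps_map_monoid : monoid_morphism (ps_map iota).
Proof.
split=> [|a b]; apply: ps_ext => n /=; first by rewrite rmorph_nat.
by rewrite rmorph_sum; apply: eq_bigr => j _; rewrite rmorphM.
Qed.
HB.instance Definition _ :=
  GRing.isZmodMorphism.Build (pser k) (pser kbar) (ps_map iota) ps_map_zmod.
HB.instance Definition _ :=
  GRing.isMonoidMorphism.Build (pser k) (pser kbar) (ps_map iota) ps_map_monoid.

Lemma ps_map_inj : injective (ps_map iota).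
Proof.
move=> a b e; apply: ps_ext => n; apply: (fmorph_inj iota).
exact: (congr1 (fun u : pser kbar => pcoef u n) e).
Qed.

Definition LSmap : LS k -> LS kbar := LS_map iota.
HB.instance Definition _ := GRing.isZmodMorphism.Build (LS k) (LS kbar) LSmap
  (frac_map_zmod ps_map_inj).
HB.instance Definition _ := GRing.isMonoidMorphism.Build (LS k) (LS kbar) LSmap
  (frac_map_monoid ps_map_inj).

Lemma LSmap_tofrac a : LSmap a%:F = (ps_map iota a)%:F.
Proof.
have := frac_mapE ps_map_inj a (oner_neq0 _).
by rewrite !rmorph1 !divr1.
Qed.
Lemma LSmap_t : LSmap (tLS k) = tLS kbar.
Proof. by rewrite LSmap_tofrac; congr _%:F; apply: ps_ext => n /=; rewrite rmorph_nat. Qed.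
Lemma LSmapM : {morph LSmap : x y / x * y}. Proof. exact: (rmorphM LSmap). Qed.
Lemma LSmapD : {morph LSmap : x y / x + y}. Proof. exact: (rmorphD LSmap). Qed.
Lemma LSmap0 : LSmap 0 = 0. Proof. exact: (rmorph0 LSmap). Qed.
Lemma LSmap1 : LSmap 1 = 1. Proof. exact: (rmorph1 LSmap). Qed.
Lemma LSmap_tz (n : int) : LSmap (tLS k ^ n) = tLS kbar ^ n.
Proof.
have -> : LSmap (tLS k ^ n) = LSmap (tLS k) ^ n by exact: (rmorphXz LSmap n (tLS_unit k)).
by rewrite LSmap_t.
Qed.
Lemma LSmap_cst c : LSmap (cstLS c) = cstLS (iota c).
Proof.
by rewrite LSmap_tofrac; congr _%:F; apply: ps_ext => n /=; case: eqP => // _; rewrite rmorph0.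
Qed.

Variable q : k.
Hypothesis q0 : q != 0.
Hypothesis char0 : [pchar k] =i pred0.
Local Notation sg := (sigma_q (iota q)).
Local Notation t := (tLS kbar).
Local Notation cst := (@cstLS kbar).
Variables (r : int) (s : nat) (f : {poly k}) (l : seq kbar).
Hypotheses (s_gt0 : (0 < s)%N) (fS : inS f) (ul : uniq l).
Hypothesis lE : forall x : kbar, (x \in l) = root (map_poly iota f) x.
Local Notation m := (degS f).

Let iq0 : iota q != 0. Proof. by rewrite fmorph_eq0. Qed.
Let mf : f \is monic. Proof. by case: fS. Qed.
Let irf : irreducible_poly f. Proof. by case: fS. Qed.
Let sf : (1 < size f)%N. Proof. by case: irf. Qed.

Let W : 'rV[LS kbar]_(m * s) -> 'rV[LS kbar]_(m * s) :=
  VrsRow sg t r (fun j : 'I_m => cst (iota (- f`_j))).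

Let W_semilin : semilin (iota q) W.
Proof.
pose W' := VrsM sg t r (fun j : 'I_m => cst (iota (- f`_j))) : 'M[LS kbar]_(m, s) -> 'M[LS kbar]_(m, s).
have WE x : W x = mxvec (W' (vec_mx x)) by [].
have slW : semilin (iota q) W'.
  split=> [M N|a M]; apply/matrixP => i j; rewrite !mxE.
    by case: ifP => _; [| case: ifP => _]; rewrite !(sigmaD iq0); ring.
  by case: ifP => _; [| case: ifP => _]; rewrite !(sigmaM iq0); ring.
by split=> [u v|a u]; rewrite !WE ?linearD ?linearZ /= ?slW.1 ?slW.2 ?linearD ?linearZ.
Qed.

Let ext_VrsE x : ext_Vrs q kbar iota r s f x = W x.
Proof.
rewrite (semilin_delta iq0 x W_semilin); apply: eq_bigr => i _; congr (_ *: _).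
rewrite /Vrs /VrsRow /W /VrsRow map_mxvec; congr mxvec.
case/mxvec_indexP: i => i j.
have E (K : fieldType) : vec_mx (delta_mx 0 (mxvec_index i j)) = delta_mx i j :> 'M[LS K]_(m, s).
  by rewrite vec_mx_delta.
rewrite !E; apply/matrixP => a b; rewrite !mxE -[LS_map iota]/LSmap.
have S1 (c : bool) : LSmap (sigma_q q c%:R) = sg c%:R.
  by case: c; rewrite ?(sigma1 q0) ?(sigma0 q0) ?(sigma1 iq0) ?(sigma0 iq0) ?LSmap1 ?LSmap0.
case: ifP => _; first exact: S1.
rewrite LSmapM LSmapD LSmapM LSmap_tz LSmap_cst S1.
by case: ifP => _; rewrite ?S1 ?LSmap0.
Qed.

Let size_l : size l = m.
Proof.
have sep : separable_poly (map_poly iota f).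
  by rewrite separable_map separable_poly.unlock irred_coprimep_deriv.
have [rr er] := closed_field_poly_normal (map_poly iota f).
have lc1 : lead_coef (map_poly iota f) = 1 by rewrite lead_coef_map (eqP mf) rmorph1.
rewrite lc1 scale1r in er.
have ur : uniq rr by rewrite -separable_prod_XsubC -er.
have pr : perm_eq l rr.
  by apply: uniq_perm => // x; rewrite lE er root_prod_XsubC.
rewrite (perm_size pr) /degS -(size_map_poly iota) er size_prod_XsubC //.
Qed.

Let A0 : 'M[kbar]_(size l, m) := \matrix_(i, j) l`_i ^+ j.

(** Vandermonde: a vector in the kernel is a polynomial of degree below [m] that vanishes at the [m]
    distinct elements of [l]. *)
Let A0_free : row_free A0^T.
Proof.
rewrite -kermx_eq0; apply/rowV0P => v /sub_kermxP vA.
apply/rowP => j; rewrite mxE.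
have p0 : rVpoly v = 0.
  apply: (roots_geq_poly_eq0 (rs := l)) => //; last by rewrite size_l size_poly.
  apply/allP => x xl; have lt : (index x l < size l)%N by rewrite index_mem.
  apply/rootP; rewrite (horner_coef_wide _ (size_poly _ _)).
  have := congr1 (fun M : 'rV_(size l) => M 0 (Ordinal lt)) vA; rewrite !mxE => e.
  rewrite -[RHS]e; apply: eq_bigr => i _.
  by rewrite coef_rVpoly_ord !mxE /= nth_index.
by have := coef_rVpoly_ord v j; rewrite p0 coef0.
Qed.

Let A0_full : row_full A0^T.
Proof. by move: A0_free; rewrite /row_free /row_full => /eqP ->; rewrite size_l. Qed.

(** [size l] and [m] are equal but not convertible, so the inverse of [A0] is taken as a
    pseudo-inverse of a matrix of full rank. *)
Let B0 : 'M[kbar]_(m, size l) := (pinvmx A0^T)^T.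
Let BA : B0 *m A0 = 1%:M.
Proof. by apply: trmx_inj; rewrite trmx_mul trmxK trmx1 mulmxVp. Qed.
Let AB : A0 *m B0 = 1%:M.
Proof. by apply: trmx_inj; rewrite trmx_mul trmxK trmx1 mulVpmx. Qed.

Let A : 'M[LS kbar]_(size l, m) := map_mx cst A0.
Let B : 'M[LS kbar]_(m, size l) := map_mx cst B0.

Let root_l (i : 'I_(size l)) : \sum_(j < m) l`_i ^+ j * iota (- f`_j) = l`_i ^+ m.
Proof.
have : root (map_poly iota f) l`_i by rewrite -lE mem_nth.
rewrite /root horner_coef size_map_poly.
have -> : size f = m.+1 by rewrite /degS prednK // ltnW.
have fm : (map_poly iota f)`_m = 1.
  by rewrite coef_map (_ : f`_m = 1); [exact: (rmorph1 iota) | exact: (eqP mf)].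
rewrite big_ord_recr /= fm.
rewrite mul1r addr_eq0 => /eqP e; rewrite -[RHS]opprK -e -sumrN.
by apply: eq_bigr => j _; rewrite coef_map rmorphN mulrN mulrC.
Qed.

(** Row [lambda] of [A M] is the component along [e_lambda]. The passage from the last column to
    column 0 multiplies it by [lambda t^r]; for [v_(m-1)] this holds because [lambda] is a root of
    [f]. *)
Let comm (M : 'M[LS kbar]_(m, s)) :
  A *m VrsM sg t r (fun j : 'I_m => cst (iota (- f`_j))) M = sum_Vlam q kbar iota r s l (A *m M).
Proof.
apply/matrixP => i c; rewrite mxE /sum_Vlam /dsum_mod [RHS]mxE /Vlam /cyc_mod summxE.
set p := 'X^s - _.
have pE (j : 'I_s) : p`_j = if (j == 0 :> nat) then - (cst l`_i * t ^ r) else 0.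
  rewrite /p coefB coefXn coefC ltn_eqF // sub0r.
  by case: eqP => // _; rewrite oppr0.
have sgA j : sg (row i (A *m M) 0 j) = \sum_(x < m) cst (l`_i ^+ x) * sg (M x j).
  rewrite !mxE (big_morph sg (sigmaD iq0) (sigma0 iq0)); apply: eq_bigr => x _.
  by rewrite (sigmaM iq0) !mxE (sigma_cst iq0).
have lts : (s.-1 < s)%N by rewrite ltn_predL.
have TE (j : 'I_s) : Tmul p j 0 c = if (j.+1 < s)%N then (c == j.+1 :> nat)%:R
    else if (c == 0 :> nat) then cst l`_i * t ^ r else 0.
  rewrite /Tmul; case: ifP => lt.
    by rewrite mxE eqxx /= -(inj_eq val_inj) val_insubd lt.
  by rewrite !mxE pE; case: eqP => _; rewrite ?opprK ?oppr0.
rewrite [RHS](eq_bigr (fun j => sg (row i (A *m M) 0 j) * (if (j.+1 < s)%N then (c == j.+1 :> nat)%:R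
    else if (c == 0 :> nat) then cst l`_i * t ^ r else 0))); last first.
  by move=> j _; rewrite mxE TE.
case: (posnP c) => [c0|c1]; last first.
  have ltc : (c.-1 < s)%N := leq_ltn_trans (leq_pred _) (ltn_ord c).
  rewrite [RHS](bigD1 (Ordinal ltc)) //= [X in _ = _ + X]big1 ?addr0 => [|j ne]; last first.
    case: ifP => _; last by rewrite mulr0.
    rewrite (_ : (c == j.+1 :> nat) = false) ?mulr0 //.
    by apply: contraNF ne => /eqP e; apply/eqP/val_inj; rewrite /= e.
  rewrite prednK // ltn_ord eqxx mulr1 sgA; apply: eq_bigr => x _.
  rewrite !mxE c1; congr (_ * sg (M x _)); apply: val_inj; rewrite val_insubd /=.
  by rewrite (leq_ltn_trans (leq_pred _) (ltn_ord c)).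
rewrite [RHS](bigD1 (Ordinal lts)) //= [X in _ = _ + X]big1 ?addr0 => [|j ne]; last first.
  have -> : (j.+1 < s)%N.
    rewrite ltn_neqAle ltn_ord andbT; apply: contra ne => /eqP e.
    by apply/eqP/val_inj; exact: (congr1 predn e).
  by rewrite c0 mulr0.
rewrite prednK // ltnn.
have cE : insubd c s.-1 = Ordinal lts by apply: val_inj; rewrite val_insubd lts.
pose S (j : nat) : LS kbar := if insub j is Some j' then sg (M j' (Ordinal lts)) else 0.
have SE (j : 'I_m) : sg (M j (Ordinal lts)) = S j by rewrite /S valK.
have sgS : sg (row i (A *m M) 0 (Ordinal lts)) = \sum_(x < m) cst (l`_i ^+ x) * S x.
  by rewrite sgA; apply: eq_bigr => x _; rewrite SE.
rewrite sgS (eq_bigr (fun j : 'I_m => t ^ r * (cst (l`_i ^+ j) * (if (0 < j)%N then S j.-1 else 0))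
   + t ^ r * S m.-1 * cst (l`_i ^+ j * iota (- f`_j)))); last first.
  move=> j _; rewrite !mxE c0 /= cE.
  have m0 : (0 < m)%N by exact: leq_ltn_trans (leq0n _) (ltn_ord j).
  have ltj : (j.-1 < m)%N := leq_ltn_trans (leq_pred _) (ltn_ord j).
  have ltm : (m.-1 < m)%N by rewrite ltn_predL.
  rewrite !SE !val_insubd ltj ltm rmorphM /=; case: ifP => _; ring.
rewrite big_split /= -!mulr_sumr -(rmorph_sum cst) root_l.
have mE : m = m.-1.+1 by rewrite prednK // m_gt0.
(* Shifting the index by one takes a factor [lambda] out of the terms with [j >= 1], and the term in
   [lambda^m] completes the sum. *)
rewrite mE; move: m.-1 => n {mE}.
rewrite big_ord_recl /= mulr0 add0r [in RHS]big_ord_recr /=.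
rewrite (eq_bigr (fun x : 'I_n => cst l`_i * (cst (l`_i ^+ x) * S x))); last first.
  by move=> x _; rewrite /= /bump /= add1n add0n exprS rmorphM mulrA.
by rewrite -mulr_sumr exprS rmorphM /=; ring.
Qed.

(** The change of basis and its inverse have constant entries, and constants of kbar lie in
    kbar((t))_0, so both directions preserve vectors over that field. *)
Lemma ext_Vrs_decomposition :
  Dq_iso_over (in_kbar0 iota) (ext_Vrs q kbar iota r s f) (sum_Vlam q kbar iota r s l).
Proof.
exists (fun x => A *m vec_mx x), (fun M => mxvec (B *m M)); split; last split; last split.
- split.
  + by move=> a u v; rewrite linearP mulmxDr scalemxAr.
  + by move=> a u v; rewrite mulmxDr -scalemxAr linearP.
  + by move=> x; rewrite mulmxA -map_mxM BA map_mx1 mul1mx vec_mxK.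
  + by move=> M; rewrite mxvecK mulmxA -map_mxM AB map_mx1 mul1mx.
- by move=> x; rewrite ext_VrsE -comm /W /VrsRow mxvecK.
- move=> x hx; apply: mx_over_mul => [i j|i j]; first by rewrite mxE; exact: in_kbar0_cst.
  by rewrite mxE; exact: hx.
- move=> M hM i j; rewrite ord1; case/mxvec_indexP: j => a b; rewrite mxvecE.
  by apply: mx_over_mul => // i' j'; rewrite mxE; exact: in_kbar0_cst.
Qed.

End ScalarExtension.

Theorem mainTheorem6 (k : fieldType) (q : k) (kbar : closedFieldType)
    (iota : {rmorphism k -> kbar}) :
  [pchar k] =i pred0 ->
  q != 0 ->
  (forall n : nat, (0 < n)%N -> q ^+ n != 1) ->
  (forall x : kbar, exists p : {poly k}, p != 0 /\ root (map_poly iota p) x) ->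
  (* (i) irreducibility of V_{r,s}(f) *)
  (forall (r : int) (s : nat) (f : {poly k}),
     (0 < s)%N -> coprime `|r|%N s -> inS f ->
     is_Dq_module (sigma_q q) (Vrs q r s f) /\
     Dq_irreducible (Vrs q r s f)) /\
  (* (i) isomorphism criterion *)
  (forall (r : int) (s : nat) (f : {poly k}) (r' : int) (s' : nat) (g : {poly k}),
     (0 < s)%N -> coprime `|r|%N s -> inS f ->
     (0 < s')%N -> coprime `|r'|%N s' -> inS g ->
     (Dq_iso (Vrs q r s f) (Vrs q r' s' g) <->
      [/\ r = r', s = s' & same_orbit q f g])) /\
  (* (i) classification of irreducibles *)
  (forall (V : vectType (LS k)) (Phi : V -> V),
     is_Dq_module (sigma_q q) Phi -> Dq_irreducible Phi ->
     exists (r : int) (s : nat) (f : {poly k}),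
       [/\ (0 < s)%N, coprime `|r|%N s, inS f & Dq_iso Phi (Vrs q r s f)]) /\
  (* (ii) decomposition after extension of scalars to kbar((t))_0 *)
  (forall (r : int) (s : nat) (f : {poly k}) (l : seq kbar),
     (0 < s)%N -> coprime `|r|%N s -> inS f ->
     uniq l -> (forall x : kbar, (x \in l) = root (map_poly iota f) x) ->
     Dq_iso_over (in_kbar0 iota) (ext_Vrs q kbar iota r s f)
                 (sum_Vlam q kbar iota r s l)) /\
  (* (iii) classification of indecomposables *)
  (forall (V : vectType (LS k)) (Phi : V -> V),
     is_Dq_module (sigma_q q) Phi -> Dq_indecomposable Phi ->
     exists (d : nat) (r : int) (s : nat) (f : {poly k}),
       [/\ (0 < d)%N, (0 < s)%N, coprime `|r|%N s, inS f &
           Dq_iso Phi (JV q d r s f)]) /\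
  (* (iii) uniqueness of the data (d, r, s, orbit of f) *)
  (forall (d : nat) (r : int) (s : nat) (f : {poly k})
          (d' : nat) (r' : int) (s' : nat) (g : {poly k}),
     (0 < d)%N -> (0 < s)%N -> coprime `|r|%N s -> inS f ->
     (0 < d')%N -> (0 < s')%N -> coprime `|r'|%N s' -> inS g ->
     Dq_iso (JV q d r s f) (JV q d' r' s' g) ->
     [/\ d = d', r = r', s = s' & same_orbit q f g]).
Proof.
move=> char0 q0 qnr _; split; last (split; last (split; last (split; last split))).
- move=> r s f s0 co fS; split; first exact: Vrs_is_Dq.
  exact: (Vrs_irreducible iota q0 qnr).
- move=> *; exact: (Vrs_iso_iff iota q0 qnr).
- exact: (irreducible_Vrs iota q0 qnr).
- move=> r s f l s0 co fS ul lE; exact: ext_Vrs_decomposition.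
- move=> V Phi /is_Dq_semilin [sl bij] ind.
  have [r [s [f [d [s0 co fS d0 iso]]]]] := indecomposable_primary iota q0 qnr sl bij ind.
  exists d, r, s, f; split=> //; apply: Dq_iso_trans (Dq_iso_sym iso) _.
  case: d d0 {iso} => // d _.
  exact: (JV_iso q0 char0 d s0 fS iota qnr co).
move=> d r s f d' r' s' g; case: d => // d d0 s0 co fS; case: d' => // d' d'0 s'0 co' gS iso.
apply: (primary_iso_data q0 qnr d0 s0 co fS d'0 s'0 co' gS).
apply: Dq_iso_trans (JV_iso q0 char0 d s0 fS iota qnr co) _.
apply: Dq_iso_trans iso (Dq_iso_sym _).
exact: (JV_iso q0 char0 d' s'0 gS iota qnr co').
Qed.
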